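(* Assume that the coefficients $b,c,d$ satisfy (C1), or (C2), or (C3) (the three cases described in the context). For all $U_0\in\mathcal{H}$, the evolution equation $U_t=\mathcal{A}U$, $U(0)=U_0$, admits a unique weak solution $U(t)=e^{t\mathcal{A}}U_0\in C^0(\mathbb{R}_+,\mathcal{H})$, where $(e^{t\mathcal{A}})_{t\ge0}$ is the $C_0$-semigroup generated by $\mathcal{A}$. Moreover, if $U_0\in D(\mathcal{A})$, then it admits a unique strong solution $U(t)=e^{t\mathcal{A}}U_0\in C^0(\mathbb{R}_+,D(\mathcal{A}))\cap C^1(\mathbb{R}_+,\mathcal{H})$.
   Context: All functions are complex valued; $\mathbb{R}_+=[0,\infty)$. Let $L>0$ and $a>0$ be constants, let $b_0,d_0>0$ and $c_0\in\mathbb{R}\setminus\{0\}$, and let $\chi_{(\alpha,\beta)}$ denote the indicator function of the interval $(\alpha,\beta)$. The three cases are: (C1) $b=b_0\chi_{(b_1,b_2)}$, $c=c_0\chi_{(c_1,c_2)}$, $d=d_0\chi_{(d_1,d_2)}$ with $0<b_1<b_2<c_1<c_2<d_1<d_2<L$. (C2) $b=b_0\chi_{(b_1,b_2)}$, $c=c_0\chi_{(c_1,c_2)}$, $d=d_0\chi_{(d_1,d_2)}$ with $0<b_1<b_2<d_1<d_2<c_1<c_2<L$. (C3) $b=b_0\chi_{(b_1,b_2)}$, $c=c_0\chi_{(c_1,c_2)}$, $d=0$ with $0<b_1<b_2<c_1<c_2<L$. The energy space is $\mathcal{H}=(H_0^1(0,L)\times L^2(0,L))^2$ with inner product $(U,U_1)_{\mathcal{H}}=\int_0^L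 v\overline{v_1}\,dx+a\int_0^L u_x\overline{(u_1)_x}\,dx+\int_0^L z\overline{z_1}\,dx+\int_0^L y_x\overline{(y_1)_x}\,dx$ for $U=(u,v,y,z)^\top$, $U_1=(u_1,v_1,y_1,z_1)^\top$. The operator $\mathcal{A}$ has domain $D(\mathcal{A})=\{(u,v,y,z)^\top\in\mathcal{H}: v,z\in H_0^1(0,L),\ (au_x+bv_x)_x\in L^2(0,L),\ (y_x+dz_x)_x\in L^2(0,L)\}$ (with the graph norm) and is given by $\mathcal{A}(u,v,y,z)^\top=(v,\ (au_x+bv_x)_x-cz,\ z,\ (y_x+dz_x)_x+cv)^\top$. The equation $U_t=\mathcal{A}U$ is the first order form, with $U=(u,u_t,y,y_t)^\top$, of the system $u_{tt}-(au_x+bu_{tx})_x+cy_t=0$, $y_{tt}-(y_x+dy_{tx})_x-cu_t=0$ on $(0,L)\times(0,\infty)$ with $u=y=0$ at $x=0,L$. ''Weak solution'' is meant in the usual (mild) semigroup sense. *)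

(* Defs.v *)
From HB Require Import structures.
From mathcomp Require Import all_boot all_order all_algebra.
From mathcomp Require Import generic_quotient ring_quotient ring lra.
From mathcomp Require Import all_classical all_reals all_analysis.
From mathcomp Require Import measurable_realfun.
From mathcomp Require Import complex.

Set Implicit Arguments.
Unset Strict Implicit.
Unset Printing Implicit Defensive.

Import Order.TTheory GRing.Theory Num.Theory.
Import numFieldNormedType.Exports.
Import ComplexField.Normc.

Local Open Scope classical_set_scope.
Local Open Scope ring_scope.
Local Open Scope complex_scope.
Local Open Scope quotient_scope.

Section ComplexFacts.
Variable R : realType.
Local Notation C := R[i].
Local Notation Re := (@complex.Re R).
Local Notation Im := (@complex.Im R).

Lemma normcsqE (z : C) : normc z ^+ 2 = Re z ^+ 2 + Im z ^+ 2.
Proof. by case: z => a b; rewrite /normc sqr_sqrtr// addr_ge0// sqr_ge0. Qed.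

Lemma normcsqD (z w : C) :
  normc (z + w) ^+ 2 <= 2 * normc z ^+ 2 + 2 * normc w ^+ 2.
Proof.
rewrite !normcsqE; case: z w => a b [c d] /=; rewrite -subr_ge0.
rewrite [leRHS](_ : _ = (a - c) ^+ 2 + (b - d) ^+ 2); last by ring.
by rewrite addr_ge0// sqr_ge0.
Qed.

Lemma normc_ge0 (z : C) : 0 <= normc z.
Proof. by case: z => a b; exact: sqrtr_ge0. Qed.

Lemma ReZ (k z : C) : Re (k * z) = Re k * Re z - Im k * Im z.
Proof. by case: k z => a b [c d]. Qed.

Lemma ImZ (k z : C) : Im (k * z) = Re k * Im z + Im k * Re z.
Proof. by case: k z => a b [c d]. Qed.

Lemma ReD (z w : C) : Re (z + w) = Re z + Re w.
Proof. by case: z w => a b [c d]. Qed.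

Lemma ImD (z w : C) : Im (z + w) = Im z + Im w.
Proof. by case: z w => a b [c d]. Qed.

Lemma complex_eq (z w : C) : Re z = Re w -> Im z = Im w -> z = w.
Proof. by case: z w => a b [c d] /= -> ->. Qed.

End ComplexFacts.

Section SquareIntegrable.
Variables (R : realType) (L : R).
Local Notation C := R[i].
Local Notation Re := (@complex.Re R).
Local Notation Im := (@complex.Im R).
Local Notation mu := (@lebesgue_measure R).
Local Notation I := (`]0, L[%classic : set (measurableTypeR R)).

Definition sqintegrable (f : R -> C) : Prop :=
  [/\ measurable_fun I (Re \o f), measurable_fun I (Im \o f) &
      mu.-integrable I (fun x => (normc (f x) ^+ 2)%:E)].

Definition sqint : {pred R -> C} := [pred f | `[< sqintegrable f >]].

Lemma sqintP f : reflect (sqintegrable f) (f \in sqint).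
Proof. exact: asboolP. Qed.

Lemma measurable_I : measurable I. Proof. exact: measurable_itv. Qed.
Local Hint Resolve measurable_I : core.

Lemma measurable_normcsq f : measurable_fun I (Re \o f) ->
  measurable_fun I (Im \o f) -> measurable_fun I (fun x => normc (f x) ^+ 2).
Proof.
move=> mr mi; rewrite (_ : (fun _ => _) =
  (fun x => (Re \o f) x ^+ 2 + (Im \o f) x ^+ 2)); last first.
  by apply/funext => x; rewrite normcsqE.
by apply: measurable_funD; apply: measurable_funX.
Qed.

Lemma sqint_submod_closed : submod_closed sqint.
Proof.
split.
  apply/sqintP; split; [exact: measurable_cst|exact: measurable_cst|].
  rewrite (_ : (fun _ => _) = cst 0%E); first exact: integrable0.
  by apply/funext => x; rewrite [normc _]normc0 expr0n.
move=> k f g /sqintP[fr fi ff] /sqintP[gr gi gg]; apply/sqintP.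
have mr : measurable_fun I (Re \o (k *: f + g)).
  rewrite (_ : Re \o _ = fun x => Re k * (Re \o f) x - Im k * (Im \o f) x
    + (Re \o g) x); last by apply/funext => x /=; rewrite ReD ReZ.
  by apply: measurable_funD => //; apply: measurable_funB => //;
    apply: measurable_funM => //; exact: measurable_cst.
have mi : measurable_fun I (Im \o (k *: f + g)).
  rewrite (_ : Im \o _ = fun x => Re k * (Im \o f) x + Im k * (Re \o f) x
    + (Im \o g) x); last by apply/funext => x /=; rewrite ImD ImZ.
  by apply: measurable_funD => //; apply: measurable_funD => //;
    apply: measurable_funM => //; exact: measurable_cst.
split => //.
have kk := integrableZl measurable_I (2 * normc k ^+ 2) ff.
have k2 := integrableZl measurable_I 2 gg.
apply: (le_integrable _ _ _ (integrableD _ kk k2)) => //.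
- by apply/measurable_EFinP; exact: measurable_normcsq.
- move=> x _; rewrite /= lee_fin.
  rewrite !ger0_norm ?addr_ge0 ?mulr_ge0 ?exprn_ge0 ?normc_ge0//.
  by apply: (le_trans (normcsqD _ _)); rewrite normcM exprMn mulrA.
Qed.

HB.instance Definition _ :=
  GRing.isSubmodClosed.Build C (R -> C) sqint sqint_submod_closed.

Record sqfun := Sqfun { sqfun_val :> R -> C; sqfunP : sqfun_val \in sqint }.
HB.instance Definition _ := [isSub for sqfun_val].
HB.instance Definition _ := [Choice of sqfun by <:].
HB.instance Definition _ := [SubChoice_isSubLmodule of sqfun by <:].

(* only the values on ]0, L[ matter: L^2(0, L) is the quotient of the square
   integrable functions by those vanishing a.e. on ]0, L[ *)
Definition aenull : {pred sqfun} :=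
  [pred f : sqfun | `[< (f : R -> C) = 0 %[ae mu in I] >]].

Lemma aenull_submod_closed : submod_closed aenull.
Proof.
split; first by apply/asboolP; apply: nearW.
move=> k f g /asboolP f0 /asboolP g0; apply/asboolP.
apply: filterS2 f0 g0 => x fx gx Ix.
by rewrite [LHS](_ : _ = k * f x + g x)// fx// gx// mulr0 addr0.
Qed.

HB.instance Definition _ :=
  GRing.isSubmodClosed.Build C sqfun aenull aenull_submod_closed.

Definition L2 : Type := {ideal_quot aenull}.
HB.instance Definition _ := GRing.Zmodule.on L2.
HB.instance Definition _ := Choice.on L2.
HB.instance Definition _ := EqQuotient.on L2.

Lemma pi_L2D (f g : sqfun) : \pi_L2 (f + g) = \pi_L2 f + \pi_L2 g :> L2.
Proof. exact: Quotient.pi_add. Qed.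

Definition scaleL2 (k : C) (f : L2) : L2 := \pi_L2 (k *: repr f).

Lemma pi_scaleL2 k (f : sqfun) : scaleL2 k (\pi_L2 f) = \pi_L2 (k *: f).
Proof.
apply/eqP; rewrite -Quotient.idealrBE -scalerBr.
apply: rpredZ; rewrite Quotient.idealrBE; apply/eqP; exact: reprK.
Qed.

Let scaleA a b (f : L2) : scaleL2 a (scaleL2 b f) = scaleL2 (a * b) f.
Proof. by rewrite -[f]reprK !pi_scaleL2 scalerA reprK. Qed.
Let scale1 : left_id 1 scaleL2.
Proof. by move=> f; rewrite /scaleL2 scale1r reprK. Qed.
Let scaleDr : right_distributive scaleL2 +%R.
Proof.
move=> k f g; rewrite -[f]reprK -[g]reprK.
have E (u v : sqfun) : scaleL2 k (\pi_L2 u + \pi_L2 v) =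
    scaleL2 k (\pi_L2 u) + scaleL2 k (\pi_L2 v).
  by rewrite -(pi_L2D u v) !pi_scaleL2 scalerDr pi_L2D.
exact: E.
Qed.
Let scaleDl (f : L2) : {morph scaleL2^~ f : a b / a + b}.
Proof. by move=> a b; rewrite /scaleL2 scalerDl pi_L2D. Qed.

HB.instance Definition _ := GRing.Zmodule_isLmodule.Build C L2
  scaleA scale1 scaleDr scaleDl.

Definition L2_fun (f : L2) : R -> C := sqfun_val (repr f).
Coercion L2_fun : L2 >-> Funclass.

(* the class of f if f is square integrable, and 0 otherwise *)
Definition toL2 (f : R -> C) : L2 := \pi_L2 (insubd 0 f).

Definition cint (f : R -> C) : C :=
  (\int[mu]_(x in I) Re (f x)) +i* (\int[mu]_(x in I) Im (f x)).

Definition ipL2 (f g : L2) : C := cint (fun x => f x * (g x)^*).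
Definition normL2 (f : L2) : R := Num.sqrt (Re (ipL2 f f)).

Definition smooth (f : R -> R) : Prop := forall n x, derivable (derive1n n f) x 1.

Definition test_fun (phi : R -> C) : Prop :=
  [/\ smooth (Re \o phi), smooth (Im \o phi) &
      exists K : set R, [/\ compact K, K `<=` `]0, L[%classic &
                            forall x, ~ K x -> phi x = 0]].

Definition cderiv (phi : R -> C) : R -> C :=
  fun x => derive1 (Re \o phi) x +i* derive1 (Im \o phi) x.

(* g is the distributional derivative of f on ]0, L[ *)
Definition is_wderiv (f g : L2) : Prop := forall phi, test_fun phi ->
  cint (fun x => f x * cderiv phi x) = - cint (fun x => g x * phi x).

Definition inH1 (f : L2) : Prop := exists g : L2, is_wderiv f g.

(* a weak derivative is unique in L^2 when it exists (the test functions are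
   dense), so the choice made by xget is immaterial on H^1; the value 0 outside
   of H^1 is a default *)
Definition wderiv (f : L2) : L2 := xget 0 [set g : L2 | is_wderiv f g].

(* the closure of the test functions in H^1(0, L) *)
Definition inH10 (f : L2) : Prop := exists g : L2, is_wderiv f g /\
  exists phi : nat -> R -> C,
    [/\ forall n, test_fun (phi n),
        normL2 (toL2 (phi n) - f) @[n --> \oo] --> (0 : R) &
        normL2 (toL2 (cderiv (phi n)) - g) @[n --> \oo] --> (0 : R)].

Lemma repr_pi_ae (f : sqfun) : L2_fun (\pi_L2 f) = f %[ae mu in I].
Proof.
have : (repr (\pi_L2 f) - f) \in aenull.
  by rewrite Quotient.idealrBE; apply/eqP; rewrite reprK.
move=> /asboolP; apply: filterS => x + Ix => /(_ Ix) fx.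
apply/eqP; rewrite -subr_eq0; apply/eqP.
by rewrite -[RHS]fx.
Qed.

Lemma L2_funZD_ae k (f g : L2) :
  L2_fun (k *: f + g) = (fun x => k * f x + g x) %[ae mu in I].
Proof.
have -> : k *: f + g = \pi_L2 (k *: repr f + repr g).
  by rewrite pi_L2D reprK.
exact: repr_pi_ae.
Qed.

Lemma toL2ZD k phi psi : phi \in sqint -> psi \in sqint ->
  toL2 (k *: phi + psi) = k *: toL2 phi + toL2 psi.
Proof.
move=> p q; rewrite /toL2.
rewrite -[X in _ = X + _](esym (pi_scaleL2 k (insubd 0 phi))) -pi_L2D.
congr (\pi_L2 _).
apply: val_inj; rewrite /= !insubdK//.
by apply: rpredD => //; apply: rpredZ.
Qed.

Lemma L2_sqint (f : L2) : (f : R -> C) \in sqint.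
Proof. exact: valP. Qed.

Lemma normcM_le (z w : C) : normc (z * w) <= normc z ^+ 2 + normc w ^+ 2.
Proof.
rewrite normcM; have := normc_ge0 z; have := normc_ge0 w.
move: (normc z) (normc w) => a b *; nra.
Qed.

Lemma Re_le_normc (z : C) : `|Re z| <= normc z.
Proof.
rewrite -[leRHS]ger0_norm ?normc_ge0// -ler_sqr ?nnegrE// !real_normK ?num_real//.
by rewrite normcsqE lerDl sqr_ge0.
Qed.

Lemma Im_le_normc (z : C) : `|Im z| <= normc z.
Proof.
rewrite -[leRHS]ger0_norm ?normc_ge0// -ler_sqr ?nnegrE// !real_normK ?num_real//.
by rewrite normcsqE lerDr sqr_ge0.
Qed.

Lemma measurable_ReM (f g : R -> C) : f \in sqint -> g \in sqint ->
  measurable_fun I (fun x => Re (f x * g x)).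
Proof.
move=> /sqintP[fr fi ff] /sqintP[gr gi gg].
have -> : (fun x => Re (f x * g x)) =
  (fun x => (Re \o f) x * (Re \o g) x - (Im \o f) x * (Im \o g) x).
  by apply/funext => x; rewrite ReZ.
by apply: measurable_funB; apply: measurable_funM.
Qed.

Lemma measurable_ImM (f g : R -> C) : f \in sqint -> g \in sqint ->
  measurable_fun I (fun x => Im (f x * g x)).
Proof.
move=> /sqintP[fr fi ff] /sqintP[gr gi gg].
have -> : (fun x => Im (f x * g x)) =
  (fun x => (Re \o f) x * (Im \o g) x + (Im \o f) x * (Re \o g) x).
  by apply/funext => x; rewrite ImZ.
by apply: measurable_funD; apply: measurable_funM.
Qed.

Lemma integrable_ReM (f g : R -> C) : f \in sqint -> g \in sqint ->
  mu.-integrable I (EFin \o (fun x => Re (f x * g x))).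
Proof.
move=> fs gs; have /sqintP[fr fi ff] := fs; have /sqintP[gr gi gg] := gs.
apply: (le_integrable _ _ _ (integrableD _ ff gg)) => //.
- by apply/measurable_EFinP; exact: measurable_ReM.
- move=> x _; rewrite /= lee_fin.
  rewrite [leRHS]ger0_norm ?addr_ge0 ?exprn_ge0 ?normc_ge0//.
  exact: (le_trans (Re_le_normc _) (normcM_le _ _)).
Qed.

Lemma integrable_ImM (f g : R -> C) : f \in sqint -> g \in sqint ->
  mu.-integrable I (EFin \o (fun x => Im (f x * g x))).
Proof.
move=> fs gs; have /sqintP[fr fi ff] := fs; have /sqintP[gr gi gg] := gs.
apply: (le_integrable _ _ _ (integrableD _ ff gg)) => //.
- by apply/measurable_EFinP; exact: measurable_ImM.
- move=> x _; rewrite /= lee_fin.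
  rewrite [leRHS]ger0_norm ?addr_ge0 ?exprn_ge0 ?normc_ge0//.
  exact: (le_trans (Im_le_normc _) (normcM_le _ _)).
Qed.

Lemma eq_cint_ae (f g : R -> C) :
  measurable_fun I (Re \o f) -> measurable_fun I (Im \o f) ->
  measurable_fun I (Re \o g) -> measurable_fun I (Im \o g) ->
  f = g %[ae mu in I] -> cint f = cint g.
Proof.
move=> fr fi gr gi fg; rewrite /cint /Rintegral.
congr (fine _ +i* fine _); apply: ae_eq_integral => //.
- exact/measurable_EFinP.
- exact/measurable_EFinP.
- by apply: filterS fg => x /[apply] ->.
- exact/measurable_EFinP.
- exact/measurable_EFinP.
- by apply: filterS fg => x /[apply] ->.
Qed.

Lemma cintZD k (f g h : R -> C) : f \in sqint -> g \in sqint -> h \in sqint ->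
  cint (fun x => (k * f x + g x) * h x) =
  k * cint (fun x => f x * h x) + cint (fun x => g x * h x).
Proof.
move=> fs gs hs; have r1 := integrable_ReM fs hs; have i1 := integrable_ImM fs hs.
have r2 := integrable_ReM gs hs; have i2 := integrable_ImM gs hs.
have Z c (u : R -> R) : mu.-integrable I (EFin \o u) ->
    mu.-integrable I (EFin \o (fun x => c * u x)).
  by move=> iu; have := integrableZl measurable_I c iu; apply: eq_integrable.
have D (u v : R -> R) : mu.-integrable I (EFin \o u) ->
    mu.-integrable I (EFin \o v) ->
    mu.-integrable I (EFin \o (fun x => u x + v x)).
  by move=> iu iv; have := integrableD measurable_I iu iv; apply: eq_integrable.
apply: complex_eq.
  rewrite ReD ReZ /=.
  rewrite -!RintegralZl// -RintegralB//; [|exact: Z..].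
  rewrite -RintegralD//.
    by apply: eq_Rintegral => x _; rewrite mulrDl -mulrA ReD ReZ.
  have := D _ _ (Z (Re k) _ r1) (Z (- Im k) _ i1); apply: eq_integrable => // x _ /=.
  by rewrite mulNr.
rewrite ImD ImZ /=.
rewrite -!RintegralZl// -RintegralD//; [|exact: Z..].
rewrite -RintegralD//; first by apply: eq_Rintegral => x _; rewrite mulrDl -mulrA ImD ImZ.
exact: D (Z _ _ _) (Z _ _ _).
Qed.

Lemma normL2E (f : L2) :
  normL2 f = Num.sqrt (\int[mu]_(x in I) (normc (f x) ^+ 2)).
Proof.
congr Num.sqrt; rewrite /ipL2 /=; apply: eq_Rintegral => x _.
by rewrite normcsqE ReZ; case: (f x) => a b /=; rewrite mulrN opprK !expr2.
Qed.

Lemma normL2_ZD k (f g : L2) :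
  normL2 (k *: f + g) <= Num.sqrt 2 * (normc k * normL2 f + normL2 g).
Proof.
have intn (u : L2) : mu.-integrable I (EFin \o (fun x => normc (u x) ^+ 2)).
  by have /sqintP[_ _] := L2_sqint u.
have Z c (u : L2) :
    mu.-integrable I (EFin \o (fun x => c * normc (u x) ^+ 2)).
  by have := integrableZl measurable_I c (intn u); apply: eq_integrable.
pose F (u : L2) := \int[mu]_(x in I) (normc (u x) ^+ 2).
have F0 u : 0 <= F u by apply: Rintegral_ge0 => x _; exact: sqr_ge0.
have FE u : normL2 u ^+ 2 = F u by rewrite normL2E sqr_sqrtr; [|exact: F0].
have leF : F (k *: f + g) <= 2 * normc k ^+ 2 * F f + 2 * F g.
  rewrite /F -!RintegralZl// -RintegralD//; [|exact: Z..].
  have iD : mu.-integrable I (EFin \o (fun x =>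
      2 * normc k ^+ 2 * normc (f x) ^+ 2 + 2 * normc (g x) ^+ 2)).
    have := integrableD measurable_I (Z (2 * normc k ^+ 2) f) (Z 2 g).
    exact: eq_integrable.
  have sqZD : (fun x => k * f x + g x) \in sqint.
    apply: (@rpredD _ sqint (k *: (f : R -> C)) (g : R -> C)).
      by apply: rpredZ; exact: L2_sqint.
    exact: L2_sqint.
  have /sqintP[mr mi _] := sqZD.
  have /sqintP[mr' mi' _] := L2_sqint (k *: f + g).
  have -> : \int[mu]_(x in I) (normc (L2_fun (k *: f + g) x) ^+ 2) =
            \int[mu]_(x in I) (normc (k * f x + g x) ^+ 2).
    congr fine; apply: ae_eq_integral => //.
    - by apply/measurable_EFinP; exact: measurable_normcsq.
    - by apply/measurable_EFinP; exact: (measurable_normcsq mr mi).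
    - by apply: filterS (L2_funZD_ae k f g) => x /[apply] /= ->.
  apply: le_Rintegral => //.
    by have /sqintP[_ _] := sqZD.
  move=> x _; apply: (le_trans (normcsqD _ _)).
  by rewrite normcM exprMn mulrA.
rewrite normL2E -[leRHS]ger0_norm; last first.
  by rewrite mulr_ge0 ?sqrtr_ge0// addr_ge0 ?mulr_ge0 ?normc_ge0 ?sqrtr_ge0.
rewrite -sqrtr_sqr ler_wsqrtr//; apply: (le_trans leF).
rewrite exprMn sqr_sqrtr// -!FE.
have : 0 <= normc k * normL2 f * normL2 g.
  by rewrite !mulr_ge0 ?normc_ge0 ?sqrtr_ge0.
move: (normc k) (normL2 f) (normL2 g) => a b c; nra.
Qed.

Lemma smooth_lin a b (f g : R -> R) : smooth f -> smooth g ->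
  smooth (a *: f + b *: g).
Proof.
move=> sf sg.
have E n : derive1n n (a *: f + b *: g) = a *: derive1n n f + b *: derive1n n g.
  elim: n => [//|n IH]; rewrite !derive1nS IH; apply/funext => x.
  rewrite derive1E deriveD; [|exact/derivableZ/sf|exact/derivableZ/sg].
  by rewrite !deriveZ//= -!derive1E.
by move=> n x; rewrite E; apply: derivableD; apply: derivableZ.
Qed.

Lemma smooth_derive1 f : smooth f -> smooth (derive1 f).
Proof. by move=> sf n x; have := sf n.+1 x; rewrite derive1Sn. Qed.

Lemma smooth_cont f : smooth f -> continuous f.
Proof.
move=> sf x; apply: differentiable_continuous; apply/derivable1_diffP.
exact: (sf 0%N).
Qed.

Lemma cont_sqint (phi : R -> C) : continuous (Re \o phi) ->
  continuous (Im \o phi) -> phi \in sqint.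
Proof.
move=> cr ci; apply/sqintP; split.
- by apply: measurable_funTS; exact: continuous_measurable_fun.
- by apply: measurable_funTS; exact: continuous_measurable_fun.
have IJ : I `<=` (`[0, L]%classic : set (measurableTypeR R)).
  by move=> x /=; rewrite !in_itv/= => /andP[? ?]; rewrite !ltW.
have mJ : measurable (`[0, L]%classic : set (measurableTypeR R)).
  exact: measurable_itv.
apply: (integrableS mJ) => //.
apply: (@continuous_compact_integrable R (fun x => normc (phi x) ^+ 2)).
  exact: segment_compact.
have -> : (fun x => normc (phi x) ^+ 2) =
    (fun x => (Re \o phi) x * (Re \o phi) x +
              (Im \o phi) x * (Im \o phi) x) :> (R -> R).
  by apply/funext => x; rewrite normcsqE !expr2.
apply: continuous_subspaceT => x.
by apply: cvgD; apply: cvgM; [exact: cr|exact: cr|exact: ci|exact: ci].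
Qed.

Lemma test_sqint phi : test_fun phi -> phi \in sqint.
Proof. by move=> [sr si _]; apply: cont_sqint; exact: smooth_cont. Qed.

Lemma cderiv_sqint phi : test_fun phi -> cderiv phi \in sqint.
Proof.
by move=> [/smooth_derive1/smooth_cont sr /smooth_derive1/smooth_cont si _];
  exact: cont_sqint.
Qed.

Lemma Re_ZD k (phi psi : R -> C) : Re \o (k *: phi + psi) =
  (1 : R) *: (Re k *: (Re \o phi) + (- Im k) *: (Im \o phi)) + 1 *: (Re \o psi).
Proof.
apply/funext => x; rewrite /= ReD ReZ.
by rewrite -[RHS]/(1 * (Re k * Re (phi x) + - Im k * Im (phi x)) + 1 * Re (psi x))
  !mul1r mulNr.
Qed.

Lemma Im_ZD k (phi psi : R -> C) : Im \o (k *: phi + psi) =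
  (1 : R) *: (Re k *: (Im \o phi) + Im k *: (Re \o phi)) + 1 *: (Im \o psi).
Proof.
apply/funext => x; rewrite /= ImD ImZ.
by rewrite -[RHS]/(1 * (Re k * Im (phi x) + Im k * Re (phi x)) + 1 * Im (psi x))
  !mul1r.
Qed.

Lemma test_ZD k phi psi : test_fun phi -> test_fun psi ->
  test_fun (k *: phi + psi).
Proof.
move=> [rf ifi [K [cK KI K0]]] [rg ig [K' [cK' KI' K0']]]; split.
- by rewrite Re_ZD; apply: smooth_lin => //; exact: smooth_lin.
- by rewrite Im_ZD; apply: smooth_lin => //; exact: smooth_lin.
exists (K `|` K'); split; first exact: compactU.
  by rewrite subUset.
move=> x /not_orP[/K0 p0 /K0' q0].
by rewrite -[LHS]/(k * phi x + psi x) p0 q0 mulr0 addr0.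
Qed.

Lemma test_0 : test_fun 0.
Proof.
have s0 : smooth (cst 0).
  have E n : derive1n n (cst (0 : R) : R -> R) = cst 0.
    by elim: n => [//|n IH]; rewrite derive1nS IH; apply/funext => x; rewrite derive1_cst.
  by move=> n x; rewrite E; exact: derivable_cst.
by split=> //; exists set0; split => //; exact: compact0.
Qed.

Lemma derive1_lin a b (f g : R -> R) : smooth f -> smooth g ->
  derive1 (a *: f + b *: g) = a *: derive1 f + b *: derive1 g.
Proof.
move=> /(_ 0%N) sf /(_ 0%N) sg; apply/funext => x.
rewrite derive1E deriveD; [|exact/derivableZ/sf|exact/derivableZ/sg].
by rewrite !deriveZ//= -!derive1E.
Qed.

Lemma cderiv_ZD k phi psi : test_fun phi -> test_fun psi ->
  cderiv (k *: phi + psi) = k *: cderiv phi + cderiv psi.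
Proof.
move=> [rf ifi _] [rg ig _]; apply/funext => x.
rewrite -[RHS]/(k * cderiv phi x + cderiv psi x) /cderiv.
apply: complex_eq.
  rewrite ReD ReZ/= Re_ZD derive1_lin//; last exact: smooth_lin.
  rewrite [derive1 (_ + _)]derive1_lin//.
  set a := derive1 _; set b := derive1 _; set c := derive1 _.
  by rewrite -[LHS]/(1 * (Re k * a x + - Im k * b x) + 1 * c x) !mul1r mulNr.
rewrite ImD ImZ/= Im_ZD derive1_lin//; last exact: smooth_lin.
rewrite [derive1 (_ + _)]derive1_lin//.
set a := derive1 _; set b := derive1 _; set c := derive1 _.
by rewrite -[LHS]/(1 * (Re k * a x + Im k * b x) + 1 * c x) !mul1r.
Qed.

Lemma cint_L2ZD k (f g : L2) h : h \in sqint ->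
  cint (fun x => L2_fun (k *: f + g) x * h x) =
  k * cint (fun x => f x * h x) + cint (fun x => g x * h x).
Proof.
move=> hs; rewrite -cintZD ?L2_sqint//.
have sqZD : (fun x => k * f x + g x) \in sqint.
  apply: (@rpredD _ sqint (k *: (f : R -> C)) (g : R -> C)).
    by apply: rpredZ; exact: L2_sqint.
  exact: L2_sqint.
apply: eq_cint_ae.
- exact: (measurable_ReM (L2_sqint _) hs).
- exact: (measurable_ImM (L2_sqint _) hs).
- exact: (measurable_ReM sqZD hs).
- exact: (measurable_ImM sqZD hs).
- by apply: filterS (L2_funZD_ae k f g) => x /[apply] ->.
Qed.

Lemma is_wderiv_ZD k f f' g g' : is_wderiv f f' -> is_wderiv g g' ->
  is_wderiv (k *: f + g) (k *: f' + g').
Proof.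
move=> wf wg phi tp; have s0 := test_sqint tp; have s1 := cderiv_sqint tp.
rewrite !cint_L2ZD//.
by rewrite wf// wg// mulrN opprD.
Qed.

Lemma normL2_lin_cvg k (f_ g_ : nat -> L2) :
  normL2 (f_ n) @[n --> \oo] --> (0 : R) ->
  normL2 (g_ n) @[n --> \oo] --> (0 : R) ->
  normL2 (k *: f_ n + g_ n) @[n --> \oo] --> (0 : R).
Proof.
move=> f0 g0.
apply: (@squeeze_cvgr _ _ _ _ (cst 0)
  (fun n => Num.sqrt 2 * (normc k * normL2 (f_ n) + normL2 (g_ n)))).
- by apply: nearW => n; rewrite normL2_ZD sqrtr_ge0.
- exact: cvg_cst.
rewrite [X in _ --> X](_ : 0 = Num.sqrt 2 * (normc k * 0 + 0)); last first.
  by rewrite mulr0 addr0 mulr0.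
by apply: cvgMr; apply: cvgD => //; apply: cvgMr.
Qed.

Definition H10pred : {pred L2} := [pred f : L2 | `[< inH10 f >]].

Lemma toL2_0 : toL2 0 = 0.
Proof.
have s0 := test_sqint test_0; have := toL2ZD (-1) s0 s0.
by rewrite scaler0 add0r scaleN1r addNr.
Qed.

Lemma cderiv_0 : cderiv 0 = 0.
Proof.
have := cderiv_ZD (-1) test_0 test_0.
by rewrite scaler0 add0r scaleN1r addNr.
Qed.

Lemma normL2_0 : normL2 0 = 0.
Proof.
have /sqintP[mr mi _] := L2_sqint 0.
rewrite normL2E /Rintegral (_ : (\int[_]_(_ in _) _)%E = 0%E) ?sqrtr0//.
rewrite (ae_eq_integral (cst 0%E)) ?integral0//.
- by apply/measurable_EFinP; exact: measurable_normcsq.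
- have := L2_funZD_ae (-1) 0 0; rewrite scaler0 addr0.
  apply: filterS => x /[apply] ->.
  by rewrite mulN1r addNr /cst [normc _]normc0 expr0n.
Qed.

Lemma is_wderiv_0 : is_wderiv 0 0.
Proof.
have c0 h : h \in sqint -> cint (fun x => L2_fun 0 x * h x) = 0.
  move=> hs; have := cint_L2ZD (-1) 0 0 hs.
  by rewrite scaler0 add0r mulN1r addNr.
by move=> phi tp; rewrite !c0 ?oppr0//; [exact: test_sqint|exact: cderiv_sqint].
Qed.

Lemma H10_submod_closed : submod_closed H10pred.
Proof.
split.
  apply/asboolP; exists 0; split; first exact: is_wderiv_0.
  exists (fun=> 0); split; [by move=> n; exact: test_0|..].
    by rewrite toL2_0 subr0 normL2_0; exact: cvg_cst.
  by rewrite cderiv_0 toL2_0 subr0 normL2_0; exact: cvg_cst.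
move=> k f g /asboolP[f' [wf [p [tp pf pf']]]] /asboolP[g' [wg [q [tq qf qg']]]].
apply/asboolP; exists (k *: f' + g'); split; first exact: is_wderiv_ZD.
exists (fun n => k *: p n + q n); split.
- by move=> n; exact: test_ZD.
- have := normL2_lin_cvg k pf qf; apply: cvg_trans.
  apply: near_eq_cvg; apply: nearW => n.
  by rewrite toL2ZD ?test_sqint// scalerBr opprD addrACA.
- have := normL2_lin_cvg k pf' qg'; apply: cvg_trans.
  apply: near_eq_cvg; apply: nearW => n.
  rewrite cderiv_ZD// toL2ZD ?cderiv_sqint//.
  by rewrite scalerBr opprD addrACA.
Qed.

HB.instance Definition _ :=
  GRing.isSubmodClosed.Build C (L2) H10pred H10_submod_closed.

End SquareIntegrable.

Section EnergySpace.
Variables (R : realType) (L : R).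
Local Notation C := R[i].
Local Notation Re := (@complex.Re R).

Record H10 := MkH10 { H10_val :> L2 L; H10P : H10_val \in @H10pred R L }.
HB.instance Definition _ := [isSub for H10_val].
HB.instance Definition _ := [Choice of H10 by <:].
HB.instance Definition _ := [SubChoice_isSubLmodule of H10 by <:].

Definition Hspace : Type := ((H10 * L2 L) * (H10 * L2 L))%type.
HB.instance Definition _ := GRing.Lmodule.on Hspace.

(* U = (u, v, y, z) is encoded as ((u, v), (y, z)) *)
Definition Hu (U : Hspace) : H10 := U.1.1.
Definition Hv (U : Hspace) : L2 L := U.1.2.
Definition Hy (U : Hspace) : H10 := U.2.1.
Definition Hz (U : Hspace) : L2 L := U.2.2.

Definition ipH (a : R) (U U1 : Hspace) : C :=
  ipL2 (Hv U) (Hv U1) + a%:C * ipL2 (wderiv (Hu U)) (wderiv (Hu U1))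
  + ipL2 (Hz U) (Hz U1) + ipL2 (wderiv (Hy U)) (wderiv (Hy U1)).

Definition normH (a : R) (U : Hspace) : R := Num.sqrt (Re (ipH a U U)).

Definition mulL2 (m : R -> R) (f : L2 L) : L2 L :=
  toL2 L (fun x => (m x)%:C * f x).

Definition flux1 (a : R) (b : R -> R) (U : Hspace) : L2 L :=
  a%:C *: wderiv (Hu U) + mulL2 b (wderiv (Hv U)).
Definition flux2 (d : R -> R) (U : Hspace) : L2 L :=
  wderiv (Hy U) + mulL2 d (wderiv (Hz U)).

Definition domA (a : R) (b d : R -> R) : set Hspace :=
  [set U | [/\ inH10 (Hv U), inH10 (Hz U), inH1 (flux1 a b U)
             & inH1 (flux2 d U)]].

(* on domA the components v and z lie in H10, so insubd does not default to 0 *)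
Definition opA (a : R) (b c d : R -> R) (U : Hspace) : Hspace :=
  ((insubd (0 : H10) (Hv U), wderiv (flux1 a b U) - mulL2 c (Hz U)),
   (insubd (0 : H10) (Hz U), wderiv (flux2 d U) + mulL2 c (Hv U))).

Definition ind (m0 m1 m2 : R) : R -> R := fun x => m0 * \1_(`]m1, m2[%classic) x.

Definition caseC1 (b c d : R -> R) : Prop :=
  exists b0 b1 b2 c0 c1 c2 d0 d1 d2 : R,
    [/\ [/\ 0 < b0, c0 != 0 & 0 < d0],
        [/\ 0 < b1, b1 < b2, b2 < c1 & c1 < c2],
        [/\ c2 < d1, d1 < d2 & d2 < L]
      & [/\ b = ind b0 b1 b2, c = ind c0 c1 c2 & d = ind d0 d1 d2]].

Definition caseC2 (b c d : R -> R) : Prop :=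
  exists b0 b1 b2 c0 c1 c2 d0 d1 d2 : R,
    [/\ [/\ 0 < b0, c0 != 0 & 0 < d0],
        [/\ 0 < b1, b1 < b2, b2 < d1 & d1 < d2],
        [/\ d2 < c1, c1 < c2 & c2 < L]
      & [/\ b = ind b0 b1 b2, c = ind c0 c1 c2 & d = ind d0 d1 d2]].

Definition caseC3 (b c d : R -> R) : Prop :=
  exists b0 b1 b2 c0 c1 c2 : R,
    [/\ 0 < b0 /\ c0 != 0,
        [/\ 0 < b1, b1 < b2, b2 < c1, c1 < c2 & c2 < L]
      & [/\ b = ind b0 b1 b2, c = ind c0 c1 c2 & d = cst 0]].

End EnergySpace.

Section Semigroups.
(* V need not carry a canonical normed structure: convergence is taken with
   respect to an explicit norm N, to be instantiated with the energy norm *)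
Variables (R : realType) (V : lmodType R[i]).
Implicit Types (N : V -> R) (U : R -> V) (A : V -> V) (D : set V)
  (T : R -> V -> V).

(* R_+ = [0, +oo[; the values of U at negative times are irrelevant *)
Definition continuous_Rp N U : Prop := forall t, 0 <= t ->
  N (U s - U t) @[s --> within [set s : R | 0 <= s] (nbhs t)] --> (0 : R).

(* one-sided at t = 0 *)
Definition derivative_Rp N U (t : R) (W : V) : Prop :=
  N (h^-1%:C *: (U (t + h) - U t) - W)
    @[h --> within [set h : R | 0 <= t + h] (0 : R)^'] --> (0 : R).

Definition C1_Rp N U : Prop := exists U' : R -> V,
  (forall t, 0 <= t -> derivative_Rp N U t (U' t)) /\ continuous_Rp N U'.

Definition C0_semigroup N T : Prop :=
  [/\ forall t, 0 <= t ->
        (forall k x y, T t (k *: x + y) = k *: T t x + T t y) /\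
        (exists M : R, forall x, N (T t x) <= M * N x),
      forall x, T 0 x = x,
      forall s t x, 0 <= s -> 0 <= t -> T (s + t) x = T s (T t x)
    & forall x, N (T t x - x) @[t --> (0 : R)^'+] --> (0 : R)].

Definition generator N T (x w : V) : Prop :=
  N (h^-1%:C *: (T h x - x) - w) @[h --> (0 : R)^'+] --> (0 : R).

Definition generated_by N D A T : Prop := C0_semigroup N T /\
  forall x w, generator N T x w <-> D x /\ A x = w.

(* J is the Riemann integral of U over [0, t]: xi tags the partition s *)
Definition is_integral N U (t : R) (J : V) : Prop :=
  forall e : R, 0 < e -> exists2 delta : R, 0 < delta &
  forall (n : nat) (s xi : nat -> R), s 0%N = 0 -> s n = t ->
    (forall i, (i < n)%N ->
       [/\ s i <= xi i, xi i <= s i.+1 & s i.+1 - s i < delta]) ->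
    N (\sum_(i < n) (s i.+1 - s i)%:C *: U (xi i) - J) < e.

(* the mild solutions: U(t) = U0 + A (int_0^t U) with int_0^t U in D(A) *)
Definition weak_solution N D A (U0 : V) U : Prop :=
  continuous_Rp N U /\
  forall t, 0 <= t -> exists J,
    [/\ is_integral N U t J, D J & U t = U0 + A J].

Definition graph_norm N A (x : V) : R := N x + N (A x).

Definition strong_solution N D A (U0 : V) U : Prop :=
  [/\ U 0 = U0,
      (forall t, 0 <= t -> D (U t)) /\ continuous_Rp (graph_norm N A) U,
      C1_Rp N U
    & forall t, 0 <= t -> derivative_Rp N U t (A (U t))].

End Semigroups.

(* Main.v *)
(* The energy identity gives [Re (A U, U) = - \int b |v_x|^2 - \int d |z_x|^2 <= 0],
   the two coupling terms in [c] cancelling.  Moreover [A] is onto with a bounded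
   inverse: [A U = F] prescribes [v] and [z] and leaves two Dirichlet problems
   [(s u_x + p)_x = h] for [u] and [y], solvable by the Riesz representation
   theorem and the Poincare inequality in [H_0^1].  A dissipative operator that is
   onto with a bounded inverse has [l - A] onto for all [l > 0] and a dense domain,
   and [e^(t A)] is the limit of the implicit Euler approximations with dyadic
   steps.  Dissipativity makes the norm of a strong solution nonincreasing, whence
   uniqueness; two mild solutions differ by [W = A J] with [J = \int_0^t W], and [J]
   is a strong solution starting at [0].  Uniform boundedness gives local bounds
   for an arbitrary semigroup generated by [A], whose orbits in the domain are
   then strong solutions, so that it is [e^(t A)]. *)
Require Import Defs.
From HB Require Import structures.
From mathcomp Require Import all_boot all_order all_algebra.
From mathcomp Require Import generic_quotient ring lra.
From mathcomp Require Import all_classical all_reals all_analysis.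
From mathcomp Require Import measurable_realfun.
From mathcomp Require Import complex.

Set Implicit Arguments.
Unset Strict Implicit.
Unset Printing Implicit Defensive.

Import Order.TTheory GRing.Theory Num.Theory.
Import numFieldNormedType.Exports.
Import ComplexField.Normc.
Local Open Scope classical_set_scope.
Local Open Scope ring_scope.
Local Open Scope complex_scope.
Local Open Scope quotient_scope.

(** * Inner products, norms and the Riesz representation *)

(** The damping coefficients [b] and [d] jump and vanish on parts of the interval, so [u_x] and
    [v_x] need not be weakly differentiable one by one: the domain controls only the combined
    fluxes. A flux is therefore never split under a derivative; it is used through integration by
    parts against H_0^1. This is also why [A] is inverted rather than [l - A]: once [v] and [z] are
    prescribed, [(b v_x)_x] and [(d z_x)_x] are known data, and the remaining problems for [u] and
    [y] have the constant coefficients [a] and [1]. Surjectivity serves a second time for mild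
    solutions: if [A y = x], then [T t y - y] is the integral of [T s x] over [0, t], so no integral
    has to be constructed. The Euler steps are dyadic because one coarse step is then compared with
    two half steps. Resolvents commute and are contractions, so the error over [0, t] is at most the
    number of steps times the local error; it halves with the step on the domain of the square of
    [A], and density does the rest. *)

Section InnerProduct.
Variables (R : realType) (V : lmodType R[i]) (ip : V -> V -> R[i]).
Local Notation C := R[i].
Local Notation Re := (@complex.Re R).
Local Notation Im := (@complex.Im R).

Definition inner_product : Prop :=
  [/\ forall k x y z, ip (k *: x + y) z = k * ip x z + ip y z,
      forall x y, ip y x = (ip x y)^*,
      forall x, 0 <= Re (ip x x)
    & forall x, Re (ip x x) = 0 -> x = 0].

Definition ipnorm (x : V) : R := Num.sqrt (Re (ip x x)).

Hypothesis ipP : inner_product.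
Local Notation N := ipnorm.
Local Notation "<< x , y >>" := (Re (ip x y)).

Lemma ipDl x y z : ip (x + y) z = ip x z + ip y z.
Proof. by case: ipP => l _ _ _; rewrite -[x]scale1r l mul1r scale1r. Qed.

Lemma ip0l z : ip 0 z = 0.
Proof. by apply: (addrI (ip 0 z)); rewrite -ipDl !addr0. Qed.

Lemma ipZl k x z : ip (k *: x) z = k * ip x z.
Proof. by case: ipP => l _ _ _; rewrite -[k *: x]addr0 l ip0l addr0. Qed.

Lemma ipC x y : ip y x = (ip x y)^*.
Proof. by case: ipP. Qed.

Lemma ripC x y : << y, x >> = << x, y >>.
Proof. by rewrite ipC; case: (ip x y). Qed.

Lemma ripDl x y z : << x + y, z >> = << x, z >> + << y, z >>.
Proof. by rewrite ipDl ReD. Qed.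

Lemma ripZl (k : R) x z : << k%:C *: x, z >> = k * << x, z >>.
Proof. by rewrite ipZl ReZ /= mul0r subr0. Qed.

Lemma ripNl x z : << - x, z >> = - << x, z >>.
Proof. by rewrite -scaleN1r ipZl ReZ /= oppr0 mul0r subr0 mulN1r. Qed.

Lemma ripBl x y z : << x - y, z >> = << x, z >> - << y, z >>.
Proof. by rewrite ripDl ripNl. Qed.

Lemma ripDr x y z : << z, x + y >> = << z, x >> + << z, y >>.
Proof. by rewrite ripC ripDl ripC [in X in _ + X]ripC. Qed.

Lemma ripZr (k : R) x z : << z, k%:C *: x >> = k * << z, x >>.
Proof. by rewrite ripC ripZl ripC. Qed.

Lemma ripNr x z : << z, - x >> = - << z, x >>.
Proof. by rewrite ripC ripNl ripC. Qed.

Lemma ripBr x y z : << z, x - y >> = << z, x >> - << z, y >>.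
Proof. by rewrite ripDr ripNr. Qed.

Lemma ripZDl (k : R) x y z : << k%:C *: x + y, z >> = k * << z, x >> + << y, z >>.
Proof. by rewrite ripDl ripZl (ripC z x). Qed.

Lemma ipnorm_ge0 x : 0 <= N x. Proof. exact: sqrtr_ge0. Qed.

Lemma ipnormE x : N x ^+ 2 = << x, x >>.
Proof. by rewrite sqr_sqrtr//; case: ipP. Qed.

Lemma ipnorm0_eq0 x : N x = 0 -> x = 0.
Proof.
by move=> x0; case: ipP => _ _ _; apply; rewrite -ipnormE x0 expr0n.
Qed.

Lemma ipnormZ k x : N (k *: x) = normc k * N x.
Proof.
apply/eqP; rewrite -(@eqrXn2 _ 2) ?mulr_ge0 ?normc_ge0 ?ipnorm_ge0//.
have wE : ip x x = << x, x >>%:C.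
  apply: complex_eq => //=.
  have /(congr1 Im) := ipC x x; case: (ip x x) => p q /=; lra.
rewrite exprMn !ipnormE normcsqE ipZl (ipC (k *: x) x) ipZl wE.
by case: k => p q; apply/eqP => /=; ring.
Qed.

(** Evaluate at the minimizer [t = - q / r]. Besides Cauchy-Schwarz, this serves in [riesz_on] to
    turn near-minimality into an approximate Euler-Lagrange equation. *)
Lemma discriminant_le (p q r : R) : 0 <= r ->
  (forall t, 0 <= p + 2 * t * q + t ^+ 2 * r) -> q ^+ 2 <= p * r.
Proof.
move=> r0 H; have [r_eq0|rn0] := eqVneq r 0.
  suff -> : q = 0 by rewrite r_eq0 mulr0 expr0n.
  (* For [r = 0] the expression is affine in [t], and this [t] gives it the value -1. *)
  apply/eqP/negPn/negP => qn0; have := H (- (p + 1) / (2 * q)).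
  rewrite r_eq0 mulr0 addr0.
  have -> : 2 * (- (p + 1) / (2 * q)) * q = - (p + 1) by field.
  lra.
have rp : 0 < r by rewrite lt_neqAle eq_sym rn0.
have := H (- q / r).
have -> : p + 2 * (- q / r) * q + (- q / r) ^+ 2 * r = (p * r - q ^+ 2) / r.
  by field.
by rewrite pmulr_lge0 ?invr_gt0// subr_ge0.
Qed.

Lemma cauchy_schwarz x y : `|<< x, y >>| <= N x * N y.
Proof.
rewrite -ler_sqr ?nnegrE ?mulr_ge0 ?ipnorm_ge0// real_normK ?num_real//.
rewrite exprMn; apply: discriminant_le; first exact: sqr_ge0.
move=> t; rewrite !ipnormE.
have := sqr_ge0 (N (x + t%:C *: y)); rewrite ipnormE.
rewrite !(ripDl, ripDr, ripZl, ripZr) (ripC x y); lra.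
Qed.

Lemma ipnormD x y : N (x + y) <= N x + N y.
Proof.
rewrite -ler_sqr ?nnegrE ?addr_ge0 ?ipnorm_ge0//.
have := cauchy_schwarz x y; have := ler_norm << x, y >>.
rewrite sqrrD !ipnormE !(ripDl, ripDr) (ripC x y); lra.
Qed.

End InnerProduct.

Section SeqNorm.
Variables (R : realType) (V : lmodType R[i]) (N : V -> R).

Definition norm_axioms : Prop :=
  [/\ forall x, N x = 0 -> x = 0, forall x y, N (x + y) <= N x + N y
    & forall k x, N (k *: x) = normc k * N x].

Definition nlim (u : nat -> V) (l : V) : Prop :=
  forall e : R, 0 < e -> exists n0, forall n, (n0 <= n)%N -> N (u n - l) < e.

Definition ncauchy (u : nat -> V) : Prop :=
  forall e : R, 0 < e -> exists n0, forall m n, (n0 <= m)%N -> (n0 <= n)%N ->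
    N (u m - u n) < e.

Definition ncomplete : Prop := forall u, ncauchy u -> exists l, nlim u l.

Hypothesis NP : norm_axioms.

Lemma n_eq0 x : N x = 0 -> x = 0. Proof. by case: NP => + _ _; apply. Qed.
Lemma nD x y : N (x + y) <= N x + N y. Proof. by case: NP. Qed.
Lemma nZ k x : N (k *: x) = normc k * N x. Proof. by case: NP. Qed.

Lemma normc_real (k : R) : normc k%:C = `|k|.
Proof. by rewrite /normc /= expr0n addr0 sqrtr_sqr. Qed.

Lemma nZr (k : R) x : N (k%:C *: x) = `|k| * N x.
Proof. by rewrite nZ normc_real. Qed.

Lemma nN x : N (- x) = N x.
Proof.
have -> : - x = (-1)%:C *: x by rewrite rmorphN1 scaleN1r.
by rewrite nZr normrN1 mul1r.
Qed.

Lemma n0 : N 0 = 0.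
Proof. by rewrite -(scale0r (0 : V)) nZ normc0 mul0r. Qed.

Lemma n_ge0 x : 0 <= N x.
Proof. by have := nD x (- x); rewrite subrr n0 nN; lra. Qed.

Lemma nB x y : N (x - y) <= N x + N y.
Proof. by rewrite -[N y]nN nD. Qed.

Lemma ndistC x y : N (x - y) = N (y - x).
Proof. by rewrite -opprB nN. Qed.

Lemma ntri z x y : N (x - y) <= N (x - z) + N (z - y).
Proof. by have := nD (x - z) (z - y); rewrite subrKA. Qed.

Lemma n_eq0_le x : (forall e, 0 < e -> N x <= e) -> x = 0.
Proof.
move=> h; apply: n_eq0; apply/eqP; rewrite eq_le n_ge0 andbT.
by apply/ler_addgt0Pr => e /h; rewrite add0r.
Qed.

Lemma nlim_unique u l l' : nlim u l -> nlim u l' -> l = l'.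
Proof.
move=> ul ul'; apply/eqP; rewrite -subr_eq0; apply/eqP; apply: n_eq0_le => e e0.
have e2 : 0 < e / 2 by lra.
have [n1 h1] := ul _ e2; have [n2 h2] := ul' _ e2.
have := h1 (maxn n1 n2) (leq_maxl _ _); have := h2 (maxn n1 n2) (leq_maxr _ _).
have := ntri (u (maxn n1 n2)) l l'; rewrite (ndistC l (u _)); lra.
Qed.

Lemma nlim_le u l z r : nlim u l ->
  (exists n0, forall n, (n0 <= n)%N -> N (u n - z) <= r) -> N (l - z) <= r.
Proof.
move=> ul [n1 h1]; apply/ler_addgt0Pr => e e0.
have [n2 h2] := ul _ e0.
have := h2 (maxn n1 n2) (leq_maxr _ _); have := h1 (maxn n1 n2) (leq_maxl _ _).
have := ntri (u (maxn n1 n2)) l z; rewrite (ndistC l (u _)); lra.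
Qed.

Lemma nlim_cauchy u l : nlim u l -> ncauchy u.
Proof.
move=> ul e e0; have [|n1 h1] := ul (e / 2); first lra.
exists n1 => m n /h1 a /h1 b; have := ntri l (u m) (u n).
rewrite (ndistC l (u _)); lra.
Qed.

End SeqNorm.

Lemma ipnorm_axioms (R : realType) (V : lmodType R[i]) (ip : V -> V -> R[i]) :
  inner_product ip -> norm_axioms (ipnorm ip).
Proof.
move=> ipP; split; [exact: ipnorm0_eq0|exact: ipnormD|exact: ipnormZ].
Qed.

Section Riesz.
Variables (R : realType) (V : lmodType R[i]) (ip : V -> V -> R[i]).
Hypothesis ipP : inner_product ip.
Local Notation N := (ipnorm ip).
Hypothesis complN : ncomplete N.
Local Notation "<< x , y >>" := (complex.Re (ip x y)).
Let NP := ipnorm_axioms ipP.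

(* Minimizes [N y ^+ 2 - 2 * l y] over [K]: [l := << x, - >>] gives the
   orthogonal projection of [x] onto [K], and [K := setT] the representation
   theorem. *)
Lemma riesz_on (K : set V) (l : V -> R) (M : R) :
  K 0 -> (forall x y, K x -> K y -> K (x + y)) ->
  (forall (k : R) x, K x -> K (k%:C *: x)) ->
  (forall u x, (forall n, K (u n)) -> nlim N u x -> K x) ->
  (forall x y, l (x + y) = l x + l y) -> (forall (k : R) x, l (k%:C *: x) = k * l x) ->
  0 <= M -> (forall x, `|l x| <= M * N x) ->
  exists p, [/\ K p, forall y, K y -> << p, y >> = l y & N p <= M].
Proof.
move=> K0 KD KZ Kcl lD lZ M0 lM.
pose J y := N y ^+ 2 - 2 * l y.
pose S := [set J y | y in K].
have Sinf : has_inf S.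
  split; first by exists (J 0), 0.
  (* Completing the square: [N y ^+ 2 - 2 * M * N y >= - M ^+ 2]. *)
  exists (- M ^+ 2) => _ [y _ <-]; rewrite /J.
  by have := lM y; have := ler_norm (l y); have := sqr_ge0 (N y - M); nra.
set m := inf S.
have mJ y : K y -> m <= J y by move=> Ky; apply: ge_inf; [case: Sinf|exists y].
have ex n : exists y, K y /\ J y < m + n.+1%:R^-1.
  have [|_ [y Ky <-] h] := @inf_adherent _ S n.+1%:R^-1 _ Sinf.
    by rewrite invr_gt0.
  by exists y.
have [u uP] := choice ex.
have Ku n := (uP n).1.
(* Parallelogram law: two near-minimizers are close to each other, because [J] at their midpoint is
   at least [m]. *)
have par y z : N (y - z) ^+ 2 = 2 * (J y + J z - 2 * J (2^-1%:C *: (y + z))).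
  rewrite /J !(ipnormE ipP) lZ lD !(ripDl ipP, ripDr ipP,
    ripZl ipP, ripZr ipP, ripNl ipP, ripNr ipP).
  by rewrite (ripC ipP z y); field.
have small e : 0 < e -> exists n0, forall n, (n0 <= n)%N -> n.+1%:R^-1 < e :> R.
  move=> e0; exists (Num.bound e^-1) => n hn.
  rewrite invf_plt ?posrE//; apply: (lt_le_trans (archi_boundP _)).
    by rewrite invr_ge0 ltW.
  by rewrite ler_nat ltnW.
have cu : ncauchy N u.
  move=> e e0; have [|n1 h] := small (e ^+ 2 / 4); first by rewrite divr_gt0 ?exprn_gt0.
  exists n1 => i j /h hi /h hj; rewrite -ltr_sqr ?nnegrE ?ipnorm_ge0 ?ltW//.
  rewrite par; have := mJ _ (KZ 2^-1 _ (KD _ _ (Ku i) (Ku j))).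
  have := (uP i).2; have := (uP j).2.
  by move: hi hj; move: (i.+1%:R^-1) (j.+1%:R^-1) => ri rj; lra.
have [p up] := complN cu.
have Kp : K p := Kcl _ _ Ku up.
have eq_l y : K y -> << p, y >> = l y.
  move=> Ky; apply/eqP; rewrite -subr_eq0 -normr_le0.
  apply/ler_addgt0Pr => e e0; rewrite add0r.
  have y1 : 0 < 1 + N y by have := ipnorm_ge0 ip y; lra.
  have [d d0 dE] : exists2 d, 0 < d & d * (1 + N y) = e / 2.
    exists (e / (2 * (1 + N y))); first by rewrite divr_gt0// mulr_gt0.
    by field; rewrite gt_eqF.
  have [n1 h1] := small (d ^+ 2) (exprn_gt0 _ d0).
  have [n2 h2] := up _ d0; set n := maxn n1 n2.
  have {}h1 := h1 n (leq_maxl _ _); have {}h2 := h2 n (leq_maxr _ _).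
  (* For every [t], [J (u n + t y) >= m > J (u n) - n.+1^-1], so a quadratic in [t] is nonnegative
     and its discriminant bounds the square of the left-hand side by [n.+1^-1 * N y ^+ 2]. *)
  have A : `|<< u n, y >> - l y| <= d * N y.
    rewrite -ler_sqr ?nnegrE ?mulr_ge0 ?ipnorm_ge0 ?(ltW d0)//.
    rewrite real_normK ?num_real// exprMn.
    apply: (@le_trans _ _ (n.+1%:R^-1 * N y ^+ 2)); last first.
      by rewrite ler_wpM2r ?sqr_ge0// ltW.
    apply: discriminant_le; first exact: sqr_ge0.
    move=> t; have := mJ _ (KD _ _ (Ku n) (KZ t _ Ky)); have := (uP n).2.
    rewrite /J !(ipnormE ipP) lD lZ !(ripDl ipP, ripDr ipP, ripZl ipP, ripZr ipP).
    by rewrite (ripC ipP (u n) y); move: (n.+1%:R^-1) => rn; lra.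
  have B := cauchy_schwarz ipP (p - u n) y.
  rewrite (ndistC NP (u n) p) in h2.
  have -> : << p, y >> - l y = << p - u n, y >> + (<< u n, y >> - l y).
    by rewrite (ripBl ipP); lra.
  apply: (le_trans (ler_normD _ _)).
  have := ipnorm_ge0 ip y; nra.
exists p; split => //.
have [->//|pn0] := eqVneq (N p) 0.
have p0 : 0 < N p by rewrite lt_neqAle eq_sym pn0 ipnorm_ge0.
rewrite -(ler_pM2r p0) -expr2 (ipnormE ipP) eq_l//.
exact: le_trans (ler_norm _) (lM p).
Qed.

(** The closure [K] of [D] is a closed subspace, and what remains of [x] after projection onto [K]
    is orthogonal to [D], hence zero. *)
Lemma dense_of_orthogonal (D : set V) :
  D 0 -> (forall x y, D x -> D y -> D (x + y)) ->
  (forall (k : R) x, D x -> D (k%:C *: x)) ->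
  (forall w, (forall x, D x -> << w, x >> = 0) -> w = 0) ->
  forall x e, 0 < e -> exists2 y, D y & N (x - y) < e.
Proof.
move=> D0 DD DZ orth x.
pose K : set V := fun z => forall e, 0 < e -> exists2 y, D y & N (z - y) < e.
have DK y : D y -> K y by move=> Dy e e0; exists y => //; rewrite subrr (n0 NP).
have KD y z : K y -> K z -> K (y + z).
  move=> Ky Kz e e0; have [|y' Dy' hy] := Ky (e / 2); first lra.
  have [|z' Dz' hz] := Kz (e / 2); first lra.
  exists (y' + z'); first exact: DD.
  by rewrite opprD addrACA; have := nD NP (y - y') (z - z'); lra.
have KZ (k : R) y : K y -> K (k%:C *: y).
  move=> Ky e e0; have k1 : 0 < 1 + `|k| by have := normr_ge0 k; lra.
  have [|y' Dy' hy] := Ky (e / (1 + `|k|)); first by rewrite divr_gt0.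
  exists (k%:C *: y'); first exact: DZ.
  rewrite -scalerBr (nZr NP); move: hy; rewrite ltr_pdivlMr//.
  have := n_ge0 NP (y - y'); nra.
have Kcl u z : (forall n, K (u n)) -> nlim N u z -> K z.
  move=> Ku uz e e0; have [|n1 h] := uz (e / 2); first lra.
  have [|y Dy hy] := Ku n1 (e / 2); first lra.
  exists y => //; have := h n1 (leqnn _).
  have := ntri NP (u n1) z y; rewrite (ndistC NP z (u n1)); lra.
have [p [Kp pP _]] := @riesz_on K (fun y => << x, y >>) (N x) (DK _ D0) KD KZ Kcl
  (fun y z => ripDr ipP y z x) (fun k y => ripZr ipP k y x) (ipnorm_ge0 ip x)
  (fun y => cauchy_schwarz ipP x y).
have : x - p = 0.
  by apply: orth => y /DK /pP h; rewrite (ripBl ipP) h subrr.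
by move=> /eqP; rewrite subr_eq0 => /eqP ->.
Qed.

End Riesz.

(** * Completeness and dissipative operators *)

Section Completeness.
Variables (R : realType) (V : lmodType R[i]) (N : V -> R).
Hypothesis NP : norm_axioms N.
Hypothesis complN : ncomplete N.

Lemma geometric_small (r0 : R) e : 0 < e -> exists n0, forall n, (n0 <= n)%N ->
  r0 / 2 ^+ n < e.
Proof.
move=> e0; exists (Num.trunc (r0 / e)).+1 => n hn.
rewrite ltr_pdivrMr ?exprn_gt0// -ltr_pdivrMl// mulrC.
apply: (lt_le_trans (truncnS_gt _)).
apply: (@le_trans _ _ n%:R); first by rewrite ler_nat.
by rewrite -natrX ler_nat ltnW// ltn_expl.
Qed.

Lemma geometric_cauchy (u : nat -> V) (r : nat -> R) :
  (forall k, N (u k.+1 - u k) <= r k) -> (forall k, r k.+1 <= r k / 2) ->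
  exists l, nlim N u l /\ forall k, N (l - u k) <= 2 * r k.
Proof.
move=> hu hr.
have r0 k : 0 <= r k by apply: le_trans (hu k); exact: n_ge0.
(* The subtracted term carries the induction: adding an increment of size [r (k + j)] is absorbed
   because [2 * r k.+1 <= r k]. *)
have H k j : N (u (k + j)%N - u k) <= 2 * r k - 2 * r (k + j)%N.
  elim: j => [|j IH]; first by rewrite addn0 subrr (n0 NP) subrr.
  rewrite addnS; have := ntri NP (u (k + j)%N) (u (k + j).+1) (u k).
  have := hu (k + j)%N; have := hr (k + j)%N; lra.
have H2 k j : (k <= j)%N -> N (u j - u k) <= 2 * r k.
  by move=> /subnKC <-; have := H k (j - k)%N; have := r0 (k + (j - k))%N; lra.
have rk k : r k <= r 0%N / 2 ^+ k.
  elim: k => [|k IH]; first by rewrite expr0 divr1.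
  apply: (le_trans (hr k)); rewrite exprSr invfM mulrA ler_wpM2r//.
have [|l ul] := @complN u.
  move=> e e0; have [|n1 h] := @geometric_small (r 0%N) (e / 4); first lra.
  exists n1 => i j hi hj; have := h _ (leqnn _); have := rk n1.
  have := H2 _ _ hi; have := H2 _ _ hj; have := ntri NP (u n1) (u i) (u j).
  rewrite (ndistC NP (u n1)); lra.
exists l; split => // k; apply: (nlim_le NP ul); exists k => j; exact: H2.
Qed.

Lemma contraction_fixpoint (f : V -> V) :
  (forall x y, N (f x - f y) <= N (x - y) / 2) -> exists x, f x = x.
Proof.
move=> fc; pose u k := iter k f 0; pose r k := N (f 0) / 2 ^+ k.
have r2 k : r k.+1 = r k / 2 by rewrite /r exprSr invfM mulrA.
have hu k : N (u k.+1 - u k) <= r k.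
  elim: k => [|k IH]; first by rewrite /u/= subr0 /r expr0 divr1.
  by rewrite r2 [u k.+2]iterS [in X in _ - X]/u iterS; have := fc (u k.+1) (u k);
    rewrite -/(u k); lra.
have [|l [ul _]] := geometric_cauchy hu; first by move=> k; rewrite r2.
exists l; apply: (nlim_unique NP (u := fun n => u n.+1)).
  move=> e /ul[n1 h]; exists n1 => n /h; have := fc (u n) l.
  by have := n_ge0 NP (u n - l); rewrite [u n.+1]iterS -/(u n); lra.
by move=> e /ul[n1 h]; exists n1 => n hn; apply: h; exact: leqW.
Qed.

(* Gliding hump with radii adapted to the (finite) bounds of the operators
   already chosen. *)
Lemma uniform_boundedness (T : nat -> V -> V) (B : nat -> R) :
  (forall n x y, T n (x + y) = T n x + T n y) ->
  (forall n (k : R) x, T n (k%:C *: x) = k%:C *: T n x) ->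
  (forall n x, N (T n x) <= B n * N x) ->
  (forall x, exists M : R, forall n, N (T n x) <= M) ->
  exists M : R, forall n x, N (T n x) <= M * N x.
Proof.
move=> TD TZ TB pw; apply: contrapT => /forallNP nub.
have big (M : R) : exists n x, M * N x < N (T n x).
  have /existsNP[n /existsNP[x /negP]] := nub M.
  by rewrite -ltNge => ?; exists n, x.
(* The state is a counter [k] with a centre and a radius. Around the new centre, on a ball of twice
   the new radius, some [T n] has norm at least [k - 2]; the factor 2 matches the distance to the
   limit granted by [geometric_cauchy]. *)
have step (kxr : nat * (V * R)) : exists xr' : V * R, 0 < kxr.2.2 ->
    [/\ N (xr'.1 - kxr.2.1) <= kxr.2.2, 0 < xr'.2, xr'.2 <= kxr.2.2 / 2
      & exists n, forall y, N (y - xr'.1) <= 2 * xr'.2 ->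
          kxr.1%:R - 2 <= N (T n y)].
  case: kxr => k [x r] /=; have [r0|] := ltP 0 r; last by exists (0, 0).
  have [n [z hz]] := big (k%:R / r).
  have TN y : T n (- y) = - T n y.
    have -> : - y = (-1)%:C *: y by rewrite rmorphN1 scaleN1r.
    by rewrite TZ rmorphN1 scaleN1r.
  have z0 : N z != 0.
    apply/eqP => /(n_eq0 NP) z0; move: hz.
    by have := TZ n 0 z; rewrite z0 scaler0 scale0r => ->; rewrite (n0 NP) mulr0 ltxx.
  have zp : 0 < N z by rewrite lt_neqAle eq_sym z0 (n_ge0 NP).
  pose w := (r / N z)%:C *: z.
  have Nw : N w = r.
    by rewrite (nZr NP) ger0_norm ?divr_ge0 ?(n_ge0 NP) ?(ltW r0)// divfK.
  have NTw : k%:R <= N (T n w).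
    rewrite TZ (nZr NP) ger0_norm ?divr_ge0 ?(n_ge0 NP) ?(ltW r0)//.
    move: hz; rewrite mulrAC ltr_pdivrMr// => /ltW hz.
    by rewrite mulrAC ler_pdivlMr// mulrC [leRHS]mulrC mulrC.
  (* As [2 T n w = T n (x + w) - T n (x - w)], one of [x + w] and [x - w] has an image of norm at
     least [k]. *)
  have [x' xx' Tx'] : exists2 x', N (x' - x) <= r & k%:R <= N (T n x').
    have [h|h] := leP k%:R (N (T n (x + w))).
      by exists (x + w) => //; rewrite addrAC subrr add0r Nw.
    exists (x - w); first by rewrite addrAC subrr add0r (nN NP) Nw.
    have E : 2%:C *: T n w = T n (x + w) - T n (x - w).
      rewrite !TD TN opprD opprK addrACA subrr add0r.
      by rewrite (_ : 2%:C = 1 + 1) ?scalerDl ?scale1r// rmorphD rmorph1.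
    have := nB NP (T n (x + w)) (T n (x - w)); rewrite -E (nZr NP) ger0_norm//; lra.
  have B0 : 0 < `|B n| + 1 by have := normr_ge0 (B n); lra.
  (* The second bound on the radius lets [T n] vary by at most 2 on the doubled ball. *)
  exists (x', Num.min (r / 2) (`|B n| + 1)^-1); split => //=.
  - by rewrite lt_min divr_gt0//= invr_gt0.
  - by rewrite ge_min lexx.
  exists n => y hy.
  have hy2 : N (y - x') <= 2 * (`|B n| + 1)^-1.
    by apply: le_trans hy _; rewrite ler_pM2l// ge_min lexx orbT.
  have := TB n (y - x'); rewrite TD TN.
  have hb : B n * N (y - x') <= 2.
    apply: (@le_trans _ _ ((`|B n| + 1) * N (y - x'))).
      rewrite ler_wpM2r ?(n_ge0 NP)//; have := ler_norm (B n); lra.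
    by move: hy2; rewrite ler_pdivlMr// mulrC.
  have := ntri NP (T n y) (T n x') 0; rewrite !subr0 (ndistC NP (T n x')).
  lra.
have [g gP] := choice step.
pose s := fix s k := if k is k'.+1 then g (k', s k') else (0 : V, 1 : R).
have s0 k : 0 < (s k).2 by elim: k => [//=|k IH]; have [] := gP (k, s k) IH.
have [||l [sl ls]] := @geometric_cauchy (fun k => (s k).1) (fun k => (s k).2).
- by move=> k; have [] := gP (k, s k) (s0 k).
- by move=> k; have [] := gP (k, s k) (s0 k).
have [M hM] := pw l.
pose k := (Num.trunc (M + 2)).+1.
have hk : M + 2 < k%:R by exact: truncnS_gt.
have [_ _ _ [n /(_ l (ls k.+1))]] := gP (k, s k) (s0 k).
have /= := hM n; lra.
Qed.

End Completeness.

Section Dissipative.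
Variables (R : realType) (V : lmodType R[i]) (N : V -> R).
Hypothesis NP : norm_axioms N.
Hypothesis complN : ncomplete N.
Variables (D : set V) (A : V -> V).

Definition linear_on : Prop := forall k x y, D x -> D y ->
  D (k *: x + y) /\ A (k *: x + y) = k *: A x + A y.

Definition dissipative : Prop := forall x (h : R), D x -> 0 <= h ->
  N x <= N (x - h%:C *: A x).

Hypothesis D0 : D 0.
Hypothesis Alin : linear_on.

Lemma D_Z k x : D x -> D (k *: x).
Proof. by move=> Dx; have [+ _] := Alin k Dx D0; rewrite addr0. Qed.

Lemma D_D x y : D x -> D y -> D (x + y).
Proof. by move=> Dx Dy; have [+ _] := Alin 1 Dx Dy; rewrite scale1r. Qed.

Lemma D_B x y : D x -> D y -> D (x - y).
Proof. by move=> Dx Dy; rewrite -scaleN1r addrC; have [] := Alin (-1) Dy Dx. Qed.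

Lemma A_D x y : D x -> D y -> A (x + y) = A x + A y.
Proof. by move=> Dx Dy; have [_] := Alin 1 Dx Dy; rewrite !scale1r. Qed.

Lemma A_0 : A 0 = 0.
Proof. by apply: (addrI (A 0)); rewrite -A_D// !addr0. Qed.

Lemma A_Z k x : D x -> A (k *: x) = k *: A x.
Proof. by move=> Dx; have [_] := Alin k Dx D0; rewrite A_0 !addr0. Qed.

Lemma A_B x y : D x -> D y -> A (x - y) = A x - A y.
Proof.
by move=> Dx Dy; rewrite -(scaleN1r y) A_D//; [rewrite A_Z// scaleN1r|exact: D_Z].
Qed.

Definition full_range (l : R) : Prop :=
  forall x, exists2 y, D y & l%:C *: y - A y = x.

(** The equation [m y - A y = x] is the fixed point equation [y = (l - A)^-1 (x + (l - m) y)]. The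
    inverse is bounded by [c^-1], so the right-hand side contracts with constant 1/2. *)
Lemma full_range_near (l m c : R) : 0 < c ->
  (forall y, D y -> c * N y <= N (l%:C *: y - A y)) -> full_range l ->
  `|m - l| <= c / 2 -> full_range m.
Proof.
move=> c0 bd fr ml x.
have ex y : exists z, D z /\ l%:C *: z - A z = x + (l - m)%:C *: y.
  by have [z Dz zP] := fr (x + (l - m)%:C *: y); exists z.
have [f fP] := choice ex.
have fc y z : N (f y - f z) <= N (y - z) / 2.
  have [Dy hy] := fP y; have [Dz hz] := fP z.
  have := bd _ (D_B Dy Dz); rewrite A_B//.
  have -> : l%:C *: (f y - f z) - (A (f y) - A (f z)) =
      l%:C *: f y - A (f y) - (l%:C *: f z - A (f z)).
    by rewrite scalerBr !opprB addrACA [RHS]addrACA; congr (_ + _); rewrite addrC.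
  rewrite hy hz opprD addrACA subrr add0r -scalerBr (nZr NP) distrC => h.
  rewrite -(ler_pM2l c0); apply: (le_trans h).
  have := n_ge0 NP (y - z); nra.
have [y yP] := contraction_fixpoint NP complN fc.
have [Dy hy] := fP y; rewrite yP in Dy hy; exists y => //.
have : m%:C *: y = l%:C *: y - (l - m)%:C *: y.
  by rewrite -scalerBl -rmorphB subKr.
move=> ->; rewrite addrAC hy addrK //.
Qed.

Hypothesis Adis : dissipative.

Lemma dissipative_bound (l : R) y : 0 < l -> D y ->
  l * N y <= N (l%:C *: y - A y).
Proof.
move=> l0 Dy.
have -> : l%:C *: y - A y = l%:C *: (y - l^-1%:C *: A y).
  by rewrite scalerBr scalerA -rmorphM divff ?gt_eqF// scale1r.
by rewrite (nZr NP) gtr0_norm// ler_pM2l// Adis// invr_ge0 ltW.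
Qed.

(** Continuation in [l]. The bounded inverse leads from 0 to [K^-1 / 2]. From any [l > 0],
    dissipativity supplies the lower bound [c = l], so each step may change [l] by up to [l / 2]:
    values further down are reached by halving, values further up by factors 3/2. *)
Lemma full_range_pos (K : R) : (forall x, exists2 y, D y & A y = x) ->
  0 < K -> (forall y, D y -> N y <= K * N (A y)) ->
  forall l, 0 < l -> full_range l.
Proof.
move=> surj K0 bd.
have fr0 : full_range 0.
  move=> x; have [y Dy yx] := surj (- x); exists y => //.
  by rewrite scale0r sub0r yx opprK.
have frK : full_range (K^-1 / 2).
  apply: (@full_range_near 0 _ K^-1) => //; first by rewrite invr_gt0.
    move=> y Dy; rewrite scale0r sub0r (nN NP) mulrC ler_pdivrMr// mulrC; exact: bd.
  by rewrite subr0 gtr0_norm// divr_gt0// invr_gt0.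
have next l m : 0 < l -> full_range l -> 0 < m -> m <= 3 / 2 * l -> full_range m.
  move=> l0 fl m0 ml; have [lm|lm] := leP (l / 2) m.
    apply: (@full_range_near l _ l) => //; first by move=> y; exact: dissipative_bound.
    by rewrite ler_norml; apply/andP; split; lra.
  have fl2 n : full_range (l / 2 ^+ n).
    elim: n => [|n IH]; first by rewrite expr0 divr1.
    have p : 0 < l / 2 ^+ n by rewrite divr_gt0// exprn_gt0.
    apply: (@full_range_near (l / 2 ^+ n) _ (l / 2 ^+ n)) => //.
      by move=> y; exact: dissipative_bound.
    by rewrite exprSr invfM mulrA ler_norml; apply/andP; split; lra.
  have [n0 h] := geometric_small l m0.
  have ex : exists n, l / 2 ^+ n < m by exists n0; exact: h.
  case: (ex_minnP ex) => -[|n] hn mn; first by move: hn; rewrite expr0 divr1; lra.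
  have mn2 : m <= l / 2 ^+ n by rewrite leNgt; apply/negP => /mn; rewrite ltnn.
  have p : 0 < l / 2 ^+ n by rewrite divr_gt0// exprn_gt0.
  move: hn; rewrite exprSr invfM mulrA => hn.
  apply: (@full_range_near (l / 2 ^+ n) _ (l / 2 ^+ n)) => //.
    by move=> y; exact: dissipative_bound.
  by rewrite ler_norml; apply/andP; split; lra.
have K2 : 0 < K^-1 / 2 by rewrite divr_gt0// invr_gt0.
have up n : full_range (K^-1 / 2 * (3 / 2) ^+ n).
  elim: n => [|n IH]; first by rewrite expr0 mulr1.
  have p : 0 < K^-1 / 2 * (3 / 2) ^+ n by rewrite mulr_gt0// exprn_gt0// divr_gt0.
  apply: next IH _ _ => //; first by rewrite mulr_gt0// exprn_gt0// divr_gt0.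
  by rewrite exprS mulrCA.
(* This [n] satisfies [l < n * K^-1 / 4], and [n <= 2 * (3 / 2) ^+ n] then gives
   [l <= K^-1 / 2 * (3 / 2) ^+ n]. *)
move=> l l0; pose n := (Num.trunc (l / (K^-1 / 4))).+1.
apply: (next _ _ _ (up n)) => //; first by rewrite mulr_gt0// exprn_gt0// divr_gt0.
have : l / (K^-1 / 4) < n%:R.
  exact: truncnS_gt.
rewrite ltr_pdivrMr; last by rewrite divr_gt0// invr_gt0.
have : n%:R <= 2 * (3 / 2) ^+ n :> R.
  elim: n => [|n IH]; first by rewrite mulr_ge0.
  have : 1 <= (3 / 2 : R) ^+ n by rewrite exprn_ege1//; lra.
  by move: IH; rewrite exprS -[n.+1%:R]natr1; move: (_ ^+ n) (n%:R) => p q; lra.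
have : 0 < K^-1 by rewrite invr_gt0.
move: (K^-1) (n%:R) (_ ^+ n) => k p q k0 h1 h2.
nra.
Qed.

End Dissipative.

(** * Generation of contraction semigroups *)

Lemma subrACA (V : zmodType) (a b c d : V) : (a - b) - (c - d) = (a - c) - (b - d).
Proof. by rewrite !opprB addrACA [RHS]addrACA; congr (_ + _); rewrite addrC. Qed.

Lemma subr_swap (V : zmodType) (a b c : V) : a - b = c -> b = a - c.
Proof. by move=> <-; rewrite subKr. Qed.

Section Generation.
Variables (R : realType) (V : lmodType R[i]) (N : V -> R).
Hypothesis NP : norm_axioms N.
Hypothesis complN : ncomplete N.
Variables (D : set V) (A : V -> V).
Hypothesis D0 : D 0.
Hypothesis Alin : linear_on D A.
Hypothesis Adis : dissipative N D A.
Hypothesis Arange : forall l, 0 < l -> full_range D A l.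
Hypothesis Adense : forall x e, 0 < e -> exists2 y, D y & N (x - y) < e.

Definition contractive (T : V -> V) : Prop :=
  (forall k x y, T (k *: x + y) = k *: T x + T y) /\ forall x, N (T x) <= N x.

Lemma contractiveB T x y : contractive T -> T (x - y) = T x - T y.
Proof. by case=> l _; rewrite addrC -scaleN1r l scaleN1r addrC. Qed.

Lemma contractive_dist T x y : contractive T -> N (T x - T y) <= N (x - y).
Proof. by move=> cT; rewrite -contractiveB//; case: cT. Qed.

Lemma contractiveZ T k x : contractive T -> T (k *: x) = k *: T x.
Proof.
move=> cT; have T0 : T 0 = 0 by have := contractiveB 0 0 cT; rewrite !subrr.
by case: cT => l _; rewrite -[k *: x]addr0 l T0 addr0.
Qed.

Lemma contractive_iter T n : contractive T -> contractive (iter n T).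
Proof.
move=> cT; elim: n => [|n [l c]]; first by [].
split => [k x y|x]; first by rewrite !iterS l; case: cT.
by rewrite iterS; apply: le_trans (c x); case: cT.
Qed.

Lemma iter_comm (T S : V -> V) n : (forall x, T (S x) = S (T x)) ->
  forall x, iter n T (S x) = S (iter n T x).
Proof. by move=> TS x; elim: n => [//|n IH]; rewrite !iterS IH TS. Qed.

(** The operator [(1 - h A)^-1], one implicit Euler step of length [h]. For [h > 0] the default 0 is
    never taken as such, by [resolventP]. *)
Definition resolvent (h : R) (x : V) : V :=
  xget 0 [set y | D y /\ y - h%:C *: A y = x].
Local Notation J := resolvent.

Lemma resolventP h x : 0 < h -> D (J h x) /\ J h x - h%:C *: A (J h x) = x.
Proof.
move=> h0; rewrite /resolvent; case: xgetP => [y _ //|H]; exfalso.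
have [y Dy yx] := Arange (divr_gt0 ltr01 h0) (h^-1%:C *: x).
apply: (H y); split => //.
have := congr1 (fun z => h%:C *: z) yx.
rewrite /= scalerBr !scalerA -!rmorphM/= div1r divff ?gt_eqF// !scale1r.
by [].
Qed.

Lemma resolvent_uniq h x y : 0 < h -> D y -> y - h%:C *: A y = x -> y = J h x.
Proof.
move=> h0 Dy yx; have [Dz zx] := resolventP x h0.
apply/eqP; rewrite -subr_eq0; apply/eqP/(n_eq0 NP)/eqP.
rewrite eq_le (n_ge0 NP) andbT.
have := Adis (D_B Alin Dy Dz) (ltW h0).
by rewrite (A_B D0 Alin)// scalerBr subrACA yx zx subrr (n0 NP).
Qed.

Lemma resolvent_contractive h : 0 < h -> contractive (J h).
Proof.
move=> h0; split => [k x y|x]; last first.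
  by have [Dz {2}<-] := resolventP x h0; apply: Adis => //; exact: ltW.
have [Dx hx] := resolventP x h0; have [Dy hy] := resolventP y h0.
have [Dk Ak] := Alin k Dx Dy.
apply/esym/resolvent_uniq => //.
transitivity (k *: (J h x - h%:C *: A (J h x)) + (J h y - h%:C *: A (J h y))).
  by rewrite Ak scalerDr scalerBr !scalerA opprD addrACA mulrC.
by rewrite hx hy.
Qed.

(** [A (J h x)] is a multiple of [J h x - x], a difference of two elements of [D]; applying [A] to
    the resolvent equation for [x] gives the one for [A x]. *)
Lemma resolvent_A h x : 0 < h -> D x -> D (A (J h x)) /\ A (J h x) = J h (A x).
Proof.
move=> h0 Dx; have [Dy hy] := resolventP x h0.
have AE : A (J h x) = h^-1%:C *: (J h x - x).
  by rewrite -(subr_swap hy) scalerA -rmorphM/= mulVf ?gt_eqF// scale1r.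
have DA : D (A (J h x)) by rewrite AE; apply: (D_Z D0 Alin) => //; exact: (D_B Alin).
split => //; apply: resolvent_uniq => //.
have := congr1 A hy; rewrite (A_B D0 Alin)// ?(A_Z D0 Alin)//.
exact: (D_Z D0 Alin).
Qed.

(** Both [J k (J h x)] and its image under [A] lie in [D], so [1 - h A] and [1 - k A] may be applied
    to it in either order. *)
Lemma resolvent_comm h k x : 0 < h -> 0 < k -> J h (J k x) = J k (J h x).
Proof.
move=> h0 k0; have [Dx hx] := resolventP x h0.
have [Dy hy] := resolventP (J h x) k0.
have [DA AE] := resolvent_A k0 Dx.
apply/esym/resolvent_uniq => //; apply: resolvent_uniq => //.
  by apply: (D_B Alin) => //; exact: (D_Z D0 Alin).
have Az : A (J h x) = A (J k (J h x)) - k%:C *: A (A (J k (J h x))).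
  rewrite -{1}hy (A_B D0 Alin)// ?(A_Z D0 Alin)//; exact: (D_Z D0 Alin).
rewrite (A_B D0 Alin)// ?(A_Z D0 Alin)//; last exact: (D_Z D0 Alin).
rewrite -[RHS]hx Az -[X in _ = X - _]hy !scalerBr !scalerA [(h%:C * _)%R]mulrC.
exact: subrACA.
Qed.

Lemma resolvent_sub h x : 0 < h -> D x -> J h x - x = h%:C *: J h (A x).
Proof.
move=> h0 Dx; have [_ <-] := resolvent_A h0 Dx.
by have [_ /subr_swap] := resolventP x h0.
Qed.

Lemma resolvent_dist h x : 0 < h -> D x -> N (J h x - x) <= h * N (A x).
Proof.
move=> h0 Dx; rewrite resolvent_sub// (nZr NP) gtr0_norm// ler_pM2l//.
by have [_] := resolvent_contractive h0.
Qed.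

Lemma iter_resolvent_dist h n x : 0 < h -> D x ->
  N (iter n (J h) x - x) <= n%:R * h * N (A x).
Proof.
move=> h0 Dx; elim: n => [|n IH]; first by rewrite subrr (n0 NP) !mul0r.
have := contractive_dist (iter n (J h) x) x (resolvent_contractive h0).
have := resolvent_dist h0 Dx.
have := ntri NP (J h x) (iter n.+1 (J h) x) x.
by rewrite iterS -[n.+1%:R]natr1; move: (n%:R) IH => m; lra.
Qed.

(** Telescoping of [S^n - T^n]: commutation brings each power of [T] in front of [S x - T x], where
    contractivity discards it. *)
Lemma comm_contractive_iter_dist (S T : V -> V) n x :
  contractive S -> contractive T -> (forall x, S (T x) = T (S x)) ->
  N (iter n S x - iter n T x) <= n%:R * N (S x - T x).
Proof.
move=> cS cT ST; elim: n => [|n IH]; first by rewrite subrr (n0 NP) mul0r.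
rewrite !iterS.
have := ntri NP (S (iter n T x)) (S (iter n S x)) (T (iter n T x)).
have := contractive_dist (iter n S x) (iter n T x) cS.
have := contractive_dist (S x) (T x) (contractive_iter n cT).
rewrite (iter_comm n (fun y => esym (ST y))) -iterSr iterS.
by rewrite -[n.+1%:R]natr1; move: (n%:R) IH => m; lra.
Qed.

Lemma dense2 x e : 0 < e -> exists y, [/\ D y, D (A y) & N (x - y) < e].
Proof.
move=> e0; have [|y Dy xy] := Adense x (e := e / 2); first lra.
(* Makes [h * N (A y)], which bounds the distance from [J h y] to [y], at most [e / 2]. *)
pose h := e / (2 * (1 + N (A y))).
have p : 0 < 1 + N (A y) by have := n_ge0 NP (A y); lra.
have h0 : 0 < h by rewrite divr_gt0// mulr_gt0.
have [Dz zy] := resolventP y h0; have [DA _] := resolvent_A h0 Dy.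
exists (J h y); split => //.
have hE : h * (1 + N (A y)) = e / 2 by rewrite /h; field; rewrite gt_eqF.
have := ntri NP y x (J h y); have := resolvent_dist h0 Dy.
rewrite (ndistC NP (J h y)); lra.
Qed.

Let hs (k : nat) : R := (2 ^+ k)^-1.
Let hs0 k : 0 < hs k. Proof. by rewrite invr_gt0 exprn_gt0. Qed.
Let hsS k : hs k.+1 = hs k / 2. Proof. by rewrite /hs exprSr invfM. Qed.

Let hs_small e : 0 < e -> exists n0, forall k, (n0 <= k)%N -> hs k < e.
Proof.
move=> /(geometric_small 1)[n0 h]; exists n0 => k /h; by rewrite div1r.
Qed.

Let steps (k : nat) (t : R) : nat := Num.trunc (t / hs k).

Let steps_le k t : 0 <= t -> (steps k t)%:R * hs k <= t.
Proof.
move=> t0; rewrite -ler_pdivlMr//.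
by rewrite truncn_le divr_ge0// ltW.
Qed.

Let steps_gt k t : t < (steps k t)%:R * hs k + hs k.
Proof.
rewrite -{2}[hs k]mul1r -mulrDl -ltr_pdivrMr// natr1; exact: truncnS_gt.
Qed.

(** Controls rounding: passing to the finer grid, or rounding [s + t] once instead of [s] and [t]
    separately, adds at most one step. *)
Let steps_near k t (n : nat) : 0 <= t -> n%:R * hs k <= t ->
  t < n.+2%:R * hs k -> steps k t = n \/ steps k t = n.+1.
Proof.
move=> t0; rewrite -ler_pdivlMr// -ltr_pdivrMr// => h1 h2.
have [h|h] := ltP (t / hs k) n.+1%:R.
  by left; apply: truncn_def; rewrite h1.
by right; apply: truncn_def; rewrite h.
Qed.

(* implicit Euler approximation of [exp (t A) x] with step [2 ^- k] *)
Let euler (k : nat) (t : R) (x : V) : V := iter (steps k t) (J (hs k)) x.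

Let euler_contractive k t : contractive (euler k t).
Proof. by apply: contractive_iter; exact: resolvent_contractive. Qed.

(** Up to one additional fine step ([E1]), the finer scheme replaces each coarse step by two half
    steps. The local error is quadratic in the step ([E2]) and accumulates over about [t / h] steps
    ([E3]). The resulting bound halves with [k], as [geometric_cauchy] requires. *)
Let euler_refine k t x : 0 <= t -> D x -> D (A x) ->
  N (euler k.+1 t x - euler k t x) <=
    (2 * t * N (A (A x)) + N (A x)) * hs k.
Proof.
move=> t0 Dx DAx; set n := steps k t; set h := hs k; set h' := hs k.+1.
have h0 : 0 < h := hs0 k; have h'0 : 0 < h' := hs0 k.+1.
have hE : h = 2 * h' by rewrite /h' hsS -/h; field.
have cJ := resolvent_contractive h0; have cJ' := resolvent_contractive h'0.
pose T := J h' \o J h'.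
have cT : contractive T := contractive_iter 2 cJ'.
have iT y : iter n T y = iter (n.*2) (J h') y.
  by elim: (n) => [//|m IH]; rewrite doubleS !iterS IH.
have E1 : N (euler k.+1 t x - iter n T x) <= h' * N (A x).
  rewrite iT /euler -/h'.
  have [|||->|->] := @steps_near k.+1 t n.*2 => //.
  - have := steps_le k t0; rewrite -/n -/h -/h' hE -mul2n natrM; lra.
  - have := steps_gt k t; rewrite -/n -/h -/h' hE.
    rewrite (_ : n.*2.+2%:R = 2 * n%:R + 2); last first.
      by rewrite -mul2n -[_.+2]addn2 natrD natrM.
    lra.
  - by rewrite subrr (n0 NP) mulr_ge0 ?(n_ge0 NP)// ltW.
  rewrite iterSr; apply: le_trans (resolvent_dist h'0 Dx).
  exact: contractive_dist (contractive_iter _ cJ').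
(* The first order terms of both schemes are [h A x] and cancel; what is left are distances between
   resolvents of [A x] and [A x] itself, each of order [h * N (A (A x))]. *)
have E2 : N (T x - J h x) <= 2 * h ^+ 2 * N (A (A x)).
  have [Dy _] := resolventP x h'0.
  have TE : T x - x = h'%:C *: (J h' (J h' (A x)) + J h' (A x)).
    rewrite scalerDr -(resolvent_sub h'0 Dx).
    have [_ <-] := resolvent_A h'0 Dx.
    by rewrite -(resolvent_sub h'0 Dy) addrA subrK.
  have JE : J h x - x = h'%:C *: (J h (A x) + J h (A x)).
    by rewrite resolvent_sub// hE rmorphM/= mulrC -scalerA (_ : 2%:C = 1 + 1)
      ?scalerDl ?scale1r// rmorphD rmorph1.
  have -> : T x - J h x = h'%:C *: ((J h' (J h' (A x)) - A x) +
      (J h' (A x) - A x) - ((J h (A x) - A x) + (J h (A x) - A x))).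
    rewrite !(addrACA _ (- A x) _ (- A x)) -(opprD (A x)) subrACA subrr subr0.
    by rewrite scalerBr -TE -JE opprB addrA subrK.
  rewrite (nZr NP) gtr0_norm//.
  have a1 := resolvent_dist h0 DAx.
  have a2 := resolvent_dist h'0 DAx.
  have a3 := iter_resolvent_dist 2 h'0 DAx.
  rewrite -[iter 2 _ _]/(J h' (J h' (A x))) in a3.
  have := nB NP (J h' (J h' (A x)) - A x + (J h' (A x) - A x))
    (J h (A x) - A x + (J h (A x) - A x)).
  have := nD NP (J h (A x) - A x) (J h (A x) - A x).
  have := nD NP (J h' (J h' (A x)) - A x) (J h' (A x) - A x).
  have := n_ge0 NP (A (A x)).
  move: (N (A (A x))) a1 a2 a3 => q a1 a2 a3 q0 b1 b2 b3.
  (* The contributions [2 h' + h' + 2 h] add up to [7 h'], rounded up to [4 h]. *)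
  have b4 : N (J h' (J h' (A x)) - A x + (J h' (A x) - A x) -
    (J h (A x) - A x + (J h (A x) - A x))) <= 4 * h * q.
    have hq : h * q = 2 * (h' * q) by rewrite hE; ring.
    have q1 : 0 <= h' * q by rewrite mulr_ge0// ltW.
    lra.
  apply: (@le_trans _ _ (h' * (4 * h * q))); first by rewrite ler_pM2l.
  by rewrite hE; nra.
have E3 : N (iter n T x - euler k t x) <= 2 * t * h * N (A (A x)).
  have TJ y : T (J h y) = J h (T y).
    by rewrite /T /= !(resolvent_comm _ h'0 h0).
  apply: le_trans (comm_contractive_iter_dist n x cT cJ TJ) _.
  apply: (@le_trans _ _ (n%:R * (2 * h ^+ 2 * N (A (A x))))).
    by rewrite ler_wpM2l.
  have := steps_le k t0; rewrite -/n -/h => nt.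
  rewrite [leLHS](_ : _ = (n%:R * h) * (2 * h * N (A (A x)))); last by ring.
  rewrite [leRHS](_ : _ = t * (2 * h * N (A (A x)))); last by ring.
  by rewrite ler_wpM2r// !mulr_ge0 ?(n_ge0 NP)// ltW.
have := ntri NP (iter n T x) (euler k.+1 t x) (euler k t x).
have : h' * N (A x) <= h * N (A x).
  by rewrite ler_wpM2r ?(n_ge0 NP)// hE; lra.
lra.
Qed.

Let euler_cvg t x : 0 <= t -> exists l, nlim N (fun k => euler k t x) l.
Proof.
move=> t0; apply: complN => e e0.
have [|y [Dy DAy xy]] := dense2 x (e := e / 4); first lra.
pose r k := (2 * t * N (A (A y)) + N (A y)) * hs k.
have [|l [yl _]] := @geometric_cauchy _ _ _ NP complN (fun k => euler k t y) r
  (fun k => euler_refine k t0 Dy DAy).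
  by move=> k; rewrite /r hsS mulrA.
have [|n1 h] := nlim_cauchy NP yl (e := e / 4); first lra.
exists n1 => i j hi hj; have := h i j hi hj.
have := contractive_dist x y (euler_contractive i t).
have := contractive_dist x y (euler_contractive j t).
have := ntri NP (euler i t y) (euler i t x) (euler j t x).
have := ntri NP (euler j t y) (euler i t y) (euler j t x).
rewrite (ndistC NP (euler j t y) (euler j t x)); lra.
Qed.

Definition exp_semigroup (t : R) (x : V) : V :=
  xget 0 [set l | nlim N (fun k => euler k t x) l].
Local Notation S := exp_semigroup.

Lemma exp_semigroup_lim t x : 0 <= t -> nlim N (fun k => euler k t x) (S t x).
Proof.
move=> t0; rewrite /S; case: xgetP => [y _ //|H].
by have [l /H] := euler_cvg x t0.
Qed.

Lemma exp_semigroup_contractive t : 0 <= t -> contractive (S t).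
Proof.
move=> t0; split => [k x y|x].
  apply: (nlim_unique NP (exp_semigroup_lim (k *: x + y) t0)) => e e0.
  have k1 : 0 < 2 * (1 + normc k) by have := normc_ge0 k; lra.
  have [|n1 h1] := exp_semigroup_lim x t0 (e := e / (2 * (1 + normc k))).
    by rewrite divr_gt0.
  have [|n2 h2] := exp_semigroup_lim y t0 (e := e / 2); first lra.
  exists (maxn n1 n2) => n; rewrite geq_max => /andP[/h1 + /h2].
  have [-> _] := euler_contractive n t.
  rewrite opprD addrACA -scalerBr ltr_pdivlMr//.
  have := nD NP (k *: (euler n t x - S t x)) (euler n t y - S t y).
  rewrite (nZ NP); have := n_ge0 NP (euler n t x - S t x); have := normc_ge0 k.
  move: (N (k *: _ + _)) (N (euler n t y - _)) (normc k) (N (euler n t x - S t x)).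
  by move=> a b p q ? ? ? ? ?; nra.
have := nlim_le NP (exp_semigroup_lim x t0) (z := 0) (r := N x).
rewrite !subr0; apply; exists 0%N => n _; rewrite subr0.
by have [_] := euler_contractive n t.
Qed.

Lemma exp_semigroup0 x : S 0 x = x.
Proof.
apply: (nlim_unique NP (exp_semigroup_lim x (lexx 0))) => e e0.
by exists 0%N => n _; rewrite /euler /steps mul0r truncn0 subrr (n0 NP).
Qed.

Lemma n_eq_dense (S1 S2 : V -> V) (M : R) :
  (forall x y, N (S1 x - S1 y) <= M * N (x - y)) ->
  (forall x y, N (S2 x - S2 y) <= M * N (x - y)) ->
  (forall x, D x -> S1 x = S2 x) -> forall x, S1 x = S2 x.
Proof.
move=> c1 c2 eqD x; apply/eqP; rewrite -subr_eq0; apply/eqP/(n_eq0_le NP) => e e0.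
have M0 : 0 < 2 * (1 + `|M|) by have := normr_ge0 M; lra.
have [|y Dy xy] := Adense x (e := e / (2 * (1 + `|M|))); first by rewrite divr_gt0.
have := ntri NP (S1 y) (S1 x) (S2 x); rewrite {2}(eqD _ Dy).
have := c1 x y; have := c2 y x; rewrite (ndistC NP y x).
move: xy; rewrite ltr_pdivlMr//; have := n_ge0 NP (x - y); have := ler_norm M.
move: (`|M|) (N (x - y)) => p q; nra.
Qed.

Lemma exp_semigroupD s t x : 0 <= s -> 0 <= t -> S (s + t) x = S s (S t x).
Proof.
move=> s0 t0; have st0 : 0 <= s + t by rewrite addr_ge0.
apply: (@n_eq_dense (S (s + t)) (S s \o S t) 1) => {x} [x y|x y|x Dx].
- by rewrite mul1r; exact: contractive_dist (exp_semigroup_contractive st0).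
- rewrite mul1r; apply: le_trans (contractive_dist _ _ (exp_semigroup_contractive s0)) _.
  exact: contractive_dist (exp_semigroup_contractive t0).
apply: (nlim_unique NP (exp_semigroup_lim x st0)) => e e0 /=.
have [|n1 h1] := exp_semigroup_lim x t0 (e := e / 4); first lra.
have [|n2 h2] := exp_semigroup_lim (S t x) s0 (e := e / 4); first lra.
have Ax1 : 0 < 4 * (1 + N (A x)) by have := n_ge0 NP (A x); lra.
have [|n3 h3] := hs_small (e := e / (4 * (1 + N (A x)))); first by rewrite divr_gt0.
exists (maxn n1 (maxn n2 n3)) => k; rewrite !geq_max => /and3P[/h1 {}h1 /h2 {}h2 /h3 {}h3].
(* The two sides differ by at most one Euler step, which moves [x] by at most this amount. *)
have H : N (euler k (s + t) x - euler k s (euler k t x)) <= hs k * N (A x).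
  rewrite /euler -iterD.
  have [|||->|->] := @steps_near k (s + t) (steps k s + steps k t) => //.
  - by rewrite natrD mulrDl lerD// steps_le.
  - have := steps_gt k s; have := steps_gt k t.
    rewrite -[_.+2]addn2 natrD mulrDl natrD mulrDl; lra.
  - by rewrite subrr (n0 NP) mulr_ge0 ?(n_ge0 NP)// ltW.
  rewrite iterSr; apply: le_trans (resolvent_dist (hs0 k) Dx).
  apply: contractive_dist (contractive_iter _ (resolvent_contractive _)) => //.
move: h3; rewrite ltr_pdivlMr// => h3.
have := contractive_dist (euler k t x) (S t x) (euler_contractive k s).
have := ntri NP (euler k s (euler k t x)) (euler k (s + t) x) (S s (S t x)).
have := ntri NP (euler k s (S t x)) (euler k s (euler k t x)) (S s (S t x)).
have := n_ge0 NP (A x); have := hs0 k.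
move: (hs k) (N (A x)) H h3 => p q; nra.
Qed.

Lemma exp_semigroup_dist t x : 0 <= t -> D x -> N (S t x - x) <= t * N (A x).
Proof.
move=> t0 Dx; apply: (nlim_le NP (exp_semigroup_lim x t0)); exists 0%N => k _.
apply: le_trans (iter_resolvent_dist _ (hs0 k) Dx) _.
by rewrite ler_wpM2r ?(n_ge0 NP)// steps_le.
Qed.

Lemma exp_semigroup_cont0 x e : 0 < e -> exists2 d, 0 < d &
  forall t, 0 <= t -> t < d -> N (S t x - x) < e.
Proof.
move=> e0; have [|y Dy xy] := Adense x (e := e / 3); first lra.
have p : 0 < 3 * (1 + N (A y)) by have := n_ge0 NP (A y); lra.
exists (e / (3 * (1 + N (A y)))); first by rewrite divr_gt0.
move=> t t0; rewrite ltr_pdivlMr// => td.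
have := exp_semigroup_dist t0 Dy.
have := contractive_dist x y (exp_semigroup_contractive t0).
have := ntri NP (S t y) (S t x) x; have := ntri NP y (S t y) x.
rewrite (ndistC NP y x); lra.
Qed.

(** Each Euler increment is [hs k] times an iterate of the resolvent at [A x], and these iterates
    stay near [A x] for short times. The estimate thus holds for the Euler approximations uniformly
    in [k], and the limit is taken at fixed [t]. *)
Lemma exp_semigroup_der0 x e : D x -> 0 < e -> exists2 d, 0 < d &
  forall t, 0 <= t -> t < d -> N (S t x - x - t%:C *: A x) <= e * t.
Proof.
move=> Dx e0; have [|y Dy xy] := Adense (A x) (e := e / 4); first lra.
have p : 0 < 2 * (1 + N (A y)) by have := n_ge0 NP (A y); lra.
exists (e / (2 * (1 + N (A y)))); first by rewrite divr_gt0.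
move=> t t0; rewrite ltr_pdivlMr// => td.
(* [A x] need not lie in [D], so the distance estimate is applied to its approximation [y]. *)
have near k j : (j <= (steps k t))%N -> N (iter j (J (hs k)) (A x) - A x) <= e.
  move=> jn; have := iter_resolvent_dist j (hs0 k) Dy.
  have := contractive_dist (A x) y (contractive_iter j (resolvent_contractive (hs0 k))).
  have := ntri NP (iter j (J (hs k)) y) (iter j (J (hs k)) (A x)) (A x).
  have := ntri NP y (iter j (J (hs k)) y) (A x); rewrite (ndistC NP y).
  have : j%:R * hs k <= t.
    by apply: le_trans (steps_le k t0); rewrite ler_pM2r// ler_nat.
  have := n_ge0 NP (A y).
  move: (N (A y)) (j%:R * hs k) td => a b; nra.
have step k j : (j <= (steps k t))%N ->
    N (iter j (J (hs k)) x - x - (j%:R * hs k)%:C *: A x) <= e * (j%:R * hs k).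
  elim: j => [_|j IH jn].
    by rewrite !mul0r mulr0 scale0r subr0 subrr (n0 NP).
  have := IH (ltnW jn); have := near _ _ jn.
  have [Dz _] := resolventP x (hs0 k).
  have E : iter j.+1 (J (hs k)) x - iter j (J (hs k)) x =
      (hs k)%:C *: iter j.+1 (J (hs k)) (A x).
    rewrite !iterSr -contractiveB; last first.
      exact: contractive_iter (resolvent_contractive _).
    rewrite resolvent_sub// contractiveZ//.
    exact: contractive_iter (resolvent_contractive _).
  have -> : iter j.+1 (J (hs k)) x - x - (j.+1%:R * hs k)%:C *: A x =
    (iter j (J (hs k)) x - x - (j%:R * hs k)%:C *: A x) +
      (hs k)%:C *: (iter j.+1 (J (hs k)) (A x) - A x).
    rewrite scalerBr -E -[j.+1%:R]natr1 mulrDl mul1r rmorphD/= scalerDl opprD.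
    by rewrite [RHS]addrACA [X in _ = X + _]addrC subrKA.
  have := nD NP (iter j (J (hs k)) x - x - (j%:R * hs k)%:C *: A x)
   ((hs k)%:C *: (iter j.+1 (J (hs k)) (A x) - A x)).
  rewrite (nZr NP) gtr0_norm// -[j.+1%:R]natr1.
  have := hs0 k; have := n_ge0 NP (iter j.+1 (J (hs k)) (A x) - A x).
  move: (hs k) (N (iter j.+1 (J _) _ - _)) (j%:R) => a b c; nra.
apply/ler_addgt0Pr => d d0.
have Ax1 : 0 < 2 * (1 + N (A x)) by have := n_ge0 NP (A x); lra.
have [|n1 h1] := hs_small (e := d / (2 * (1 + N (A x)))); first by rewrite divr_gt0.
have [|n2 h2] := exp_semigroup_lim x t0 (e := d / 2); first lra.
set k := maxn n1 n2.
have {}h1 := h1 k (leq_maxl _ _); have {}h2 := h2 k (leq_maxr _ _).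
have := step k _ (leqnn _); rewrite -/(euler k t x).
have := steps_le k t0; have := steps_gt k t.
set tk := _%:R * _ => g1 g2 g3.
have -> : S t x - x - t%:C *: A x =
   (S t x - euler k t x) + (euler k t x - x - tk%:C *: A x) - (t - tk)%:C *: A x.
  by rewrite rmorphB scalerBl opprB [X in _ = X + _]addrA !subrKA.
have := nB NP ((S t x - euler k t x) + (euler k t x - x - tk%:C *: A x))
  ((t - tk)%:C *: A x).
have := nD NP (S t x - euler k t x) (euler k t x - x - tk%:C *: A x).
rewrite (nZr NP) ger0_norm; last by rewrite subr_ge0.
move: h1; rewrite ltr_pdivlMr// (ndistC NP (S t x)).
have := n_ge0 NP (A x).
move: (N (A x)) (hs k) g1 => a b g1 h4 h5 h6.
have : (t - tk) * a <= b * a by rewrite ler_wpM2r//; lra.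
have := ler_wpM2l (ltW e0) g2; lra.
Qed.

(** [S t] commutes with [J 1], as the Euler approximations do. Since [x = J 1 (x - A x)], [S t x] is
    the resolvent of [S t (x - A x)]; its resolvent equation gives both claims. *)
Lemma exp_semigroup_A t x : 0 <= t -> D x -> D (S t x) /\ A (S t x) = S t (A x).
Proof.
move=> t0 Dx; have h1 : 0 < (1 : R) by [].
have com z : J 1 (S t z) = S t (J 1 z).
  apply: (nlim_unique NP (u := fun k => J 1 (euler k t z))) => e e0; last first.
    have [n1 h] := exp_semigroup_lim (J 1 z) t0 e0; exists n1 => n /h.
    rewrite /euler (iter_comm (S := J 1)) // => y.
    exact: resolvent_comm.
  have [n1 h] := exp_semigroup_lim z t0 e0; exists n1 => n /h.
  exact: le_lt_trans (contractive_dist _ _ (resolvent_contractive h1)).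
have xE : x = J 1 (x - A x) by apply: resolvent_uniq => //; rewrite scale1r.
have cS := exp_semigroup_contractive t0.
have [Dz] := resolventP (S t (x - A x)) h1.
rewrite com -xE in Dz *; rewrite scale1r contractiveB// => zE; split => //.
by apply: oppr_inj; apply: (addrI (S t x)).
Qed.

End Generation.

(** * Semigroups generated by a dissipative operator *)

Section RealLimits.
Variable R : realType.

Lemma near_withinP (Q P : R -> Prop) (t : R) :
  (\forall s \near within Q (nbhs t), P s) <->
  exists2 d : R, 0 < d & forall s, `|s - t| < d -> Q s -> P s.
Proof.
rewrite near_withinE; split=> [/nbhs_ballP[d d0 h]|[d d0 h]].
  by exists d => // s st; apply: h; rewrite /ball/= distrC.
by apply/nbhs_ballP; exists d => // s; rewrite /ball/= distrC; exact: h.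
Qed.

Lemma cvg0_withinP (Q : R -> Prop) (t : R) (f : R -> R) : (forall x, 0 <= f x) ->
  (f x @[x --> within Q (nbhs t)] --> (0 : R)) <->
  forall e, 0 < e -> exists2 d : R, 0 < d &
    forall s, `|s - t| < d -> Q s -> f s < e.
Proof.
move=> f0; split=> [/cvgr0Pnorm_lt h e /h|h].
  move=> /near_withinP[d d0 hd]; exists d => // s st Qs.
  by have := hd s st Qs; rewrite ger0_norm.
apply/cvgr0Pnorm_lt => e /h[d d0 hd]; apply/near_withinP; exists d => // s st Qs.
by rewrite ger0_norm//; exact: hd.
Qed.

Lemma cvg0_rightP (f : R -> R) : (forall x, 0 <= f x) ->
  (f x @[x --> (0 : R)^'+] --> (0 : R)) <->
  forall e, 0 < e -> exists2 d : R, 0 < d & forall s, 0 < s -> s < d -> f s < e.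
Proof.
move=> f0; rewrite cvg0_withinP//; split => h e /h[d d0 hd]; exists d => // s.
  by move=> s0 sd; apply: hd; rewrite ?subr0 ?gtr0_norm.
by rewrite subr0 => sd s0; apply: hd => //; rewrite gtr0_norm in sd.
Qed.

(** Take the infimum [m] of the points from which the bound up to [t] holds. One-sided
    semicontinuity puts [m] in the set, and if [m > 0] the left slope bound extends the set beyond
    [m]. *)
Lemma decreasing_of_left_slope (f : R -> R) (e t : R) : 0 <= t ->
  (forall s, 0 <= s -> forall d, 0 < d -> exists2 r, 0 < r &
    forall h, 0 <= h -> h < r -> f (s + h) <= f s + d) ->
  (forall s, 0 < s -> exists2 r, 0 < r &
    forall h, 0 < h -> h < r -> h <= s -> f s <= f (s - h) + e * h) ->
  f t <= f 0 + e * t.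
Proof.
move=> t0 rc lc.
pose S := [set s | [/\ 0 <= s, s <= t & f t <= f s + e * (t - s)]].
have St : S t by split => //; rewrite subrr mulr0 addr0.
have infS : has_inf S by split; [exists t|exists 0 => s []].
pose m := inf S.
have m0 : 0 <= m by apply: lb_le_inf; [exists t|move=> s []].
have mt : m <= t by apply: ge_inf => //; exists 0 => s [].
have Sm : S m.
  split => //; apply/ler_addgt0Pr => d d0.
  have [|r r0 hr] := rc m m0 (d / 2); first lra.
  (* Half of the error [d] goes to the jump of [f] from [m] to [s], the other half to
     [e * (s - m)]. *)
  pose r' := Num.min r (d / (2 * (1 + `|e|))).
  have p : 0 < 2 * (1 + `|e|) by have := normr_ge0 e; lra.
  have r'0 : 0 < r' by rewrite lt_min r0 divr_gt0.
  have [s Ss sm] := inf_adherent r'0 infS; rewrite -/m in sm.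
  have ms : m <= s by apply: ge_inf => //; exists 0 => ? [].
  case: Ss => s0 st fs.
  have := hr (s - m); rewrite subr_ge0 [m + _]addrC subrK => /(_ ms) h.
  have {}h : f s <= f m + d / 2.
    by apply: h; rewrite ltrBlDl; apply: lt_le_trans sm _; rewrite lerD2l ge_min lexx.
  have : (s - m) * (2 * (1 + `|e|)) <= d.
    by rewrite -ler_pdivlMr// lerBlDl; apply: le_trans (ltW sm) _; rewrite lerD2l
      ge_min lexx orbT.
  have := ler_norm (- e); rewrite normrN.
  move: (`|e|) => q; nra.
have [m_eq0|mn0] := eqVneq m 0; first by case: Sm => _ _; rewrite m_eq0 subr0.
have mp : 0 < m by rewrite lt_neqAle eq_sym mn0.
have [r r0 hr] := lc _ mp.
pose h := Num.min m (r / 2).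
have h0 : 0 < h by rewrite lt_min mp/=; lra.
have hm : h <= m by rewrite ge_min lexx.
have hr2 : h <= r / 2 by rewrite ge_min lexx orbT.
have : S (m - h).
  case: Sm => _ _ fm; split; [lra|lra|].
  have := hr h h0; rewrite hm => /(_ _ isT) H; have {}H : f m <= f (m - h) + e * h.
    by apply: H; lra.
  lra.
move=> Smh; have : m <= m - h by apply: ge_inf => //; exists 0 => ? [].
lra.
Qed.

End RealLimits.

Section WellPosedness.
Variables (R : realType) (V : lmodType R[i]) (N : V -> R).
Hypothesis NP : norm_axioms N.
Hypothesis complN : ncomplete N.
Variables (D : set V) (A : V -> V).
Hypothesis D0 : D 0.
Hypothesis Alin : linear_on D A.
Hypothesis Adis : dissipative N D A.
Hypothesis Arange : forall l, 0 < l -> full_range D A l.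
Hypothesis Adense : forall x e, 0 < e -> exists2 y, D y & N (x - y) < e.

Let Nge0 := n_ge0 NP.

Lemma nlinear_sub (T : V -> V) x y :
  (forall k x y, T (k *: x + y) = k *: T x + T y) -> T (x - y) = T x - T y.
Proof. by move=> l; rewrite addrC -scaleN1r l scaleN1r addrC. Qed.

Lemma nlinear_Z (T : V -> V) k x :
  (forall k x y, T (k *: x + y) = k *: T x + T y) -> T (k *: x) = k *: T x.
Proof.
move=> l; have T0 : T 0 = 0 by have := nlinear_sub 0 0 l; rewrite !subrr.
by rewrite -[k *: x]addr0 l T0 addr0.
Qed.

(* [W' = A W] through left difference quotients: these suffice to bound [N (W t)]
   when [A] is dissipative, hence for uniqueness. *)
Definition left_solution (W : R -> V) : Prop :=
  [/\ forall t, 0 <= t -> D (W t),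
      forall t, 0 <= t -> forall e, 0 < e -> exists2 d : R, 0 < d &
        forall h, 0 <= h -> h < d -> N (W (t + h) - W t) < e
    & forall t, 0 < t -> forall e, 0 < e -> exists2 d : R, 0 < d &
        forall h, 0 < h -> h < d -> h <= t ->
          N (W t - W (t - h) - h%:C *: A (W t)) <= e * h].

Lemma left_solutionB W W' : left_solution W -> left_solution W' ->
  left_solution (fun t => W t - W' t).
Proof.
move=> [Wd Wr Wl] [Wd' Wr' Wl']; split.
- by move=> t t0; apply: (D_B Alin); [exact: Wd|exact: Wd'].
- move=> t t0 e e0; have [|d d0 hd] := Wr t t0 (e / 2); first lra.
  have [|d' d'0 hd'] := Wr' t t0 (e / 2); first lra.
  exists (Num.min d d') => [|h h0]; rewrite lt_min ?d0// => /andP[/(hd _ h0) a /(hd' _ h0) b].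
  rewrite subrACA; have := nB NP (W (t + h) - W t) (W' (t + h) - W' t); lra.
- move=> t t0 e e0; have [|d d0 hd] := Wl t t0 (e / 2); first lra.
  have [|d' d'0 hd'] := Wl' t t0 (e / 2); first lra.
  exists (Num.min d d') => [|h h0]; rewrite lt_min ?d0// => /andP[hd1 hd2] ht.
  have a := hd h h0 hd1 ht; have b := hd' h h0 hd2 ht.
  rewrite (A_B D0 Alin); [|exact/Wd/ltW|exact/Wd'/ltW].
  rewrite scalerBr (subrACA (W t)) [X in N X]subrACA.
  have := nB NP (W t - W (t - h) - h%:C *: A (W t)) (W' t - W' (t - h) - h%:C *: A (W' t)).
  lra.
Qed.

(** Backward quotients are those of an implicit step: [N (W s) <= N (W s - h A (W s)) <= N (W (s -
    h)) + e' h]. *)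
Lemma left_solution_eq0 W : left_solution W -> W 0 = 0 ->
  forall t, 0 <= t -> W t = 0.
Proof.
move=> [Wd Wr Wl] W0 t t0; apply: (n_eq0_le NP) => e e0.
have p : 0 < 1 + t by lra.
pose e' := e / (1 + t).
have e'0 : 0 < e' by rewrite divr_gt0.
have e'E : e' * (1 + t) = e by rewrite /e' divfK// gt_eqF.
suff : N (W t) <= N (W 0) + e' * t by rewrite W0 (n0 NP) add0r; lra.
apply: (decreasing_of_left_slope (f := fun s => N (W s)) t0).
- move=> s s0 d d0; have [r r0 hr] := Wr s s0 d d0; exists r => // h h0 hr'.
  have := hr h h0 hr'; have := nD NP (W (s + h) - W s) (W s); rewrite subrK; lra.
- move=> s s0; have [r r0 hr] := Wl s s0 _ e'0; exists r => // h h0 hr' hs.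
  have := hr h h0 hr' hs.
  have := Adis (Wd s (ltW s0)) (ltW h0).
  have := nD NP (W s - W (s - h) - h%:C *: A (W s)) (W (s - h)).
  by rewrite addrAC subrK; lra.
Qed.

(** Says that the generator of [T] extends [A]; that it is no larger is proved in
    [contraction_semigroup_generated] from the range of [1 - A]. *)
Definition contraction_semigroup (T : R -> V -> V) : Prop :=
  [/\ forall t, 0 <= t -> contractive N (T t),
      forall x, T 0 x = x,
      forall s t x, 0 <= s -> 0 <= t -> T (s + t) x = T s (T t x),
      forall x e, 0 < e -> exists2 d, 0 < d &
        forall t, 0 <= t -> t < d -> N (T t x - x) < e
    & (forall x e, D x -> 0 < e -> exists2 d, 0 < d &
        forall t, 0 <= t -> t < d -> N (T t x - x - t%:C *: A x) <= e * t) /\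
      forall t x, 0 <= t -> D x -> D (T t x) /\ A (T t x) = T t (A x)].

Lemma exp_contraction_semigroup : contraction_semigroup (exp_semigroup N D A).
Proof.
split.
- by move=> t; exact: exp_semigroup_contractive.
- by move=> x; exact: exp_semigroup0.
- by move=> s t x; exact: exp_semigroupD.
- by move=> x e; exact: exp_semigroup_cont0.
- split; first by move=> x e; exact: exp_semigroup_der0.
  by move=> t x; exact: exp_semigroup_A.
Qed.

Lemma contraction_semigroup_generated T : contraction_semigroup T ->
  generated_by N D A T.
Proof.
move=> [Tc T0 TD Tcont [Tder TA]].
have gen x : D x -> generator N T x (A x).
  move=> Dx; apply/cvg0_rightP => // e e0.
  have [|d d0 hd] := Tder x (e / 2) Dx; first lra.
  exists d => // h h0 hh; have := hd h (ltW h0) hh.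
  have -> : h^-1%:C *: (T h x - x) - A x = h^-1%:C *: (T h x - x - h%:C *: A x).
    by rewrite [RHS]scalerBr scalerA -rmorphM/= mulVf ?gt_eqF// scale1r.
  rewrite (nZr NP) gtr0_norm ?invr_gt0// => a.
  rewrite ltr_pdivrMl//; apply: le_lt_trans a _.
  by rewrite mulrC ltr_pM2l//; lra.
split; first split => //.
- move=> t t0; have [l c] := Tc t t0; split => //.
  by exists 1 => x; rewrite mul1r.
- move=> x; apply/cvg0_rightP => // e /Tcont-/(_ x)[d d0 hd]; exists d => // s s0.
  by apply: hd; exact: ltW.
move=> x w; split; last by case=> Dx <-; exact: gen.
(* With this [z], the generator maps [u = x - z] to [u] itself. Then [T h u] is close to
   [(1 + h) u], which a contraction allows only for [u = 0]. *)
move=> gx; have [z Dz zx] := Arange ltr01 (x - w).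
rewrite scale1r in zx.
suff xz : x - z = 0.
  have xE : x = z by apply/eqP; rewrite -subr_eq0 xz.
  by split; [rewrite xE|move: zx; rewrite -xE => /addrI/oppr_inj].
apply: (n_eq0_le NP) => e e0.
have e2 : 0 < e / 2 by lra.
have [d d0 hd] := (cvg0_rightP (fun _ => Nge0 _)).1 gx _ e2.
have [d' d'0 hd'] := (cvg0_rightP (fun _ => Nge0 _)).1 (gen z Dz) _ e2.
pose h := Num.min d d' / 2.
have md : 0 < Num.min d d' by rewrite lt_min d0.
have h0 : 0 < h by rewrite /h; lra.
have hmin : h < Num.min d d' by rewrite /h; lra.
move: hmin; rewrite lt_min => /andP[hh hh'].
have {}hd := hd h h0 hh; have {}hd' := hd' h h0 hh'.
have [l c] := Tc h (ltW h0).
pose u := x - z.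
have wE : w - A z = u.
  by apply/esym/eqP; rewrite -subr_eq0 /u -subrACA zx subrr.
have a : N (h^-1%:C *: (T h u - u) - u) < e.
  rewrite -{3}wE /u (nlinear_sub _ _ l) subrACA scalerBr subrACA.
  have := nB NP (h^-1%:C *: (T h x - x) - w) (h^-1%:C *: (T h z - z) - A z); lra.
have := c u; rewrite -/u.
have E : (1 + h)%:C *: u = T h u - h%:C *: (h^-1%:C *: (T h u - u) - u).
  rewrite [h%:C *: (_ - _)]scalerBr scalerA -rmorphM/= divff ?gt_eqF// scale1r.
  by rewrite [- (_ - _ - _)]opprB addrCA subKr rmorphD rmorph1 scalerDl scale1r addrC.
have := nB NP (T h u) (h%:C *: (h^-1%:C *: (T h u - u) - u)).
rewrite -E !(nZr NP) gtr0_norm ?addr_gt0// gtr0_norm//.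
move: (N (_ - u)) a => q a.
have := Nge0 u; nra.
Qed.

(** * Arbitrary semigroups generated by [A] *)

Section GeneratedBy.
Variable T : R -> V -> V.
Hypothesis Tgen : generated_by N D A T.

Let Tlin t : 0 <= t -> forall k x y, T t (k *: x + y) = k *: T t x + T t y.
Proof. by move=> t0; case: Tgen => -[/(_ t t0)[+ _] _ _ _] _. Qed.
Let T0 x : T 0 x = x. Proof. by case: Tgen => -[]. Qed.
Let TD s t x : 0 <= s -> 0 <= t -> T (s + t) x = T s (T t x).
Proof. by case: Tgen => -[_ _ + _] _; apply. Qed.
Let Tcont0 x e : 0 < e -> exists2 d, 0 < d &
   forall t, 0 <= t -> t < d -> N (T t x - x) < e.
Proof.
move=> e0; case: Tgen => -[_ _ _ /(_ x)/cvg0_rightP] h _.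
have [//|d d0 hd] := h _ _ e0; exists d => // t; rewrite le_eqVlt => /predU1P[<-|].
  by rewrite T0 subrr (n0 NP).
exact: hd.
Qed.

Let Tbound t : 0 <= t -> exists2 M, 0 <= M & forall x, N (T t x) <= M * N x.
Proof.
move=> t0; case: Tgen => -[/(_ t t0)[_ [M hM]] _ _ _] _; exists `|M| => // x.
by apply: le_trans (hM x) _; rewrite ler_wpM2r// ler_norm.
Qed.

(** [C0_semigroup] bounds each [T t] separately. If no bound were uniform near 0, some times
    [t_n <= n.+1^-1] would have operators exceeding the bound [n.+1]; their orbits are bounded by
    continuity at 0, against uniform boundedness. *)
Let Tbound0 : exists d M : R, [/\ 0 < d, 1 <= M &
  forall t x, 0 <= t -> t <= d -> N (T t x) <= M * N x].
Proof.
apply: contrapT => nb.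
have bad n : exists tx : R * V, [/\ 0 <= tx.1, tx.1 <= n.+1%:R^-1 &
    n.+1%:R * N tx.2 < N (T tx.1 tx.2)].
  apply: contrapT => /forallNP h; apply: nb; exists n.+1%:R^-1, n.+1%:R.
  split; [by rewrite invr_gt0|by rewrite ler1n|move=> t x t0 tn].
  by rewrite leNgt; apply/negP => hx; apply: (h (t, x)).
have [tx txP] := choice bad.
have t0 n : 0 <= (tx n).1 by have [] := txP n.
have [B BP] : exists B : nat -> R, forall n x, N (T (tx n).1 x) <= B n * N x.
  have ex n : exists b : R, forall x, N (T (tx n).1 x) <= b * N x.
    by have [b _ hb] := Tbound (t0 n); exists b.
  by have [B BP] := choice ex; exists B.
have [||||M MP] := uniform_boundedness NP complN (T := fun n => T (tx n).1) (B := B).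
- by move=> n x y; rewrite -[x]scale1r Tlin// !scale1r.
- by move=> n k x; exact: (nlinear_Z _ _ (Tlin (t0 n))).
- exact: BP.
- move=> x; have [d d0 hd] := Tcont0 x ltr01.
  have [n1 h1] : exists n1, forall n, (n1 <= n)%N -> n.+1%:R^-1 < d.
    exists (Num.trunc d^-1).+1 => n hn.
    rewrite invf_plt ?posrE//; apply: (lt_trans (truncnS_gt _)).
    by rewrite ltr_nat.
  (* Late times are close to 0, where [T t x] is within 1 of [x]; the sum covers the finitely many
     early ones. *)
  exists (1 + N x + \sum_(i < n1) N (T (tx i).1 x)) => n.
  have s0 : 0 <= \sum_(i < n1) N (T (tx i).1 x) by apply: sumr_ge0.
  have [/h1 hn|hn] := leqP n1 n.
    have [_ tn _] := txP n; have := hd _ (t0 n) (le_lt_trans tn hn).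
    have := nD NP (T (tx n).1 x - x) x; rewrite subrK; lra.
  rewrite (bigD1 (Ordinal hn))//=.
  have : 0 <= \sum_(i < n1 | i != Ordinal hn) N (T (tx i).1 x) by apply: sumr_ge0.
  have := Nge0 x; lra.
pose n := Num.trunc M.
have [_ _] := txP n; have := MP n (tx n).2.
have := ler_wpM2r (Nge0 (tx n).2) (ltW (truncnS_gt M)); rewrite -/n; lra.
Qed.

Let Tlocal t : exists2 M, 0 <= M & forall s x, 0 <= s -> s <= t ->
  N (T s x) <= M * N x.
Proof.
have [d [M [d0 M1 hM]]] := Tbound0.
have H n s x : 0 <= s -> s <= n%:R * d -> N (T s x) <= M ^+ n * N x.
  elim: n s x => [|n IH] s x s0.
    rewrite mul0r => s0'; have -> : s = 0 by apply/eqP; rewrite eq_le s0' s0.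
    by rewrite T0 expr0 mul1r.
  rewrite -natr1 mulrDl mul1r => sn.
  have Mn : 1 <= M ^+ n by rewrite exprn_ege1.
  have [h|h] := leP s d.
    apply: le_trans (hM _ _ s0 h) _; rewrite ler_wpM2r// exprS ler_peMr//; lra.
  have -> : s = d + (s - d) by rewrite addrC subrK.
  rewrite TD ?subr_ge0 ?(ltW d0) ?(ltW h)//.
  apply: le_trans (hM _ _ (ltW d0) (lexx _)) _.
  rewrite exprS -mulrA ler_wpM2l; [|lra|]; first by [].
  by apply: IH; [rewrite subr_ge0 ltW|lra].
pose n := (Num.trunc (t / d)).+1.
exists (M ^+ n); first by rewrite exprn_ge0//; lra.
move=> s x s0 st; apply: H => //; apply: le_trans st _.
by rewrite -ler_pdivrMr// ltW// truncnS_gt.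
Qed.

Let Tder x e : D x -> 0 < e -> exists2 d, 0 < d &
  forall t, 0 <= t -> t < d -> N (T t x - x - t%:C *: A x) <= e * t.
Proof.
move=> Dx e0; case: Tgen => _ /(_ x (A x))[_ /(_ (conj Dx erefl))].
move=> /cvg0_rightP-/(_ (fun _ => Nge0 _) e e0)[d d0 hd]; exists d => // t.
rewrite le_eqVlt => /predU1P[<- _|t0 /(hd _ t0)/ltW h].
  by rewrite T0 subrr scale0r subrr (n0 NP) mulr0.
have -> : T t x - x - t%:C *: A x = t%:C *: (t^-1%:C *: (T t x - x) - A x).
  by rewrite [RHS]scalerBr scalerA -rmorphM/= divff ?gt_eqF// scale1r.
by rewrite (nZr NP) gtr0_norm// mulrC ler_wpM2r// ltW.
Qed.

(** [T t] commutes with the difference quotients at 0, so [T t x] lies in the domain of the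
    generator, which is [D]. *)
Let TA t x : 0 <= t -> D x -> D (T t x) /\ A (T t x) = T t (A x).
Proof.
move=> t0 Dx; case: (Tgen) => _ /(_ (T t x) (T t (A x)))[+ _]; apply.
apply/cvg0_rightP => // e e0.
have [M M0 hM] := Tbound t0.
have p : 0 < 2 * (1 + M) by lra.
have [|d d0 hd] := Tder (e := e / (2 * (1 + M))) Dx; first by rewrite divr_gt0.
exists d => // h h0 hh; have := hd h (ltW h0) hh.
have -> : h^-1%:C *: (T h (T t x) - T t x) - T t (A x) =
    T t (h^-1%:C *: (T h x - x - h%:C *: A x)).
  rewrite -TD ?(ltW h0)// [h + t]addrC TD ?(ltW h0)//.
  rewrite [in RHS]scalerBr scalerA -rmorphM/= mulVf ?gt_eqF// scale1r.
  have l := Tlin t0.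
  by rewrite (nlinear_sub _ _ l) (nlinear_Z _ _ l) (nlinear_sub _ _ l).
move=> a; apply: le_lt_trans (hM _) _; rewrite (nZr NP) gtr0_norm ?invr_gt0//.
have {}a : h^-1 * N (T h x - x - h%:C *: A x) <= e / (2 * (1 + M)).
  by rewrite ler_pdivrMl// mulrC.
have E : e / (2 * (1 + M)) * (2 * (1 + M)) = e by rewrite divfK// gt_eqF.
move: (e / _) (_^-1 * _) a E => q r a E; nra.
Qed.

(** The backward quotient at [t] is [T (t - h)] applied to a remainder at time 0. As [t - h] varies
    with [h], this needs a bound uniform on [0, t], which is the purpose of [Tlocal]. *)
Lemma generated_left_solution x : D x -> left_solution (fun t => T t x).
Proof.
move=> Dx; split.
- by move=> t t0; have [] := TA t0 Dx.
- move=> t t0 e e0; have [M M0 hM] := Tbound t0.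
  have p : 0 < 1 + M by lra.
  have [|d d0 hd] := Tcont0 x (e := e / (1 + M)); first by rewrite divr_gt0.
  exists d => // h h0 /(hd _ h0); rewrite ltr_pdivlMr// => a.
  rewrite TD// -(nlinear_sub _ _ (Tlin t0)).
  apply: le_lt_trans (hM _) _; have := Nge0 (T h x - x); nra.
move=> t t0 e e0; have [M M0 hM] := Tlocal t.
have p : 0 < 2 * (1 + M) by lra.
have [|d d0 hd] := Tder (e := e / (2 * (1 + M))) Dx; first by rewrite divr_gt0.
have [|d' d'0 hd'] := Tcont0 (A x) (e := e / (2 * (1 + M))); first by rewrite divr_gt0.
exists (Num.min d d') => [|h h0]; rewrite lt_min ?d0// => /andP[hh hh'] ht.
have a := hd _ (ltW h0) hh; have a' := hd' _ (ltW h0) hh'.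
have th : 0 <= t - h by rewrite subr_ge0.
have [_ ->] := TA (ltW t0) Dx.
have -> : T t x - T (t - h) x - h%:C *: T t (A x) =
    T (t - h) (T h x - x - h%:C *: T h (A x)).
  have l := Tlin th; rewrite !(nlinear_sub _ _ l) (nlinear_Z _ _ l).
  by rewrite -!TD ?(ltW h0)// subrK.
apply: le_trans (hM _ _ th _) _; first by rewrite lerBlDr lerDl ltW.
have b : N (T h x - x - h%:C *: T h (A x)) <= e / (2 * (1 + M)) * h * 2.
  have -> : T h x - x - h%:C *: T h (A x) =
      (T h x - x - h%:C *: A x) - h%:C *: (T h (A x) - A x).
    by rewrite scalerBr opprB [RHS]addrA subrK.
  have := nB NP (T h x - x - h%:C *: A x) (h%:C *: (T h (A x) - A x)).
  rewrite (nZr NP) gtr0_norm//; move: a'; rewrite -(ltr_pM2l h0); lra.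
have E : e / (2 * (1 + M)) * (2 * (1 + M)) = e by rewrite divfK// gt_eqF.
have q0 : 0 < e / (2 * (1 + M)) by rewrite divr_gt0.
apply: (@le_trans _ _ (M * (e / (2 * (1 + M)) * h * 2))); first by rewrite ler_wpM2l.
move: (e / _) E q0 => q <- q0; have := mulr_gt0 q0 h0; nra.
Qed.

Lemma generated_bounded t : 0 <= t -> exists M : R, forall x y,
  N (T t x - T t y) <= M * N (x - y).
Proof.
move=> t0; have [M _ hM] := Tbound t0; exists M => x y.
by rewrite -(nlinear_sub _ _ (Tlin t0)).
Qed.

End GeneratedBy.

Lemma generated_uniq T T' : generated_by N D A T -> generated_by N D A T' ->
  forall t x, 0 <= t -> T t x = T' t x.
Proof.
move=> g g' t x t0.
have [M hM] := generated_bounded g t0; have [M' hM'] := generated_bounded g' t0.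
apply: (n_eq_dense NP Adense (S1 := T t) (S2 := T' t) (M := Num.max M M')) => {x}.
- by move=> x y; apply: le_trans (hM _ _) _; rewrite ler_wpM2r// le_max lexx.
- by move=> x y; apply: le_trans (hM' _ _) _; rewrite ler_wpM2r// le_max lexx orbT.
move=> x Dx; apply/eqP; rewrite -subr_eq0; apply/eqP.
apply: (left_solution_eq0 (W := fun t => T t x - T' t x)) t0 => //.
  by apply: left_solutionB; exact: generated_left_solution.
have [[_ -> _ _] _] := g; have [[_ -> _ _] _] := g'; exact: subrr.
Qed.

Lemma generated_contraction T : generated_by N D A T -> contraction_semigroup T.
Proof.
move=> g; have cS := exp_contraction_semigroup.
have E := generated_uniq g (contraction_semigroup_generated cS).
case: cS => [Sc S0 SD Scont [Sder SA]]; split.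
- move=> t t0; have [l c] := Sc t t0; split => [k x y|x]; first by rewrite !E.
  by rewrite E.
- by move=> x; rewrite E.
- by move=> s t x s0 t0; rewrite !E ?addr_ge0//; exact: SD.
- move=> x e /Scont-/(_ x)[d d0 hd]; exists d => // t t0 td.
  by rewrite E//; exact: hd.
split=> [x e Dx e0|t x t0 Dx]; last by rewrite !E//; exact: SA.
by have [d d0 hd] := Sder x e Dx e0; exists d => // t t0 td; rewrite E//; exact: hd.
Qed.

End WellPosedness.

(** * Mild and strong solutions *)

Section Solutions.
Variables (R : realType) (V : lmodType R[i]) (N : V -> R).
Hypothesis NP : norm_axioms N.
Hypothesis complN : ncomplete N.
Variables (D : set V) (A : V -> V).
Hypothesis D0 : D 0.
Hypothesis Alin : linear_on D A.
Hypothesis Adis : dissipative N D A.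
Hypothesis Arange : forall l, 0 < l -> full_range D A l.
Hypothesis Adense : forall x e, 0 < e -> exists2 y, D y & N (x - y) < e.
Hypothesis Asurj : forall x, exists2 y, D y & A y = x.

Let Nge0 := n_ge0 NP.

Lemma continuous_RpP U : continuous_Rp N U <-> forall t, 0 <= t ->
  forall e, 0 < e -> exists2 d : R, 0 < d &
    forall s, `|s - t| < d -> 0 <= s -> N (U s - U t) < e.
Proof. by split=> h t /h/cvg0_withinP; apply. Qed.

Lemma derivative_RpP U t W : derivative_Rp N U t W <->
  forall e, 0 < e -> exists2 d : R, 0 < d & forall h, `|h| < d -> h != 0 ->
    0 <= t + h -> N (U (t + h) - U t - h%:C *: W) < e * `|h|.
Proof.
have E h : h != 0 -> N (U (t + h) - U t - h%:C *: W) =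
    `|h| * N (h^-1%:C *: (U (t + h) - U t) - W).
  move=> h0; rewrite -(nZr NP) scalerBr scalerA -rmorphM/= divff// scale1r //.
split=> [/cvgr0Pnorm_lt H e /H|H].
  rewrite near_withinE => /near_withinP[d d0 hd]; exists d => // h hd1 h0 th.
  rewrite E// mulrC ltr_pM2r ?normr_gt0//.
  by have := hd h; rewrite subr0 => /(_ hd1 h0 th); rewrite ger0_norm.
apply/cvgr0Pnorm_lt => e /H[d d0 hd].
rewrite near_withinE; apply/near_withinP; exists d => // h; rewrite subr0 => hd1 h0 th.
rewrite ger0_norm//; have := hd h hd1 h0 th.
by rewrite E// mulrC ltr_pM2r ?normr_gt0.
Qed.

Lemma nsum_le (f : nat -> V) (s : nat -> R) (e : R) n :
  (forall i, (i < n)%N -> N (f i) <= e * (s i.+1 - s i)) ->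
  N (\sum_(i < n) f i) <= e * (s n - s 0%N).
Proof.
elim: n => [_|n IH h]; first by rewrite big_ord0 (n0 NP) subrr mulr0.
rewrite big_ord_recr/=; have := IH (fun i hi => h i (ltnW hi)).
have := h n (ltnSn n).
by have := nD NP (\sum_(i < n) f i) (f n); lra.
Qed.

Lemma sum_increments (W : zmodType) (f : nat -> W) n :
  \sum_(i < n) (f i.+1 - f i) = f n - f 0%N.
Proof. by rewrite -(big_mkord predT (fun i => f i.+1 - f i)) telescope_sumr. Qed.

Lemma fine_partition (a b d : R) : a <= b -> 0 < d -> exists n, exists s : nat -> R,
  [/\ s 0%N = a, s n = b & forall i, s i <= s i.+1 /\ s i.+1 - s i < d].
Proof.
move=> ab d0; pose n := (Num.trunc ((b - a) / d)).+1.
have n0 : 0 < n%:R :> R by rewrite ltr0n.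
exists n, (fun i => a + i%:R * ((b - a) / n%:R)); split.
- by rewrite mul0r addr0.
- by rewrite mulrCA divff ?gt_eqF// mulr1 addrC subrK.
move=> i; set q := (b - a) / _; rewrite -[i.+1%:R]natr1 mulrDl mul1r addrA; split.
  by rewrite lerDl divr_ge0 ?subr_ge0// ltW.
rewrite (addrC _ q) addrK /q ltr_pdivrMr// mulrC -ltr_pdivrMr//; exact: truncnS_gt.
Qed.

(** The integral over [t, t + h] is not known to exist. Instead, a partition of [0, t] is glued to
    one of [t, t + h]: the difference of the two Riemann sums involves only values of [U] within [e]
    of [w]. *)
Lemma is_integral_increment U t h J J' w e : 0 <= t -> 0 <= h ->
  is_integral N U t J -> is_integral N U (t + h) J' ->
  (forall x, t <= x -> x <= t + h -> N (U x - w) <= e) ->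
  N (J' - J - h%:C *: w) <= e * h.
Proof.
move=> t0 h0 iJ iJ' Uw; apply/ler_addgt0Pr => d d0.
have d2 : 0 < d / 2 by lra.
have [d1 d10 hd1] := iJ _ d2; have [d1' d1'0 hd1'] := iJ' _ d2.
have m0 : 0 < Num.min d1 d1' by rewrite lt_min d10.
have [n [s [s0 sn sP]]] := fine_partition t0 m0.
have [|m [r [r0 rm rP]]] := @fine_partition t (t + h) _ _ m0; first by rewrite lerDl.
(* At the junction [i = n] the value is [r 0 = t = s n], so both pieces fit. *)
pose q i := if (i < n)%N then s i else r (i - n)%N.
have qP i : q i <= q i.+1 /\ q i.+1 - q i < Num.min d1 d1'.
  rewrite /q; have [hi|hi] := ltnP i n.
    have := sP i; have [->|h'] := eqVneq i.+1 n; last by rewrite ltn_neqAle h' hi.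
    by rewrite ltnn subnn r0 -sn.
  by rewrite ltnNge (leqW hi)/= subSn.
have rmono i j : (i <= j)%N -> r i <= r j.
  move=> /subnKC <-; elim: (j - i)%N => [|k IH]; first by rewrite addn0.
  by rewrite addnS; apply: le_trans IH _; have [] := rP (i + k)%N.
have q0 : q 0%N = 0 by rewrite /q; case: ltnP => // n0; rewrite sub0n r0 -sn -s0;
  move: n0; rewrite leqn0 => /eqP ->.
have qn : q (n + m)%N = t + h by rewrite /q ltnNge leq_addr/= addKn.
have a := hd1' (n + m)%N q q q0 qn.
have {}a : N (\sum_(i < n + m) (q i.+1 - q i)%:C *: U (q i) - J') < d / 2.
  apply: a => i _; have [? h1] := qP i; split => //.
  by apply: lt_le_trans h1 _; rewrite ge_min lexx orbT.
have b := hd1 n s s s0 sn.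
have {}b : N (\sum_(i < n) (s i.+1 - s i)%:C *: U (s i) - J) < d / 2.
  apply: b => i _; have [? h1] := sP i; split => //.
  by apply: lt_le_trans h1 _; rewrite ge_min lexx.
rewrite big_split_ord/= in a.
have E1 : \sum_(i < n) (q (lshift m i).+1 - q (lshift m i))%:C *: U (q (lshift m i)) =
    \sum_(i < n) (s i.+1 - s i)%:C *: U (s i).
  apply: eq_bigr => i _; rewrite /= /q ltn_ord.
  have [h'|h'] := ltnP i.+1 n => //.
  have -> : i.+1 = n by apply/eqP; rewrite eqn_leq h' ltn_ord.
  by rewrite subnn r0 sn.
have E2 : \sum_(i < m) (q (rshift n i).+1 - q (rshift n i))%:C *: U (q (rshift n i)) =
    \sum_(i < m) (r i.+1 - r i)%:C *: U (r i).
  apply: eq_bigr => i _; rewrite /= /q (ltnNge (n + i)) (ltnNge (n + i).+1).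
  by rewrite (leqW (leq_addr i n)) leq_addr/= addKn -addnS addKn.
rewrite E1 E2 in a.
have c : N (\sum_(i < m) (r i.+1 - r i)%:C *: U (r i) - h%:C *: w) <= e * h.
  have -> : h%:C *: w = \sum_(i < m) (r i.+1 - r i)%:C *: w.
    rewrite -scaler_suml -rmorph_sum sum_increments rm r0.
    by rewrite addrC addKr.
  rewrite -sumrB; have := @nsum_le
    (fun i => (r i.+1 - r i)%:C *: U (r i) - (r i.+1 - r i)%:C *: w) r e m.
  rewrite rm r0 [t + h]addrC addrK; apply => i im.
  rewrite -scalerBr (nZr NP); have [ri _] := rP i.
  rewrite ger0_norm ?subr_ge0// mulrC ler_wpM2r ?subr_ge0//.
  by apply: Uw; [rewrite -r0 rmono|rewrite -rm rmono// ltnW].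
move: a b c; set X := \sum_(i < n) _; set Y := \sum_(i < m) _ => a b c.
have -> : J' - J - h%:C *: w = (X - J) - (X + Y - J') + (Y - h%:C *: w).
  by rewrite subrACA (opprD X Y) (addrA X) subrr sub0r (opprB J J') (addrC (- Y)) subrKA.
have := nD NP ((X - J) - (X + Y - J')) (Y - h%:C *: w).
have := nB NP (X - J) (X + Y - J'); lra.
Qed.

Section Contraction.
Variable T : R -> V -> V.
Hypothesis Tsg : contraction_semigroup N D A T.

Lemma csg_contr t x : 0 <= t -> N (T t x) <= N x.
Proof. by move=> t0; case: Tsg => /(_ t t0)[_ +] _ _ _ _; apply. Qed.

Lemma csg_dist t x y : 0 <= t -> N (T t x - T t y) <= N (x - y).
Proof.
by move=> t0; have [/(_ t t0) cT _ _ _ _] := Tsg; exact: (contractive_dist x y cT).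
Qed.

Lemma csg_A t x : 0 <= t -> D x -> D (T t x) /\ A (T t x) = T t (A x).
Proof. by case: Tsg => _ _ _ _ [_ +]; apply. Qed.

(** Factoring out the contraction [T s] makes the estimate uniform in [s]. The free tag [x] covers
    the right quotient ([x = s]), the left one ([x = s']) and tagged Riemann sums at once. *)
Lemma csg_uniform_derivative y e : D y -> 0 < e -> exists2 d, 0 < d &
  forall s x s', 0 <= s -> s <= x -> x <= s' -> s' - s < d ->
    N (T s' y - T s y - (s' - s)%:C *: T x (A y)) <= e * (s' - s).
Proof.
move=> Dy e0; case: Tsg => Tc _ TD Tcont [Tder _].
have e2 : 0 < e / 2 by lra.
have [d d0 hd] := Tder y _ Dy e2; have [d' d'0 hd'] := Tcont (A y) _ e2.
exists (Num.min d d') => [|s x s' s0 sx xs]; rewrite lt_min ?d0// => /andP[h1 h2].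
pose r := s' - s; pose p := x - s.
have p0 : 0 <= p by rewrite subr_ge0.
have pr : p <= r by rewrite lerB.
have r0 : 0 <= r := le_trans p0 pr.
have -> : T s' y - T s y - (s' - s)%:C *: T x (A y) =
    T s (T r y - y - r%:C *: T p (A y)).
  rewrite !(contractiveB _ _ (Tc s s0)) (contractiveZ _ _ (Tc s s0)) -!TD//.
  by rewrite ![s + _]addrC !subrK.
apply: le_trans (csg_contr _ s0) _.
have -> : T r y - y - r%:C *: T p (A y) =
    (T r y - y - r%:C *: A y) - r%:C *: (T p (A y) - A y).
  by rewrite scalerBr opprB [RHS]addrA subrK.
have := nB NP (T r y - y - r%:C *: A y) (r%:C *: (T p (A y) - A y)).
rewrite (nZr NP) ger0_norm//.
have := hd r r0 h1; have := hd' p p0 (le_lt_trans pr h2) => a.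
have := ler_wpM2l r0 (ltW a); rewrite -/r; lra.
Qed.

Lemma csg_continuous x : continuous_Rp N (fun t => T t x).
Proof.
apply/continuous_RpP => t t0 e e0; case: Tsg => Tc _ TD Tcont _.
have [d d0 hd] := Tcont x e e0; exists d => // s st s0.
have H u v : 0 <= u -> u <= v -> v - u < d -> N (T v x - T u x) < e.
  move=> u0 uv vu; have vu0 : 0 <= v - u by rewrite subr_ge0.
  have -> : T v x = T u (T (v - u) x) by rewrite -TD// addrC subrK.
  by apply: le_lt_trans (csg_dist _ _ u0) _; exact: hd.
have [ts|ts] := leP t s.
  by apply: H => //; rewrite ger0_norm ?subr_ge0// in st.
rewrite (ndistC NP); apply: H => //; first exact: ltW.
by rewrite ltr0_norm ?subr_lt0// opprB in st.
Qed.

Lemma csg_derivative t x : 0 <= t -> D x ->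
  derivative_Rp N (fun s => T s x) t (T t (A x)).
Proof.
move=> t0 Dx; apply/derivative_RpP => e e0.
have [|d d0 hd] := csg_uniform_derivative Dx (e := e / 2); first lra.
exists d => // h hd1 h0 th.
apply: (@le_lt_trans _ _ (e / 2 * `|h|)); last first.
  by rewrite ltr_pM2r ?normr_gt0//; lra.
have [hp|hn] := leP 0 h.
  have := hd t t (t + h) t0 (lexx _); rewrite lerDl [t + h - t]addrC addKr.
  by rewrite ger0_norm// in hd1 *; apply.
have E : t - (t + h) = - h by rewrite opprD addNKr.
have := hd (t + h) t t th; rewrite E gerDl (lexx t) => /(_ (ltW hn) isT).
rewrite ltr0_norm// in hd1 *; move=> /(_ hd1).
by rewrite rmorphN scaleNr opprK -(nN NP) opprD opprB.
Qed.

Lemma csg_strong_solution x : D x -> strong_solution N D A x (fun t => T t x).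
Proof.
move=> Dx; split; first by case: Tsg.
- split; first by move=> t t0; have [] := csg_A t0 Dx.
  move=> t t0; have NA0 y : 0 <= graph_norm N A y by rewrite addr_ge0.
  apply/cvg0_withinP => // e e0.
  have [|d d0 hd] := (continuous_RpP _).1 (csg_continuous x) t t0 (e / 2); first lra.
  have [|d' d'0 hd'] := (continuous_RpP _).1 (csg_continuous (A x)) t t0 (e / 2); first lra.
  exists (Num.min d d') => [|s]; rewrite lt_min ?d0// => /andP[sd sd'] s0.
  have [Ds As] := csg_A s0 Dx; have [Dt At] := csg_A t0 Dx.
  rewrite /graph_norm (A_B D0 Alin)// As At.
  have := hd s sd s0; have := hd' s sd' s0; lra.
- exists (fun t => T t (A x)); split; last exact: csg_continuous.
  by move=> t t0; exact: csg_derivative.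
- by move=> t t0; have [_ ->] := csg_A t0 Dx; exact: csg_derivative.
Qed.

(** With [A y = x], the function [T s x] is the derivative of [T s y], so its integral is
    [T t y - y]; this lies in [D] and [A] maps it to [T t x - x]. *)
Lemma csg_weak_solution x : weak_solution N D A x (fun t => T t x).
Proof.
split; first exact: csg_continuous.
move=> t t0; have [y Dy yx] := Asurj x.
have [Dt At] := csg_A t0 Dy.
exists (T t y - y); split.
- move=> e e0; have p : 0 < 1 + t by lra.
  have [|d d0 hd] := csg_uniform_derivative Dy (e := e / (1 + t)).
    by rewrite divr_gt0.
  exists d => // n s xi s0 sn sP.
  have smono i : (i <= n)%N -> 0 <= s i.
    elim: i => [_|i IH hi]; first by rewrite s0.
    have [a b _] := sP i hi; apply: le_trans (IH (ltnW hi)) _; exact: le_trans a b.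
  have -> : T t y - y = \sum_(i < n) (T (s i.+1) y - T (s i) y).
    by rewrite (sum_increments (fun i => T (s i) y)) sn s0; case: Tsg => _ ->.
  rewrite -sumrB; have := @nsum_le
    (fun i => (s i.+1 - s i)%:C *: T (xi i) x - (T (s i.+1) y - T (s i) y)) s (e / (1 + t)) n.
  rewrite sn s0 subr0 => H.
  apply: le_lt_trans (H _) _.
    move=> i hi; rewrite (ndistC NP) -yx; have [a b c] := sP i hi.
    by apply: hd => //; apply: smono; exact: ltnW.
  rewrite mulrAC ltr_pdivrMr//; nra.
- exact: (D_B Alin).
- by rewrite (A_B D0 Alin)// At yx addrC subrK.
Qed.

End Contraction.

Lemma weak_solution_uniq x U U' : weak_solution N D A x U ->
  weak_solution N D A x U' -> forall t, 0 <= t -> U t = U' t.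
Proof.
move=> wU wU'.
have ex W : weak_solution N D A x W -> exists J : R -> V, forall t, 0 <= t ->
    [/\ is_integral N W t (J t), D (J t) & W t = x + A (J t)].
  move=> [_ h]; have exJ t : exists J, 0 <= t ->
      [/\ is_integral N W t J, D J & W t = x + A J].
    have [t0|t0] := leP 0 t; last by exists 0.
    by have [J JP] := h t t0; exists J.
  by have [J JP] := choice exJ; exists J.
have left_sol W J : weak_solution N D A x W -> (forall t, 0 <= t ->
    [/\ is_integral N W t (J t), D (J t) & W t = x + A (J t)]) ->
  forall t, 0 <= t -> forall e, 0 < e -> exists2 d, 0 < d &
    forall h, 0 <= h -> h < d -> N (J (t + h) - J t) < e /\
    (h <= t -> N (J t - J (t - h) - h%:C *: W t) <= e * h).
  move=> [/continuous_RpP Wc _] JP t t0 e e0.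
  have [d d0 hd] := Wc t t0 e e0.
  have p : 0 < 2 * (1 + e + N (W t)) by have := Nge0 (W t); lra.
  exists (Num.min d (e / (2 * (1 + e + N (W t))))) => [|h h0].
    by rewrite lt_min d0 divr_gt0.
  rewrite lt_min => /andP[hd1]; rewrite ltr_pdivlMr// => hd2; split.
    have th : 0 <= t + h by rewrite addr_ge0.
    have [i1 _ _] := JP t t0; have [i2 _ _] := JP _ th.
    have H : N (J (t + h) - J t - h%:C *: W t) <= e * h.
      apply: (is_integral_increment t0 h0 i1 i2) => y ty yh.
      apply/ltW/hd; last exact: le_trans t0 ty.
      by rewrite ger0_norm ?subr_ge0// ltrBlDl; apply: le_lt_trans yh _; rewrite ltrD2l.
    have := nD NP (J (t + h) - J t - h%:C *: W t) (h%:C *: W t).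
    by rewrite subrK (nZr NP) ger0_norm//; have := Nge0 (W t); nra.
  move=> ht; have th : 0 <= t - h by rewrite subr_ge0.
  have [i1 _ _] := JP _ th; have [i2 _ _] := JP _ t0.
  have := @is_integral_increment W (t - h) h _ _ (W t) e th h0 i1.
  rewrite subrK; apply => // y ty yh.
  apply/ltW/hd; last exact: le_trans th ty.
  by rewrite ler0_norm ?subr_le0// opprB ltrBlDl -ltrBlDr; apply: lt_le_trans ty; rewrite ltrD2l ltrN2.
have [J JP] := ex U wU; have [J' JP'] := ex U' wU'.
(* The empty partition of [0, 0] is admissible and has Riemann sum 0. *)
have J0 W K : (forall t, 0 <= t ->
    [/\ is_integral N W t (K t), D (K t) & W t = x + A (K t)]) -> K 0 = 0.
  move=> /(_ 0 (lexx _))[iK _ _]; apply: (n_eq0_le NP) => e /iK[d d0 hd].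
  have : N (\sum_(i < 0) ((0 : R) - 0)%:C *: W 0 - K 0) < e.
    exact: (hd 0%N (fun _ => 0) (fun _ => 0)).
  by rewrite big_ord0 sub0r (nN NP) => /ltW.
have ls : left_solution N D A (fun t => J t - J' t).
  split.
  - move=> t t0; have [_ ? _] := JP t t0; have [_ ? _] := JP' t t0.
    exact: (D_B Alin).
  - move=> t t0 e e0; have e2 : 0 < e / 2 by lra.
    have [d d0 hd] := left_sol _ _ wU JP t t0 _ e2.
    have [d' d'0 hd'] := left_sol _ _ wU' JP' t t0 _ e2.
    exists (Num.min d d') => [|h h0]; rewrite lt_min ?d0// => /andP[h1 h2].
    have [a _] := hd h h0 h1; have [b _] := hd' h h0 h2.
    by rewrite subrACA; have := nB NP (J (t + h) - J t) (J' (t + h) - J' t); lra.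
  - move=> t t0 e e0; have e2 : 0 < e / 2 by lra.
    have [d d0 hd] := left_sol _ _ wU JP t (ltW t0) _ e2.
    have [d' d'0 hd'] := left_sol _ _ wU' JP' t (ltW t0) _ e2.
    exists (Num.min d d') => [|h h0]; rewrite lt_min ?d0// => /andP[h1 h2] ht.
    have [_ /(_ ht) a] := hd h (ltW h0) h1; have [_ /(_ ht) b] := hd' h (ltW h0) h2.
    have [_ DJ UE] := JP t (ltW t0); have [_ DJ' UE'] := JP' t (ltW t0).
    rewrite (A_B D0 Alin)//.
    have -> : A (J t) - A (J' t) = U t - U' t.
      by rewrite UE UE' opprD addrACA subrr add0r.
    rewrite scalerBr (subrACA (J t)) [X in N X]subrACA.
    have := nB NP (J t - J (t - h) - h%:C *: U t) (J' t - J' (t - h) - h%:C *: U' t).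
    lra.
move=> t t0; have := left_solution_eq0 NP Adis ls _ t0.
rewrite (J0 _ _ JP) (J0 _ _ JP') subrr => /(_ erefl)/eqP.
rewrite subr_eq0 => /eqP JJ; have [_ _ ->] := JP t t0; have [_ _ ->] := JP' t t0.
by rewrite JJ.
Qed.

Lemma strong_left_solution x U : strong_solution N D A x U -> left_solution N D A U.
Proof.
move=> [U0 [UD Uc] _ Ud]; split => //.
- move=> t t0 e e0.
  have NA0 y : 0 <= graph_norm N A y by rewrite addr_ge0.
  have [d d0 hd] := (cvg0_withinP _ _ (fun s => NA0 (U s - U t))).1 (Uc t t0) e e0.
  exists d => // h h0 hh; have := hd (t + h).
  rewrite [t + h - t]addrC addKr ger0_norm// => /(_ hh (addr_ge0 t0 h0)).
  by apply: le_lt_trans; rewrite lerDl.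
- move=> t t0 e e0; have [d d0 hd] := (derivative_RpP _ _ _).1 (Ud t (ltW t0)) e e0.
  exists d => // h h0 hh ht; have := hd (- h).
  rewrite normrN gtr0_norm// oppr_eq0 gt_eqF// subr_ge0 => /(_ hh isT ht)/ltW.
  rewrite -(nN NP) rmorphN scaleNr opprK; congr (N _ <= _).
  by rewrite opprD opprB.
Qed.

Theorem semigroup_wellposed :
  (exists T : R -> V -> V, generated_by N D A T) /\
  forall T : R -> V -> V, generated_by N D A T ->
    (forall U0 : V, weak_solution N D A U0 (fun t => T t U0) /\
       forall U, weak_solution N D A U0 U -> forall t, 0 <= t -> U t = T t U0) /\
    (forall U0 : V, D U0 -> strong_solution N D A U0 (fun t => T t U0) /\
       forall U, strong_solution N D A U0 U -> forall t, 0 <= t -> U t = T t U0).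
Proof.
split.
  exists (exp_semigroup N D A).
  by apply: contraction_semigroup_generated => //; exact: exp_contraction_semigroup.
move=> T Tg; have csg := generated_contraction NP complN D0 Alin Adis Arange Adense Tg.
split=> U0.
  split; first exact: csg_weak_solution.
  by move=> U wU t t0; exact: (weak_solution_uniq wU (csg_weak_solution csg U0) t0).
move=> DU0; have sT := csg_strong_solution csg DU0; split => // U sU t t0.
apply/eqP; rewrite -subr_eq0; apply/eqP.
apply: (left_solution_eq0 NP Adis (W := fun s => U s - T s U0)) t0 => //.
  by apply: (left_solutionB NP D0 Alin (W := U) (W' := fun s => T s U0));
    [exact: strong_left_solution sU|exact: strong_left_solution sT].
have [-> _ _ _] := sU; have [_ T0 _ _ _] := csg; rewrite T0; exact: subrr.
Qed.

End Solutions.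

(** * Completeness of [L^2] *)

Section L2Hilbert.
Variables (R : realType) (L : R).
Local Notation C := R[i].
Local Notation Re := (@complex.Re R).
Local Notation Im := (@complex.Im R).
Local Notation mu := (@lebesgue_measure R).
Local Notation I := (`]0, L[%classic : set (measurableTypeR R)).
Local Notation sq := (@sqint R L).
Local Notation L2 := (L2 L).
Local Notation cint := (@cint R L).

Let mI : measurable I. Proof. exact: measurable_itv. Qed.

Definition cmeasurable (f : R -> C) : Prop :=
  measurable_fun I (Re \o f) /\ measurable_fun I (Im \o f).

Lemma sqint_cmeasurable f : f \in sq -> cmeasurable f.
Proof. by move=> /sqintP[]. Qed.

Lemma L2_cmeasurable (f : L2) : cmeasurable f.
Proof. exact/sqint_cmeasurable/L2_sqint. Qed.

Lemma cmeasurableB f g : cmeasurable f -> cmeasurable g ->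
  cmeasurable (fun x => f x - g x).
Proof.
move=> [fr fi] [gr gi]; split.
  rewrite (_ : _ \o _ = (fun x => (Re \o f) x - (Re \o g) x)).
    exact: measurable_funB.
  by apply/funext => x /=; case: (f x) (g x) => a b [].
rewrite (_ : _ \o _ = (fun x => (Im \o f) x - (Im \o g) x)).
  exact: measurable_funB.
by apply/funext => x /=; case: (f x) (g x) => a b [].
Qed.

Lemma cmeasurable_normcsq f : cmeasurable f ->
  measurable_fun I (fun x => (normc (f x) ^+ 2)%:E).
Proof. by move=> [fr fi]; apply/measurable_EFinP; exact: measurable_normcsq. Qed.

Lemma normcJ (z : C) : normc z^* = normc z.
Proof. by case: z => a b /=; rewrite sqrrN. Qed.

Lemma conj_sqint f : f \in sq -> (fun x => (f x)^*) \in sq.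
Proof.
move=> /sqintP[fr fi ff]; apply/sqintP; split.
- by rewrite (_ : _ \o _ = Re \o f)//; apply/funext => x /=; case: (f x).
- rewrite (_ : _ \o _ = (fun x => - (Im \o f) x)); first exact: measurableT_comp.
  by apply/funext => x /=; case: (f x).
- by apply: eq_integrable ff => // x _; rewrite normcJ.
Qed.

Lemma L2_eq0 (f : L2) : (f : R -> C) = 0 %[ae mu in I] -> f = 0.
Proof.
move=> f0; rewrite -[f]reprK; apply/eqP.
have : repr f - 0 \in @aenull R L by rewrite subr0; apply/asboolP.
rewrite Quotient.idealrBE => /eqP ->.
by apply/eqP; exact: (raddf0 (\pi_L2)).
Qed.

Lemma ae_normL2 (w : L2) f : cmeasurable f -> (w : R -> C) = f %[ae mu in I] ->
  (\int[mu]_(x in I) (normc (f x) ^+ 2)%:E = (normL2 w ^+ 2)%:E)%E.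
Proof.
move=> mf wf; rewrite normL2E sqr_sqrtr; last first.
  by apply: Rintegral_ge0 => x _; exact: sqr_ge0.
have /sqintP[_ _ iw] := L2_sqint w.
rewrite /Rintegral fineK; last exact: integrable_fin_num iw.
apply: ae_eq_integral => //; try exact: cmeasurable_normcsq.
  exact: (cmeasurable_normcsq (L2_cmeasurable w)).
by apply: filterS wf => x /[apply] ->.
Qed.

Lemma L2_subE (f g : L2) : ((f - g : L2) : R -> C) = (fun x => f x - g x) %[ae mu in I].
Proof.
have := L2_funZD_ae (-1) g f; rewrite scaleN1r addrC.
by apply: filterS => x /[apply] ->; rewrite mulN1r addrC.
Qed.

Lemma normL2_sub (f g : L2) :
  (\int[mu]_(x in I) (normc (f x - g x) ^+ 2)%:E = (normL2 (f - g) ^+ 2)%:E)%E.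
Proof.
by apply: ae_normL2 (L2_subE f g); exact: (cmeasurableB (L2_cmeasurable _) (L2_cmeasurable _)).
Qed.

Lemma toL2_ae f : f \in sq -> (toL2 L f : R -> C) = f %[ae mu in I].
Proof.
move=> fs; have := repr_pi_ae (insubd (0 : sqfun L) f).
by rewrite /toL2 insubdK.
Qed.

Lemma Re_mulJ (z : C) : Re (z * z^*) = normc z ^+ 2.
Proof. by rewrite normcsqE ReZ; case: z => a b /=; rewrite mulrN opprK !expr2. Qed.

Lemma normL2_eq0 (f : L2) : normL2 f = 0 -> f = 0.
Proof.
move=> n0; apply: L2_eq0; have mf := cmeasurable_normcsq (L2_cmeasurable f).
have := ae_normL2 (w := f) (L2_cmeasurable f) (ae_eq_refl _ _ _).
rewrite n0 expr0n/= => H.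
have /(ae_eq_integral_abs mu mI mf) :
    (\int[mu]_(x in I) `|(normc (f x) ^+ 2)%:E| = 0)%E.
  rewrite -[RHS]H; apply: eq_integral => x _.
  by rewrite gee0_abs// lee_fin sqr_ge0.
apply: filterS => x /[apply] -[] /eqP.
by rewrite sqrf_eq0 => /eqP/eq0_normc.
Qed.

Lemma ipL2_inner : inner_product (@ipL2 R L).
Proof.
split.
- by move=> k f g h; apply: cint_L2ZD; exact/conj_sqint/L2_sqint.
- move=> f g; have fg := integrable_ImM (L2_sqint f) (conj_sqint (L2_sqint g)).
  apply: complex_eq; rewrite /ipL2 /=.
    by apply: eq_Rintegral => x _; case: (L2_fun f x) (L2_fun g x) => a b [] c d /=; ring.
  rewrite -mulN1r -RintegralZl//; apply: eq_Rintegral => x _.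
  by case: (L2_fun f x) (L2_fun g x) => a b [] c d /=; ring.
- move=> f; rewrite /ipL2 /=; apply: Rintegral_ge0 => x _.
  by rewrite Re_mulJ sqr_ge0.
- move=> f f0; apply: normL2_eq0; by rewrite /normL2 f0 sqrtr0.
Qed.

Lemma normL2_axioms : norm_axioms (@normL2 R L).
Proof. exact: ipnorm_axioms ipL2_inner. Qed.

(* The function [\sum_k 4 ^ k * `|v_(k+1) - v_k| ^ 2] is integrable, hence finite
   almost everywhere. *)
Lemma ae_geometric (v : nat -> L2) :
  (forall k, normL2 (v k.+1 - v k) <= (4 ^+ k)^-1) ->
  \forall x \ae mu, I x -> exists B : R, forall k,
    normc (v k.+1 x - v k x) <= B / 2 ^+ k.
Proof.
move=> vk; pose t k x : \bar R := (4 ^+ k * normc (v k.+1 x - v k x) ^+ 2)%:E.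
have t0 k x : (0 <= t k x)%E by rewrite /t lee_fin mulr_ge0 ?exprn_ge0 ?normc_ge0.
have mt k : measurable_fun I (t k).
  have /measurable_EFinP mn := cmeasurable_normcsq
    (cmeasurableB (L2_cmeasurable (v k.+1)) (L2_cmeasurable (v k))).
  by apply/measurable_EFinP; apply: measurable_funM.
(* The integral is at most [4^k * (4^-k)^2 = 4^-k <= 2^-k], written in the form that
   [epsilon_trick0] sums to 2. *)
have it k : (\int[mu]_(x in I) t k x <= (2 / (2 ^ k.+1)%:R)%:E)%E.
  rewrite /t; under eq_integral do rewrite EFinM.
  have mn := cmeasurable_normcsq
    (cmeasurableB (L2_cmeasurable (v k.+1)) (L2_cmeasurable (v k))).
  have n0 x : I x -> (0 <= (normc (v k.+1 x - v k x) ^+ 2)%:E)%E.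
    by rewrite lee_fin sqr_ge0.
  rewrite (ge0_integralZl_EFin mu mI n0 mn) ?exprn_ge0//.
  rewrite normL2_sub -EFinM lee_fin.
  have -> : 2 / (2 ^ k.+1)%:R = 4 ^+ k * ((4 ^+ k)^-1 * (2 ^+ k)^-1) :> R.
    rewrite mulrA divff ?expf_neq0// mul1r natrX exprS invfM mulrA divff//.
    by rewrite mul1r.
  rewrite ler_wpM2l ?exprn_ge0//.
  apply: (@le_trans _ _ ((4 ^+ k)^-1 ^+ 2)).
    by rewrite ler_sqr ?nnegrE ?invr_ge0 ?exprn_ge0 ?sqrtr_ge0.
  rewrite expr2 ler_wpM2l ?invr_ge0 ?exprn_ge0// lef_pV2 ?posrE ?exprn_gt0//.
  by rewrite lerXn2r ?nnegrE//; lra.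
pose F x := (\sum_(0 <= k <oo) t k x)%E.
have mF : measurable_fun I F.
  have := @ge0_emeasurable_sum _ _ R I t predT (fun k x _ _ => t0 k x) (fun k _ => mt k).
  by apply: eq_measurable_fun => x _; rewrite /F; apply: eq_eseriesl.
have F0 x : (0 <= F x)%E by apply: nneseries_ge0.
have iF : mu.-integrable I F.
  apply/integrableP; split => //.
  under eq_integral do rewrite gee0_abs//.
  rewrite integral_nneseries//.
  apply: (@le_lt_trans _ _ 2%:E); last exact: ltry.
  apply: le_trans (@epsilon_trick0 R 2 predT _) => //.
  by apply: lee_nneseries => [k _ _|k _]; [apply: integral_ge0 => x _|exact: it].
have := integrable_ae mI iF; apply: filterS => x /[apply] Fx.
(* Each term of the series is at most its sum, and the square root of [4 ^+ k] is [2 ^+ k]. *)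
exists (Num.sqrt (fine (F x))) => k.
have : (t k x <= F x)%E.
  have := @nneseries_lim_ge R (fun k => t k x) predT 0%N k.+1 (fun n _ _ => t0 n x).
  apply: le_trans; rewrite big_nat_recr//= leeDr//.
  by apply: sume_ge0 => i _.
rewrite -(fineK Fx) lee_fin => h.
rewrite ler_pdivlMr ?exprn_gt0// -[leLHS]ger0_norm; last first.
  by rewrite mulr_ge0 ?normc_ge0 ?exprn_ge0.
rewrite -sqrtr_sqr ler_wsqrtr//.
by rewrite exprMn -exprM mulnC exprM mulrC (_ : 2 ^+ 2 = 4)//; ring.
Qed.

Lemma geometric_cvg (w : nat -> R) (B : R) :
  (forall k, `|w k.+1 - w k| <= B / 2 ^+ k) -> cvgn w.
Proof.
move=> hw; have /cvg_ex[l hl] : cvgn (series (telescope w)).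
  apply: normed_cvg; apply: (@series_le_cvg _ _ (geometric B 2^-1)) => //=.
  - by move=> n; rewrite exprVn; apply: le_trans (hw n).
  - by move=> n; rewrite exprVn; exact: hw.
  - by apply: is_cvg_geometric_series; rewrite ger0_norm ?invr_ge0//; lra.
apply/cvg_ex; exists (l + w 0%N).
have wE : w = (fun n => series (telescope w) n + w 0%N).
  by apply/funext => n; rewrite telescopeK/= subrK.
by rewrite {1}wE; exact: (cvgD hl (cvg_cst _)).
Qed.

Lemma measurable_limn_einf (w : nat -> R -> \bar R) :
  (forall k, measurable_fun I (w k)) -> measurable_fun I (fun x => limn_einf (w^~ x)).
Proof.
move=> mw; rewrite (_ : (fun x => _) = (fun x => (- limn_esup (fun k => - w k x))%E)).
  apply: measurableT_comp => //; apply: measurable_fun_limn_esup => k.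
  exact: measurableT_comp.
apply/funext => x; rewrite -limn_einfN; congr limn_einf.
by apply/funext => k /=; rewrite oppeK.
Qed.

(** Upper limits are measurable whether or not the sequence converges; where both parts converge,
    this is the pointwise limit. *)
Definition climit (v : nat -> R -> C) : R -> C := fun x =>
  fine (limn_esup (fun k => (Re (v k x))%:E)) +i*
  fine (limn_esup (fun k => (Im (v k x))%:E)).

Lemma climit_measurable v : (forall k, cmeasurable (v k)) -> cmeasurable (climit v).
Proof.
move=> mv.
have M (g : nat -> R -> R) : (forall k, measurable_fun I (g k)) ->
    measurable_fun I (fun x => fine (limn_esup (fun k => (g k x)%:E))).
  move=> mg; have mg' k : measurable_fun I (fun x => (g k x)%:E).
    exact/measurable_EFinP.
  have := measurable_fun_limn_esup mg'.
  exact: measurableT_comp.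
split; apply: M => k; have [] := mv k; exact.
Qed.

Lemma climit_cvg v x : cvgn (fun k => Re (v k x)) -> cvgn (fun k => Im (v k x)) ->
  (Re (v k x) @[k --> \oo] --> Re (climit v x)) /\
  (Im (v k x) @[k --> \oo] --> Im (climit v x)).
Proof.
have H (w : nat -> R) l : w k @[k --> \oo] --> l ->
    fine (limn_esup (fun k => (w k)%:E)) = l.
  move=> wl; have /cvg_limn_einf_sup[_ ->//] : (w k)%:E @[k --> \oo] --> l%:E.
  by apply: cvg_EFin => //; exact: nearW.
by move=> /cvg_ex[l hl] /cvg_ex[l' hl']; rewrite /climit/= (H _ _ hl) (H _ _ hl').
Qed.

(** A subsequence with increments below [4^-k] converges almost everywhere by [ae_geometric], and
    Fatou's lemma turns the Cauchy bounds into distances to the pointwise limit. *)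
Lemma L2_complete : ncomplete (@normL2 R L).
Proof.
move=> u cu; have NP := normL2_axioms.
have ex k : exists n, forall i j, (n <= i)%N -> (n <= j)%N ->
    normL2 (u i - u j) < (4 ^+ k)^-1.
  by apply: cu; rewrite invr_gt0 exprn_gt0.
have [p pP] := choice ex.
(* A running maximum of the thresholds, so that [m i] passes every [p k] with [k <= i]. *)
pose m k := \max_(j < k.+1) p j.
have pm k j : (k <= j)%N -> (p k <= m j)%N.
  move=> kj; have kj1 : (k < j.+1)%N by [].
  exact: (@leq_bigmax_cond _ predT (fun i : 'I_j.+1 => p i) (Ordinal kj1)).
pose v k : L2 := u (m k).
have vd k i j : (k <= i)%N -> (k <= j)%N -> normL2 (v i - v j) < (4 ^+ k)^-1.
  by move=> ki kj; apply: pP; exact: pm.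
pose h := climit (fun k => v k : R -> C).
have mh : cmeasurable h by apply: climit_measurable => k; exact: L2_cmeasurable.
have vh : \forall x \ae mu, I x -> forall j,
    (normc (v (k + j)%N x - v j x) ^+ 2 @[k --> \oo] --> normc (h x - v j x) ^+ 2).
  have := ae_geometric (fun k => ltW (vd k _ _ (leqnSn k) (leqnn k))).
  apply: filterS => x /[apply] -[B hB] j.
  have [||hr hi] := @climit_cvg (fun k => v k : R -> C) x.
  - apply: (geometric_cvg (B := B)) => k; apply: le_trans (hB k).
    by rewrite (_ : _ - _ = Re (v k.+1 x - v k x)) ?Re_le_normc//;
      case: (L2_fun (v k.+1) x) (L2_fun (v k) x) => a b [].
  - apply: (geometric_cvg (B := B)) => k; apply: le_trans (hB k).
    by rewrite (_ : _ - _ = Im (v k.+1 x - v k x)) ?Im_le_normc//;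
      case: (L2_fun (v k.+1) x) (L2_fun (v k) x) => a b [].
  have E z w : normc (z - w) ^+ 2 = (Re z - Re w) ^+ 2 + (Im z - Im w) ^+ 2.
    by rewrite normcsqE; case: z w => a b [].
  rewrite E; under eq_fun do rewrite E.
  rewrite -(cvg_shiftn j) in hr; rewrite -(cvg_shiftn j) in hi.
  by apply: cvgD; rewrite !expr2; apply: cvgM; apply: cvgB => //; exact: cvg_cst.
have hbound j : (\int[mu]_(x in I) (normc (h x - v j x) ^+ 2)%:E <=
    ((4 ^+ j)^-1 ^+ 2)%:E)%E.
  have mk k : measurable_fun I (fun x => (normc (v (k + j)%N x - v j x) ^+ 2)%:E).
    by apply: cmeasurable_normcsq; exact: (cmeasurableB (L2_cmeasurable _) (L2_cmeasurable _)).
  have mhj : measurable_fun I (fun x => (normc (h x - v j x) ^+ 2)%:E).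
    by apply: cmeasurable_normcsq; apply: cmeasurableB => //; exact: L2_cmeasurable.
  pose w k x := (normc (v (k + j)%N x - v j x) ^+ 2)%:E.
  have w0 k x : I x -> (0 <= w k x)%E by move=> _; rewrite lee_fin sqr_ge0.
  have -> : (\int[mu]_(x in I) (normc (h x - v j x) ^+ 2)%:E =
      \int[mu]_(x in I) limn_einf (w^~ x))%E.
    apply: ae_eq_integral => //; first exact: measurable_limn_einf.
    apply: filterS vh => x /[apply] /(_ j) hx.
    have /cvg_limn_einf_sup[-> _//] : w k x @[k --> \oo] -->
      (normc (h x - v j x) ^+ 2)%:E.
    by apply: cvg_EFin => //; exact: nearW.
  apply: le_trans (fatou mu mI mk w0) _.
  rewrite limn_einf_lim; apply: lime_le; first exact: is_cvg_einfs.
  apply: nearW => k; apply: (@le_trans _ _ (\int[mu]_(x in I) w k x)%E).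
    by apply: ereal_inf_lbound; exists k => /=.
  rewrite normL2_sub lee_fin ler_sqr ?nnegrE ?invr_ge0 ?exprn_ge0 ?sqrtr_ge0//.
  by apply/ltW/vd => //; exact: leq_addl.
have hs : h \in sq.
  have hv : (fun x => h x - v 0%N x) \in sq.
    have [hr hi] := cmeasurableB mh (L2_cmeasurable (v 0%N)).
    apply/sqintP; split => //; apply/integrableP; split.
      exact: (cmeasurable_normcsq (conj hr hi)).
    apply: le_lt_trans (ltry ((4 ^+ 0)^-1 ^+ 2)); apply: le_trans (hbound 0%N).
    rewrite le_eqVlt; apply/orP; left; apply/eqP; apply: eq_integral => x _.
    by rewrite gee0_abs// lee_fin sqr_ge0.
  have := rpredD hv (L2_sqint (v 0%N)).
  by rewrite (_ : _ + _ = h)//; apply/funext => x; exact: subrK.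
exists (toL2 L h).
have vl j : normL2 (toL2 L h - v j) <= (4 ^+ j)^-1.
  rewrite -ler_sqr ?nnegrE ?invr_ge0 ?exprn_ge0 ?sqrtr_ge0// -lee_fin.
  apply: le_trans (hbound j); rewrite -(ae_normL2 (f := fun x => h x - v j x)) //.
    exact: (cmeasurableB mh (L2_cmeasurable (v j))).
  apply: filterS2 (toL2_ae hs) (L2_subE (toL2 L h) (v j)) => x hx dx Ix.
  by rewrite dx// hx.
move=> e e0; have [n2 h2] : exists n2, (4 ^+ n2)^-1 < e / 2.
  have [|n2 h2] := geometric_small (1 : R) (e := e / 2); first lra.
  exists n2; apply: le_lt_trans (h2 n2 (leqnn _)).
  rewrite div1r lef_pV2 ?posrE ?exprn_gt0// lerXn2r ?nnegrE//; lra.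
exists (p n2) => n pn.
have a := pP n2 n (m n2) pn (pm n2 n2 (leqnn _)).
have := vl n2; rewrite (ndistC NP).
have := ntri NP (v n2) (u n) (toL2 L h); rewrite /v in a *; lra.
Qed.

End L2Hilbert.

(** * Smooth bump functions *)

Section SmoothBump.
Variable R : realType.
Implicit Types (p q : {poly R}) (x : R) (k : nat).

(* The family [p / q ^ k * exp (- 1 / q)] on [q > 0], extended by [0], is closed
   under differentiation. *)
Definition flat p q k x : R :=
  if 0 < q.[x] then p.[x] * (q.[x])^-1 ^+ k * expR (- (q.[x])^-1) else 0.

(** Handles [flat] at the zeros of [q], where its two branches meet. *)
Lemma is_derive0_quadratic (f : R -> R) x (M : R) :
  (\forall y \near x, `|f y - f x| <= M * (y - x) ^+ 2) -> is_derive x 1 f 0.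
Proof.
move=> fM.
have H : (h^-1 *: (f (h *: 1 + x) - f x) @[h --> 0^'] --> (0 : R)).
  apply/cvgr0Pnorm_lt => e e0.
  have [d d0 hd] : exists2 d : R, 0 < d & forall y, `|y - x| < d ->
      `|f y - f x| <= M * (y - x) ^+ 2.
    move/nbhs_ballP: fM => [d d0 hd]; exists d => // y yx; apply: hd.
    by rewrite /ball/= distrC.
  have p : 0 < 1 + `|M| by have := normr_ge0 M; lra.
  rewrite near_withinE; apply/nbhs_ballP.
  exists (Num.min d (e / (1 + `|M|))); first by rewrite /= lt_min d0 divr_gt0.
  move=> h; rewrite /ball/= sub0r normrN lt_min => /andP[hd1].
  rewrite ltr_pdivlMr// => hd2 h0.
  rewrite [_ *: 1]mulr1 normrM normfV mulrC ltr_pdivrMr ?normr_gt0//.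
  have := hd (h + x); rewrite addrK => /(_ hd1) a; apply: le_lt_trans a _.
  have hp : 0 < `|h| by rewrite normr_gt0.
  rewrite -[h ^+ 2]real_normK ?num_real//.
  have := ler_norm M; nra.
split; first by apply/cvg_ex; exists 0.
exact/cvg_lim.
Qed.

(** A single term of the exponential series suffices. With [x = 1 / q] the bound reads [O(q^2)], the
    order that [is_derive0_quadratic] asks for. *)
Lemma expRN_le x k : 0 < x -> x ^+ k * expR (- x) <= (k.+2)`!%:R / x ^+ 2.
Proof.
move=> x0; have f0 : 0 < (k.+2)`!%:R :> R by rewrite ltr0n fact_gt0.
have h := @expR_ge1Dxn R x k.+1 (ltW x0).
rewrite expRN ler_pdivrMr ?expR_gt0// mulrAC ler_pdivlMr ?exprn_gt0//.
rewrite -exprD addn2.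
have : x ^+ k.+2 / (k.+2)`!%:R <= expR x by lra.
by rewrite ler_pdivrMr// mulrC.
Qed.

(** The derivative of [p / q^k * exp (- 1 / q)] is this numerator over [q^(k+2)], times the same
    exponential. *)
Definition flat_num p q k : {poly R} :=
  p^`() * q ^+ 2 - k%:R *: (p * q^`() * q) + p * q^`().

Lemma flat_derive p q k x :
  is_derive x 1 (flat p q k) (flat (flat_num p q k) q k.+2 x).
Proof.
have [qx|qx|qx] := ltgtP 0 q.[x].
- have near_pos : \forall y \near x, 0 < q.[y].
    exact: (cvgr_gt _ (@continuous_horner R q x)).
  pose g : R -> R := horner p * ((fun y => (q.[y])^-1) ^+ k) * (expR \o (fun y => - (q.[y])^-1)).
  have gf : \forall y \near x, g y = flat p q k y.
    apply: filterS near_pos => y qy; rewrite /flat qy /g.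
    by rewrite !fctE.
  apply: near_eq_is_derive gf _.
  have dq := @is_deriveV R (horner q) x _ 1 (lt0r_neq0 qx) (is_derive_poly q x).
  have d1 := is_deriveM (is_derive_poly p x) (is_deriveX k dq).
  have dn : is_derive x 1 (fun y => - (q.[y])^-1) (- (- q.[x] ^- 2 *: q^`().[x])).
    exact: is_deriveN dq.
  have d2 := @is_derive1_comp R expR _ x _ _ (is_derive_expR (- (q.[x])^-1)) dn.
  apply: is_derive_eq (is_deriveM d1 d2) _.
  have qn0 : q.[x] != 0 by rewrite gt_eqF.
  have sc (a b : R) : a *: b = a * b by [].
  rewrite !fctE !sc /flat qx.
  have -> : (flat_num p q k).[x] =
      p^`().[x] * q.[x] ^+ 2 - k%:R * p.[x] * q^`().[x] * q.[x] + p.[x] * q^`().[x].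
    by rewrite /flat_num !(hornerD, hornerN, hornerZ, hornerM, horner_exp); ring.
  move: (expR _) => e; move: qn0; move: q.[x] p.[x] q^`().[x] p^`().[x] => y r y' r' y0.
  case: k {g d1} => [|k]; rewrite /= !exprVn ?exprS ?expr0; field => //.
  by rewrite y0 expf_neq0.
- rewrite /flat ltNge (ltW qx)/=.
  have near_neg : \forall y \near x, q.[y] < 0.
    exact: (cvgr_lt _ (@continuous_horner R q x)).
  apply: (@near_eq_is_derive _ _ _ (cst 0)).
  by apply: filterS near_neg => y qy; rewrite /flat ltNge (ltW qy).
(* At a zero [x] of [q], write [q = r * ('X - x%:P)]. Then [p * q ^+ 2] is [s] times the square of
   [y - x], with [s = p * r ^+ 2] bounded near [x]. *)
- rewrite /flat -qx ltxx.
  have [r rE] : exists r, q = r * ('X - x%:P) by apply/factor_theorem; rewrite /root -qx.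
  pose s := p * r ^+ 2.
  apply: (@is_derive0_quadratic _ _ ((k.+2)`!%:R * (`|s.[x]| + 1))).
  have near_s : \forall y \near x, `|s.[y]| < `|s.[x]| + 1.
    by have /cvgr_norm_lt := @continuous_horner R s x; apply; rewrite ltrDl.
  apply: filterS near_s => y sy; rewrite /flat -qx ltxx subr0.
  have f0 : 0 < (k.+2)`!%:R :> R by rewrite ltr0n fact_gt0.
  case: ifPn => [qy|_]; last first.
    by rewrite normr0 mulr_ge0 ?sqr_ge0// mulr_ge0 ?(ltW f0)// addr_ge0.
  have qi : 0 < (q.[y])^-1 by rewrite invr_gt0.
  rewrite -mulrA normrM [`|_ * expR _|]ger0_norm; last first.
    by rewrite mulr_ge0 ?expR_ge0// exprn_ge0// ltW.
  apply: (@le_trans _ _ (`|p.[y]| * ((k.+2)`!%:R * q.[y] ^+ 2))).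
    by rewrite ler_wpM2l//; apply: le_trans (expRN_le k qi) _; rewrite exprVn invrK.
  have -> : `|p.[y]| * ((k.+2)`!%:R * q.[y] ^+ 2) =
      (k.+2)`!%:R * (`|s.[y]| * (y - x) ^+ 2).
    rewrite /s rE !(hornerM, horner_exp, hornerXsubC) normrM.
    by rewrite [`|r.[y] ^+ 2|]ger0_norm ?sqr_ge0//; ring.
  by rewrite -mulrA ler_wpM2l ?(ltW f0)// ler_wpM2r ?sqr_ge0// ltW.
Qed.

Lemma flat_smooth p q k : smooth (flat p q k).
Proof.
have D p' k' : derive1 (flat p' q k') = flat (flat_num p' q k') q k'.+2.
  apply/funext => x; rewrite derive1E; exact: (derive_val (is_derive := flat_derive _ _ _ _)).
have E n : exists p' k', derive1n n (flat p q k) = flat p' q k'.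
  elim: n => [|n [p' [k' IH]]]; first by exists p, k.
  by exists (flat_num p' q k'), k'.+2; rewrite derive1nS IH D.
move=> n x; have [p' [k' ->]] := E n.
exact: (ex_derive (is_derive := flat_derive _ _ _ _)).
Qed.

Lemma smooth_cst (a : R) : smooth (cst a).
Proof.
have E n (b : R) : exists b', derive1n n (cst b : R -> R) = cst b'.
  elim: n => [|n [b' IH]]; first by exists b.
  by exists 0; rewrite derive1nS IH; apply/funext => x; rewrite derive1_cst.
by move=> n x; have [b ->] := E n a; exact: derivable_cst.
Qed.

(* tends to the indicator function of [`]a, b[] as [n] grows *)
Definition bump (a b : R) (n : nat) : R -> R :=
  flat 1 (n.+1%:R *: (('X - a%:P) * (b%:P - 'X))) 0.

Lemma bumpE a b n x : a < b -> bump a b n x =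
  if (a < x) && (x < b) then expR (- (n.+1%:R * ((x - a) * (b - x)))^-1) else 0.
Proof.
move=> ab; rewrite /bump /flat hornerZ hornerM hornerXsubC hornerD hornerN hornerX.
rewrite !hornerC expr0 !mul1r pmulr_rgt0//.
suff -> : (0 < (x - a) * (b - x)) = (a < x) && (x < b) by [].
apply/idP/andP => [h|[ax xb]]; last by rewrite mulr_gt0// subr_gt0.
by split; rewrite ltNge; apply/negP => ?; nra.
Qed.

Lemma bump_bounded a b n x : a < b -> 0 <= bump a b n x <= 1.
Proof.
move=> ab; rewrite bumpE//; case: ifPn => [/andP[ax xb]|_]; last by rewrite lexx ler01.
rewrite expR_ge0/= expR_le1 oppr_le0 invr_ge0 !mulr_ge0 ?ler0n// subr_ge0 ltW//.
Qed.

Lemma bump_cvg a b x : a < b ->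
  bump a b n x @[n --> \oo] --> (\1_(`]a, b[%classic) x : R).
Proof.
move=> ab; set w := (x - a) * (b - x).
have [h|h] := boolP ((a < x) && (x < b)).
  have -> : (fun n => bump a b n x) = (fun n => expR (- w^-1 * n.+1%:R^-1)).
    by apply/funext => n; rewrite bumpE// h invfM mulrC mulNr.
  have -> : (\1_(`]a, b[%classic) x : R) = expR 0.
    by rewrite indicE mem_setE in_itv/= h expR0.
  have c : - w^-1 * n.+1%:R^-1 @[n --> \oo] --> (0 : R).
    by rewrite -[X in _ --> X](mulr0 (- w^-1)); apply: cvgMr; exact: cvg_harmonic.
  by apply: continuous_cvg; [exact: continuous_expR|exact: c].
have -> : (fun n => bump a b n x) = (fun n => 0).
  by apply/funext => n; rewrite bumpE// (negbTE h).
by rewrite indicE mem_setE in_itv/= (negbTE h); exact: cvg_cst.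
Qed.

End SmoothBump.

(** * The fundamental lemma of the calculus of variations *)

Section FundamentalLemma.
Variables (R : realType) (L : R).
Local Notation mu := (@lebesgue_measure R).
Local Notation I := (`]0, L[%classic : set (measurableTypeR R)).

Let mI : measurable I. Proof. exact: measurable_itv. Qed.

Lemma bump_measurable a b n (D : set (measurableTypeR R)) : measurable_fun D (bump a b n).
Proof.
apply: measurable_funTS; apply: continuous_measurable_fun; apply: smooth_cont.
exact: flat_smooth.
Qed.

Lemma integral_itv_eq0 (u : R -> R) : mu.-integrable I (EFin \o u) ->
  (forall a b n, 0 < a -> a < b -> b < L -> \int[mu]_(x in I) (u x * bump a b n x) = 0) ->
  forall a b, 0 < a -> a < b -> b < L ->
    (\int[mu]_(x in `]a, b[%classic) (u x)%:E = 0)%E.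
Proof.
move=> iu u0 a b a0 ab bL.
have mu' : measurable_fun I u by apply/measurable_EFinP; case/integrableP: iu.
pose f_ n x := (u x * bump a b n x)%:E.
pose f x := (u x * \1_(`]a, b[%classic) x)%:E.
have key : (\int[mu]_(x in I) f_ n x)%E @[n --> \oo] --> (\int[mu]_(x in I) f x)%E.
  apply: (@dominated_cvg _ _ _ mu _ mI f_ f (fun x => `|u x|%:E)) => //.
  - by move=> n; apply/measurable_EFinP; apply: measurable_funM => //; exact: bump_measurable.
  - move=> x _; apply: cvg_EFin; first exact: nearW.
    by apply: cvgMr; exact: bump_cvg.
  - by have := integrable_abse iu; apply: eq_integrable.
  - move=> n x _; rewrite /f_ abse_EFin lee_fin normrM ler_piMr//.
    by have /andP[? ?] := bump_bounded n x ab; rewrite ger0_norm.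
have E n : (\int[mu]_(x in I) f_ n x)%E = 0%E.
  have := u0 a b n a0 ab bL; rewrite /Rintegral => h.
  rewrite -[LHS]fineK ?h//; apply: integrable_fin_num => //.
  have bd : [bounded bump a b n x | x in I].
    exists 1; split; first exact: num_real.
    move=> M M1 x _ /=; apply: le_trans (ltW M1).
    by have /andP[? ?] := bump_bounded n x ab; rewrite ger0_norm.
  have := integrableMl mI iu (@bump_measurable a b n I) bd.
  by apply: eq_integrable.
have : (\int[mu]_(x in I) f x = 0)%E.
  rewrite (_ : (fun n => _) = cst 0%E) in key; last by apply/funext => n; exact: E.
  by apply: (cvg_unique _ key); [exact: ereal_hausdorff|exact: cvg_cst].
have sub : `]a, b[%classic `<=` I.
  by move=> x /=; rewrite !in_itv/= => /andP[ax xb]; rewrite (lt_trans a0 ax) (lt_trans xb bL).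
move=> <-; rewrite -{1}(setIidr sub) integral_mkcondr.
apply: eq_integral => x _; rewrite patchE /f indicE.
by case: (x \in _); rewrite ?mulr1 ?mulr0.
Qed.

(** Dominated convergence makes the integral of [u] vanish over each subinterval, so its primitive
    is constant inside the interval; by Lebesgue differentiation the derivative of the primitive is
    [u] almost everywhere. *)
Lemma ae_eq0_of_bump (u : R -> R) : mu.-integrable I (EFin \o u) ->
  (forall a b n, 0 < a -> a < b -> b < L -> \int[mu]_(x in I) (u x * bump a b n x) = 0) ->
  \forall x \ae mu, I x -> u x = 0.
Proof.
move=> iu u0; have z := integral_itv_eq0 iu u0.
pose f := u \_ I.
have fi : mu.-integrable setT (EFin \o f).
  by rewrite -restrict_EFin; apply/(integrable_mkcond _ mI).
have fiy y : mu.-integrable `]-oo, y]%classic (EFin \o f) by exact: integrableS fi.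
have floc : locally_integrable setT f by apply: open_integrable_locally => //; exact: openT.
have := FTC1Ny fiy floc; set F := fun x : R => _; rewrite -/F.
apply: filterS; first exact: (ae_filter_ringOfSetsType mu).
move=> x [_ dF] Ix; have := Ix; rewrite /= in_itv/= => /andP[x0 xL].
have Fconst a b : 0 < a -> a < b -> b < L -> F b = F a.
  move=> a0 ab bL; apply/eqP; rewrite -subr_eq0 /F.
  rewrite (@Rintegral_itvB R f -oo%O (BRight b) a)//; last by rewrite bnd_simp ltW.
  apply/eqP; rewrite /Rintegral -integral_itv_bndo_bndc; last first.
    by apply/measurable_EFinP; apply: measurable_funTS; apply/measurable_EFinP;
      case/integrableP: fi.
  rewrite [X in fine X](_ : _ = 0%E)// -[RHS](z a b a0 ab bL).
  apply: eq_integral => y; rewrite inE/= in_itv/= => /andP[ay yb].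
  by rewrite /f patchE mem_set//= in_itv/= (lt_trans a0 ay) (lt_trans yb bL).
have : f x = u x by rewrite /f patchE mem_set.
move=> <-; rewrite -dF derive1E.
have -> : 'D_1 F x = 'D_1 (cst (F x)) x.
  apply: near_eq_derive.
  have : \forall y \near x, y \in `]0, L[ by apply: near_in_itvoo; rewrite in_itv/= x0.
  apply: filterS => y; rewrite in_itv/= => /andP[y0 yL].
  by have [xy|yx|->//] := ltgtP x y; [exact: Fconst|exact/esym/Fconst].
exact: derive_cst.
Qed.

End FundamentalLemma.

(** * Weak derivatives and [H_0^1] *)

Section Density.
Variables (R : realType) (V : lmodType R[i]).

(** Both sides are continuous in [(f, g)]. This serves to close the graph of the weak derivative and
    to extend integration by parts from test functions to H_0^1. *)
Lemma rip_density (ip : V -> V -> R[i]) (f g p p' : V) : inner_product ip ->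
  (forall e : R, 0 < e -> exists f' g' : V,
     [/\ complex.Re (ip f' p') = - complex.Re (ip g' p),
         ipnorm ip (f' - f) < e & ipnorm ip (g' - g) < e]) ->
  complex.Re (ip f p') = - complex.Re (ip g p).
Proof.
move=> ipP H; have NP := ipnorm_axioms ipP.
apply/eqP; rewrite -subr_eq0 -normr_le0.
apply/ler_addgt0Pr => e e0; rewrite add0r opprK.
have p0 := n_ge0 NP p; have p0' := n_ge0 NP p'.
have pos : 0 < 1 + ipnorm ip p + ipnorm ip p' by lra.
have [|f' [g' [wE hf hg]]] := H (e / (1 + ipnorm ip p + ipnorm ip p')).
  by rewrite divr_gt0.
have -> : complex.Re (ip f p') + complex.Re (ip g p) =
    - complex.Re (ip (f' - f) p') - complex.Re (ip (g' - g) p).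
  by rewrite !(ripBl ipP) wE; ring.
have a := cauchy_schwarz ipP (f' - f) p'.
have b := cauchy_schwarz ipP (g' - g) p.
apply: (le_trans (ler_normB _ _)); rewrite normrN.
have E : e / (1 + ipnorm ip p + ipnorm ip p') * (1 + ipnorm ip p + ipnorm ip p') = e.
  by rewrite divfK// gt_eqF.
have q0 : 0 < e / (1 + ipnorm ip p + ipnorm ip p') by rewrite divr_gt0.
have := ler_wpM2r p0' (ltW hf); have := ler_wpM2r p0 (ltW hg).
move: a b E q0; move: (e / _) (ipnorm ip (f' - f)) (ipnorm ip (g' - g)) => q x y; nra.
Qed.

Lemma norm_le_density (N : V -> R) (c : R) (f g : V) : norm_axioms N -> 0 <= c ->
  (forall e : R, 0 < e -> exists f' g' : V,
     [/\ N f' <= c * N g', N (f' - f) < e & N (g' - g) < e]) ->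
  N f <= c * N g.
Proof.
move=> NP c0 H; apply/ler_addgt0Pr => e e0.
have pos : 0 < 1 + c by lra.
have [|f' [g' [h a b]]] := H (e / (1 + c)); first by rewrite divr_gt0.
have E : e / (1 + c) * (1 + c) = e by rewrite divfK// gt_eqF.
have := nD NP (g' - g) g; have := nD NP (f - f') f'; rewrite !subrK (ndistC NP f).
move: (e / _) E a b => q E a b h1 h2; nra.
Qed.

End Density.

Section WeakDerivative.
Variables (R : realType) (L : R).
Hypothesis L0 : 0 < L.
Local Notation C := R[i].
Local Notation Re := (@complex.Re R).
Local Notation Im := (@complex.Im R).
Local Notation mu := (@lebesgue_measure R).
Local Notation I := (`]0, L[%classic : set (measurableTypeR R)).
Local Notation sq := (@sqint R L).
Local Notation L2 := (L2 L).
Local Notation cint := (@cint R L).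
Local Notation toL2 := (@toL2 R L).
Local Notation test := (@test_fun R L).
Local Notation N := (@normL2 R L).
Local Notation ip := (@ipL2 R L).
Local Notation cj := (@conjc R).

Let mI : measurable I. Proof. exact: measurable_itv. Qed.
Let ipP := @ipL2_inner R L.
Let NP := @normL2_axioms R L.

Lemma cint_ipL2 (f : L2) h : h \in sq ->
  cint (fun x => f x * h x) = ip f (toL2 (fun x => cj (h x))).
Proof.
move=> hs; have cs := conj_sqint hs; rewrite /ipL2.
have ts := conj_sqint (L2_sqint (toL2 (fun x => cj (h x)))).
apply: eq_cint_ae.
- exact: measurable_ReM (L2_sqint f) hs.
- exact: measurable_ImM (L2_sqint f) hs.
- exact: measurable_ReM (L2_sqint f) ts.
- exact: measurable_ImM (L2_sqint f) ts.
- by apply: filterS (toL2_ae cs) => x /[apply] ->; congr (_ * _); exact/esym/conjcK.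
Qed.

Lemma smoothN (f : R -> R) : smooth f -> smooth (fun x => - f x).
Proof.
move=> sf; have := @smooth_lin R (-1) 0 f f sf sf.
by rewrite scale0r addr0 (_ : -1 *: f = (fun x => - f x))//; apply/funext => x; exact: mulN1r.
Qed.

Lemma test_conj phi : test phi -> test (fun x => cj (phi x)).
Proof.
move=> [sr si [K [cK KI K0]]]; split.
- by rewrite (_ : _ \o _ = Re \o phi)//; apply/funext => x /=; case: (phi x).
- rewrite (_ : _ \o _ = (fun x => - (Im \o phi) x)); first exact: smoothN.
  by apply/funext => x /=; case: (phi x).
- by exists K; split => // x /K0 ->; rewrite conjc0.
Qed.

Lemma cderiv_conj phi : test phi ->
  cderiv (fun x => cj (phi x)) = (fun x => cj (cderiv phi x)).
Proof.
move=> [sr si _]; apply/funext => x; rewrite /cderiv.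
have -> : Re \o (fun x => cj (phi x)) = Re \o phi.
  by apply/funext => y /=; case: (phi y).
have -> : Im \o (fun x => cj (phi x)) = - (Im \o phi).
  by apply/funext => y; rewrite [RHS]/(- Im (phi y)) /=; case: (phi y).
apply: complex_eq => //=.
by rewrite !derive1E deriveN//; exact: (si 0%N).
Qed.

(** The definition pairs without conjugation; conjugating the test function yields the inner
    product. Real parts suffice because the test functions form a complex space, and they keep later
    estimates in real arithmetic. *)
Lemma is_wderivP (f g : L2) : is_wderiv f g <->
  forall phi, test phi -> Re (ip f (toL2 (cderiv phi))) = - Re (ip g (toL2 phi)).
Proof.
have E phi : test phi ->
    (cint (fun x => f x * cderiv (fun x => cj (phi x)) x) = ip f (toL2 (cderiv phi)))
    * (cint (fun x => g x * cj (phi x)) = ip g (toL2 phi)).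
  move=> tp; have tc := test_conj tp.
  have e1 : (fun x => cj (cderiv (fun x => cj (phi x)) x)) = cderiv phi.
    by rewrite (cderiv_conj tp); apply/funext => x; rewrite conjcK.
  have e2 : (fun x => cj (cj (phi x))) = phi by apply/funext => x; rewrite conjcK.
  split; first by rewrite (cint_ipL2 _ (cderiv_sqint tc)) e1.
  by rewrite (cint_ipL2 _ (test_sqint tc)) e2.
split=> H phi tp.
  have := congr1 Re (H _ (test_conj tp)); have [-> ->] := E _ tp.
  by move=> ->; case: (ip g _).
have {}E psi : test psi ->
   (cint (fun x => f x * cderiv psi x) = ip f (toL2 (cderiv (fun x => cj (psi x)))))
    * (cint (fun x => g x * psi x) = ip g (toL2 (fun x => cj (psi x)))).
  move=> tq; have [e1 e2] := E _ (test_conj tq); split.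
    rewrite -e1; congr cint; apply/funext => x; congr (_ * cderiv _ x).
    by apply/funext => y; rewrite conjcK.
  by rewrite -e2; congr cint; apply/funext => x; rewrite conjcK.
have tc := test_conj tp; have [-> ->] := E _ tp.
set psi := (fun x => cj (phi x)) in tc *.
apply: complex_eq; first by rewrite (H _ tc); case: (ip g _).
(* Testing with ['i] times the test function recovers the imaginary part. *)
have ti := test_ZD 'i%C tc (test_0 L).
have := H _ ti; rewrite (cderiv_ZD 'i%C tc (test_0 L)) (@cderiv_0 R L).
rewrite !addr0.
have toZ h : h \in sq -> toL2 ('i%C *: h) = 'i%C *: toL2 h.
  move=> hs; have s0 := test_sqint (test_0 L).
  by have := toL2ZD 'i%C hs s0; rewrite addr0 toL2_0 addr0.
rewrite (toZ _ (cderiv_sqint tc)) (toZ _ (test_sqint tc)).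
have ri (x y : L2) : Re (ip x ('i%C *: y)) = Im (ip x y).
  rewrite (ipC ipP) (ipZl ipP) (ipC ipP x y); case: (ip x y) => a b /=; ring.
by rewrite !ri => ->; case: (ip g _).
Qed.

Lemma bump_test a b n : 0 < a -> a < b -> b < L -> test (fun x => (bump a b n x)%:C).
Proof.
move=> a0 ab bL; split.
- by rewrite (_ : _ \o _ = bump a b n)//; exact: flat_smooth.
- by rewrite (_ : _ \o _ = cst 0)//; exact: smooth_cst.
- exists `[a, b]%classic; split; first exact: segment_compact.
    move=> x /=; rewrite !in_itv/= => /andP[ax xb].
    by rewrite (lt_le_trans a0 ax) (le_lt_trans xb bL).
  move=> x; rewrite /= in_itv/= => nx; rewrite bumpE//.
  by case: ifPn => // /andP[ax xb]; exfalso; apply: nx; rewrite !ltW.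
Qed.

Lemma one_sqint : cst 1 \in sq.
Proof. by apply: cont_sqint; move=> x; exact: cvg_cst. Qed.

Lemma is_wderiv_uniq (f g h : L2) : is_wderiv f g -> is_wderiv f h -> g = h.
Proof.
move=> wg wh; apply/eqP; rewrite -subr_eq0; apply/eqP.
have z phi : test phi -> cint (fun x => L2_fun (g - h) x * phi x) = 0.
  move=> tp; have sp := test_sqint tp.
  have := cint_L2ZD (-1) h g sp; rewrite scaleN1r addrC => ->.
  by rewrite mulN1r -(wh phi tp) (wg phi tp) addrC subrr.
set w : L2 := g - h in z *.
(* A square integrable function is integrable on the bounded interval, as its product with the
   constant 1. *)
have ir := integrable_ReM (L2_sqint w) one_sqint.
have ii := integrable_ImM (L2_sqint w) one_sqint.
have zr : \forall x \ae mu, I x -> Re (w x * 1) = 0.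
  apply: ae_eq0_of_bump ir _ => a b n a0 ab bL.
  have := congr1 Re (z _ (bump_test n a0 ab bL)); rewrite /= => h0; rewrite -[RHS]h0.
  by apply: eq_Rintegral => x _; rewrite mulr1 ReZ /= mulr0 subr0.
have zi : \forall x \ae mu, I x -> Im (w x * 1) = 0.
  apply: ae_eq0_of_bump ii _ => a b n a0 ab bL.
  have := congr1 Im (z _ (bump_test n a0 ab bL)); rewrite /= => h0; rewrite -[RHS]h0.
  by apply: eq_Rintegral => x _; rewrite mulr1 ImZ /= mulr0 add0r.
apply: L2_eq0; apply: filterS2 zr zi => x hr hi Ix.
by move: (hr Ix) (hi Ix); rewrite mulr1 => ? ?; apply: complex_eq.
Qed.

Lemma wderivE (f g : L2) : is_wderiv f g -> wderiv f = g.
Proof.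
move=> wg; rewrite /wderiv; case: xgetP => [h _ wh|H]; first exact: is_wderiv_uniq wh wg.
by have := H g wg.
Qed.

Lemma wderivP (f : L2) : inH1 f -> is_wderiv f (wderiv f).
Proof. by move=> [g wg]; rewrite (wderivE wg). Qed.

Lemma wderivZD k (f g : L2) : inH1 f -> inH1 g ->
  wderiv (k *: f + g) = k *: wderiv f + wderiv g.
Proof. by move=> /wderivP hf /wderivP hg; apply/wderivE/is_wderiv_ZD. Qed.

Lemma inH1ZD k (f g : L2) : inH1 f -> inH1 g -> inH1 (k *: f + g).
Proof.
by move=> [f' hf] [g' hg]; exists (k *: f' + g'); exact: is_wderiv_ZD.
Qed.

Lemma is_wderiv_lim (f g : L2) : (forall e : R, 0 < e -> exists f' g' : L2,
    [/\ is_wderiv f' g', N (f' - f) < e & N (g' - g) < e]) -> is_wderiv f g.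
Proof.
move=> H; apply/is_wderivP => phi tp; apply: rip_density ipP _ => e /H[f' [g' [w hf hg]]].
by exists f', g'; split => //; exact: (is_wderivP _ _).1 w phi tp.
Qed.

Lemma continuous_mul (f g : R -> R) : continuous f -> continuous g ->
  continuous (fun x => f x * g x).
Proof. by move=> cf cg x; exact: (cvgM (cf x) (cg x)). Qed.

Lemma continuous_add (f g : R -> R) : continuous f -> continuous g ->
  continuous (fun x => f x + g x).
Proof. by move=> cf cg x; exact: (cvgD (cf x) (cg x)). Qed.

Lemma cont_integrable (f : R -> R) : continuous f -> mu.-integrable I (EFin \o f).
Proof.
move=> cf; have IJ : I `<=` (`[0, L]%classic : set (measurableTypeR R)).
  by move=> x /=; rewrite !in_itv/= => /andP[? ?]; rewrite !ltW.
have mJ : measurable (`[0, L]%classic : set (measurableTypeR R)) by exact: measurable_itv.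
apply: (integrableS mJ) => //.
apply: continuous_compact_integrable; first exact: segment_compact.
exact: continuous_subspaceT.
Qed.

Lemma integral_derivative_eq0 (F f : R -> R) :
  (forall x : R, is_derive x 1 F (f x)) -> continuous f -> F 0 = 0 -> F L = 0 ->
  \int[mu]_(x in I) f x = 0.
Proof.
move=> dF cf F0 FL.
have cF : continuous F.
  move=> x; apply: differentiable_continuous; apply/derivable1_diffP.
  exact: (ex_derive (is_derive := dF x)).
have : (\int[mu]_(x in `[0%R, L]) (f x)%:E = (F L)%:E - (F 0)%:E)%E.
  apply: continuous_FTC2 => //.
  - exact: continuous_subspaceT.
  - split.
    + by move=> x _; exact: (ex_derive (is_derive := dF x)).
    + by apply: cvg_at_right_filter; exact: cF.
    + by apply: cvg_at_left_filter; exact: cF.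
  - by move=> x _; rewrite derive1E (derive_val (is_derive := dF x)).
rewrite F0 FL subee// => H.
rewrite /Rintegral integral_itv_bndo_bndc; last first.
  by apply: measurable_funTS; apply/measurable_EFinP; exact: continuous_measurable_fun.
rewrite integral_itv_obnd_cbnd ?H//.
by apply: measurable_funTS; apply/measurable_EFinP; exact: continuous_measurable_fun.
Qed.

Lemma smooth_is_derive (f : R -> R) : smooth f -> forall x : R, is_derive x 1 f (derive1 f x).
Proof.
move=> sf x; apply: DeriveDef; first exact: (sf 0%N).
by rewrite derive1E.
Qed.

Lemma integration_by_parts_smooth (f g : R -> R) : smooth f -> smooth g ->
  f 0 = 0 -> f L = 0 -> \int[mu]_(x in I) (f x * derive1 g x + g x * derive1 f x) = 0.
Proof.
move=> sf sg f0 fL.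
have cf := smooth_cont sf; have cf' := smooth_cont (smooth_derive1 sf).
have cg := smooth_cont sg; have cg' := smooth_cont (smooth_derive1 sg).
apply: (@integral_derivative_eq0 (f * g)).
- by move=> x; have := is_deriveM (smooth_is_derive sf x) (smooth_is_derive sg x).
- exact: (continuous_add (continuous_mul cf cg') (continuous_mul cg cf')).
- by rewrite fctE f0 mul0r.
- by rewrite fctE fL mul0r.
Qed.

Lemma test_boundary phi : test phi -> phi 0 = 0 /\ phi L = 0.
Proof.
by move=> [_ _ [K [_ KI K0]]]; split; apply: K0 => /KI /=; rewrite in_itv/= ltxx ?andbF.
Qed.

Lemma is_wderiv_test phi : test phi -> is_wderiv (toL2 phi) (toL2 (cderiv phi)).
Proof.
move=> tp; apply/is_wderivP => psi tq.
have sp := test_sqint tp; have sp' := cderiv_sqint tp.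
have sq' := test_sqint tq; have sq'' := cderiv_sqint tq.
have ipE h k : h \in sq -> k \in sq -> ip (toL2 h) (toL2 k) = cint (fun x => h x * cj (k x)).
  move=> hs ks; have ts := conj_sqint (L2_sqint (toL2 k)); have cs := conj_sqint ks.
  apply: eq_cint_ae.
  - exact: measurable_ReM (L2_sqint _) ts.
  - exact: measurable_ImM (L2_sqint _) ts.
  - exact: measurable_ReM hs cs.
  - exact: measurable_ImM hs cs.
  - by apply: filterS2 (toL2_ae hs) (toL2_ae ks) => x h1 h2 Ix; rewrite h1// h2.
rewrite !ipE//; apply/eqP; rewrite -subr_eq0 opprK /=.
have [[pr pi _] [qr qi _]] := (tp, tq).
have [p0 pL] := test_boundary tp.
have i1 := integration_by_parts_smooth pr qr (congr1 Re p0) (congr1 Re pL).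
have i2 := integration_by_parts_smooth pi qi (congr1 Im p0) (congr1 Im pL).
have cont (f g : R -> R) : smooth f -> smooth g ->
    mu.-integrable I (EFin \o (fun x => f x * derive1 g x + g x * derive1 f x)).
  move=> sf sg; apply: cont_integrable.
  have cf := smooth_cont sf; have cf' := smooth_cont (smooth_derive1 sf).
  have cg := smooth_cont sg; have cg' := smooth_cont (smooth_derive1 sg).
  exact: (continuous_add (continuous_mul cf cg') (continuous_mul cg cf')).
have iA := integrable_ReM sp (conj_sqint sq'').
have iB := integrable_ReM sp' (conj_sqint sq').
apply/eqP; transitivity (
    \int[mu]_(x in I) ((Re \o phi) x * derive1 (Re \o psi) x +
       (Re \o psi) x * derive1 (Re \o phi) x) +
    \int[mu]_(x in I) ((Im \o phi) x * derive1 (Im \o psi) x +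
       (Im \o psi) x * derive1 (Im \o phi) x)); last by rewrite i1 i2 addr0.
rewrite -[LHS](RintegralD mI iA iB) -[RHS](RintegralD mI (cont _ _ pr qr) (cont _ _ pi qi)).
apply: eq_Rintegral => x _; rewrite !ReZ /cderiv /=.
by case: (phi x) (psi x) => ? ? [? ?] /=; ring.
Qed.

Lemma inH10_approx (f : L2) : inH10 f -> is_wderiv f (wderiv f) /\
  forall e : R, 0 < e -> exists2 phi, test phi &
    N (toL2 phi - f) < e /\ N (toL2 (cderiv phi) - wderiv f) < e.
Proof.
move=> [g [wg [phi [tp c1 c2]]]]; rewrite (wderivE wg); split => // e e0.
have h1 : \forall n \near \oo, N (toL2 (phi n) - f) < e.
  move/cvgr0Pnorm_lt: c1 => /(_ e e0); apply: filterS => n.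
  by rewrite ger0_norm// (n_ge0 NP).
have h2 : \forall n \near \oo, N (toL2 (cderiv (phi n)) - g) < e.
  move/cvgr0Pnorm_lt: c2 => /(_ e e0); apply: filterS => n.
  by rewrite ger0_norm// (n_ge0 NP).
have [n [a b]] := filter_ex (filterI h1 h2).
by exists (phi n).
Qed.

(** The weak derivative relation is inherited from the test functions by closedness of its graph. *)
Lemma inH10_of_approx (f g : L2) : (forall e : R, 0 < e -> exists2 phi, test phi &
    N (toL2 phi - f) < e /\ N (toL2 (cderiv phi) - g) < e) -> inH10 f /\ wderiv f = g.
Proof.
move=> H; have wg : is_wderiv f g.
  apply: is_wderiv_lim => e /H[phi tp [a b]]; exists (toL2 phi), (toL2 (cderiv phi)).
  by split => //; exact: is_wderiv_test.
split; last exact: wderivE.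
exists g; split => //.
have ex n : exists phi, test phi /\ (N (toL2 phi - f) < n.+1%:R^-1 /\
    N (toL2 (cderiv phi) - g) < n.+1%:R^-1).
  by have [|phi tp h] := H n.+1%:R^-1; [rewrite invr_gt0|exists phi].
have [phi phiP] := choice ex; exists phi; split => [n||]; first by have [] := phiP n.
- apply: (@squeeze_cvgr _ _ _ _ (cst 0) (fun n => n.+1%:R^-1)).
  + by apply: nearW => n; have [_ [a _]] := phiP n; rewrite (n_ge0 NP) ltW.
  + exact: cvg_cst.
  + exact: cvg_harmonic.
- apply: (@squeeze_cvgr _ _ _ _ (cst 0) (fun n => n.+1%:R^-1)).
  + by apply: nearW => n; have [_ [_ a]] := phiP n; rewrite (n_ge0 NP) ltW.
  + exact: cvg_cst.
  + exact: cvg_harmonic.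
Qed.

Lemma inH10_inH1 (f : L2) : inH10 f -> inH1 f.
Proof. by move=> [g [wg _]]; exists g. Qed.

Lemma test_inH10 phi : test phi -> inH10 (toL2 phi) /\ wderiv (toL2 phi) = toL2 (cderiv phi).
Proof.
move=> tp; apply: inH10_of_approx => e e0; exists phi => //.
by rewrite !subrr (n0 NP).
Qed.

(* A real-valued test function satisfies [\int (x f ^ 2)' = 0], whence
   [\int f ^ 2 = - 2 \int x f f']. *)
Lemma poincare_smooth (f : R -> R) : smooth f -> f 0 = 0 -> f L = 0 ->
  \int[mu]_(x in I) f x ^+ 2 <= (2 * L) ^+ 2 * \int[mu]_(x in I) derive1 f x ^+ 2.
Proof.
move=> sf f0 fL; have cf := smooth_cont sf; have cf' := smooth_cont (smooth_derive1 sf).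
pose G x := x * (f x * derive1 f x + f x * derive1 f x) + f x * f x.
have cff := continuous_mul cf cf.
have cG : continuous G.
  apply: continuous_add cff; apply: continuous_mul; first by move=> x; exact: cvg_id.
  exact: (continuous_add (continuous_mul cf cf') (continuous_mul cf cf')).
have G0 : \int[mu]_(x in I) G x = 0.
  apply: (@integral_derivative_eq0 (id * (f * f))) => //.
  - move=> x; have d := smooth_is_derive sf x.
    apply: (is_derive_eq (is_deriveM (is_derive_id x 1) (is_deriveM d d))).
    rewrite /G !fctE.
    by have sc (a b : R) : a *: b = a * b by []; rewrite !sc mulr1.
  - by rewrite !fctE mul0r.
  - by rewrite !fctE fL !mulr0.
have c2 : continuous (fun x : R => f x ^+ 2) := cff.
have c2' : continuous (fun x : R => derive1 f x ^+ 2) := continuous_mul cf' cf'.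
have i1 := cont_integrable c2; have i2 := cont_integrable c2'.
have Z k (u : R -> R) : mu.-integrable I (EFin \o u) ->
    mu.-integrable I (EFin \o (fun x => k * u x)).
  by move=> iu; have := integrableZl mI k iu; apply: eq_integrable.
have D (u v : R -> R) : mu.-integrable I (EFin \o u) -> mu.-integrable I (EFin \o v) ->
    mu.-integrable I (EFin \o (fun x => u x + v x)).
  by move=> iu iv; have := integrableD mI iu iv; apply: eq_integrable.
(* The integrand is at most [G] pointwise, from [(p + 2 x q)^2 >= 0] and [x <= L]. This gives the
   constant [(2 * L) ^+ 2] without Cauchy-Schwarz for integrals. *)
have : \int[mu]_(x in I) (2^-1 * f x ^+ 2 + - (2 * L ^+ 2) * derive1 f x ^+ 2) <= 0.
  rewrite -[leRHS]G0; apply: (le_Rintegral mI).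
  - by apply: D; exact: Z.
  - exact: cont_integrable.
  - move=> x; rewrite /= in_itv/= => /andP[x0 xL]; rewrite /G.
    set p := f x; set q := derive1 f x.
    have xq : x ^+ 2 * q ^+ 2 <= L ^+ 2 * q ^+ 2.
      by rewrite ler_wpM2r ?sqr_ge0// lerXn2r ?nnegrE ?ltW.
    have : 0 <= 2^-1 * (p + 2 * x * q) ^+ 2 by rewrite mulr_ge0 ?sqr_ge0.
    have -> : 2^-1 * (p + 2 * x * q) ^+ 2 = 2^-1 * p ^+ 2 + 2 * (x * p * q) +
      2 * (x ^+ 2 * q ^+ 2) by field.
    lra.
rewrite RintegralD//; [|exact: Z..].
rewrite !RintegralZl//; set X := \int[mu]_(x in I) _; set Y := \int[mu]_(x in I) _.
by move=> h; rewrite exprMn; lra.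
Qed.

Lemma poincare (f : L2) : inH10 f -> N f <= 2 * L * N (wderiv f).
Proof.
have T phi : test phi -> N (toL2 phi) <= 2 * L * N (toL2 (cderiv phi)).
  move=> tp; have [p0 pL] := test_boundary tp.
  have tl : 0 <= 2 * L by rewrite mulr_ge0// ltW.
  have sp := test_sqint tp; have sp' := cderiv_sqint tp.
  suff H : N (toL2 phi) ^+ 2 <= (2 * L) ^+ 2 * N (toL2 (cderiv phi)) ^+ 2.
    rewrite -(ler_pXn2r (n := 2)) ?nnegrE ?(n_ge0 NP)// ?mulr_ge0 ?(n_ge0 NP) ?(ltW L0)//.
    by rewrite exprMn.
  have e1 : N (toL2 phi) ^+ 2 = \int[mu]_(x in I) normc (phi x) ^+ 2.
    by rewrite /Rintegral (ae_normL2 (sqint_cmeasurable sp) (toL2_ae sp)).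
  have e2 : N (toL2 (cderiv phi)) ^+ 2 = \int[mu]_(x in I) normc (cderiv phi x) ^+ 2.
    by rewrite /Rintegral (ae_normL2 (sqint_cmeasurable sp') (toL2_ae sp')).
  rewrite e1 e2 {e1 e2}.
  have [pr pi _] := tp.
  have a := poincare_smooth pr (congr1 Re p0) (congr1 Re pL).
  have b := poincare_smooth pi (congr1 Im p0) (congr1 Im pL).
  have c2 (h : R -> R) : smooth h -> mu.-integrable I (EFin \o (fun x : R => h x ^+ 2)).
    by move=> /smooth_cont ch; apply: cont_integrable; exact: (continuous_mul ch ch).
  have E (h : R -> C) : smooth (Re \o h) -> smooth (Im \o h) ->
      \int[mu]_(x in I) normc (h x) ^+ 2 =
      \int[mu]_(x in I) (Re \o h) x ^+ 2 + \int[mu]_(x in I) (Im \o h) x ^+ 2.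
    move=> hr hi; rewrite -RintegralD//; [|exact: c2..].
    by apply: eq_Rintegral => x _; rewrite normcsqE.
  have E1 := E phi pr pi.
  have E2 := E (cderiv phi) (smooth_derive1 pr) (smooth_derive1 pi).
  by rewrite E1 E2 [leRHS]mulrDr; exact: (lerD a b).
move=> /inH10_approx[_ ap]; apply: norm_le_density NP _ _.
  by rewrite mulr_ge0// ltW.
by move=> e /ap[phi tp [a b]]; exists (toL2 phi), (toL2 (cderiv phi)); rewrite T.
Qed.

(** For a test function this is the definition of [g']; both sides are continuous in [f] and its
    derivative. *)
Lemma green (f g g' : L2) : is_wderiv g g' -> inH10 f ->
  Re (ip g' f) = - Re (ip g (wderiv f)).
Proof.
move=> wg /inH10_approx[_ ap]; rewrite (ripC ipP) (ripC ipP (wderiv f)).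
apply: rip_density ipP _ => e /ap[phi tp [a b]].
exists (toL2 phi), (toL2 (cderiv phi)); split => //.
rewrite (ripC ipP g') (ripC ipP g) ((is_wderivP _ _).1 wg phi tp); exact/esym/opprK.
Qed.

End WeakDerivative.

(** * Well-posedness in Hilbert spaces *)

Section DissipativeHilbert.
Variables (R : realType) (V : lmodType R[i]) (ip : V -> V -> R[i]).
Hypothesis ipP : inner_product ip.
Local Notation N := (ipnorm ip).
Hypothesis complN : ncomplete N.
Variables (D : set V) (A : V -> V).
Hypothesis D0 : D 0.
Hypothesis Alin : linear_on D A.
Hypothesis Aneg : forall x, D x -> complex.Re (ip (A x) x) <= 0.

Let NP := ipnorm_axioms ipP.

Lemma dissipative_of_neg : dissipative N D A.
Proof.
move=> x h Dx h0; rewrite -ler_sqr ?nnegrE ?ipnorm_ge0//.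
rewrite !(ipnormE ipP) !(ripBl ipP, ripBr ipP, ripZl ipP, ripZr ipP) (ripC ipP (A x) x).
have := Aneg Dx; rewrite (ripC ipP x); have := sqr_ge0 (N (A x)); rewrite (ipnormE ipP).
move: (complex.Re (ip x x)) (complex.Re (ip x (A x))) (complex.Re (ip (A x) (A x))).
move=> p q r; nra.
Qed.

(** If [w] is orthogonal to [D], write [w = x - A x]: then [0 = Re (w, x) = N x ^+ 2 - Re (A x, x)
    >= N x ^+ 2], so [x] and [w] vanish. *)
Lemma dense_of_neg : full_range D A 1 -> forall x e, 0 < e -> exists2 y, D y & N (x - y) < e.
Proof.
move=> fr; apply: (dense_of_orthogonal ipP complN D0) => [x y|k x|w wD].
- exact: (D_D Alin).
- exact: (D_Z D0 Alin).
have [x Dx xw] := fr w; rewrite scale1r in xw.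
have := wD x Dx; rewrite -{1}xw (ripBl ipP) -(ipnormE ipP).
have := Aneg Dx => h /eqP; rewrite subr_eq0 => /eqP e.
have x0 : x = 0.
  apply: (n_eq0 NP); apply/eqP; rewrite -sqrf_eq0 eq_le sqr_ge0 andbT.
  by rewrite e.
by rewrite -xw x0 (A_0 D0 Alin) subrr.
Qed.

Theorem dissipative_wellposed (K : R) :
  (forall x, exists2 y, D y & A y = x) ->
  0 < K -> (forall y, D y -> N y <= K * N (A y)) ->
  (exists T : R -> V -> V, generated_by N D A T) /\
  forall T : R -> V -> V, generated_by N D A T ->
    (forall U0 : V, weak_solution N D A U0 (fun t => T t U0) /\
       forall U, weak_solution N D A U0 U -> forall t, 0 <= t -> U t = T t U0) /\
    (forall U0 : V, D U0 -> strong_solution N D A U0 (fun t => T t U0) /\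
       forall U, strong_solution N D A U0 U -> forall t, 0 <= t -> U t = T t U0).
Proof.
move=> surj K0 bd; have dis := dissipative_of_neg.
have fr := full_range_pos NP complN D0 Alin dis surj K0 bd.
exact: (semigroup_wellposed NP complN D0 Alin dis fr (dense_of_neg (fr 1 ltr01)) surj).
Qed.

End DissipativeHilbert.

(** * Multiplication by bounded measurable functions *)

Section Multiplier.
Variables (R : realType) (L : R).
Local Notation C := R[i].
Local Notation Re := (@complex.Re R).
Local Notation Im := (@complex.Im R).
Local Notation mu := (@lebesgue_measure R).
Local Notation I := (`]0, L[%classic : set (measurableTypeR R)).
Local Notation sq := (@sqint R L).
Local Notation L2 := (L2 L).
Local Notation N := (@normL2 R L).
Local Notation ip := (@ipL2 R L).

Let mI : measurable I. Proof. exact: measurable_itv. Qed.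

Definition multiplier (M : R) (m : R -> R) : Prop :=
  measurable_fun I m /\ forall x, `|m x| <= M.

Variables (M : R) (m : R -> R).
Hypothesis mP : multiplier M m.

Lemma multiplier_ge0 : 0 <= M.
Proof. by case: mP => _ /(_ 0); apply: le_trans. Qed.

Lemma multiplier_sqr x : m x ^+ 2 <= M ^+ 2.
Proof.
by case: mP => _ mM; rewrite -[m x ^+ 2]real_normK ?num_real// lerXn2r ?nnegrE ?multiplier_ge0.
Qed.

Let g (f : R -> C) : R -> C := fun x => (m x)%:C * f x.

Let g_normc f x : normc (g f x) ^+ 2 = m x ^+ 2 * normc (f x) ^+ 2.
Proof. by rewrite /g normcM normc_real exprMn real_normK ?num_real. Qed.

Let g_measurable f : cmeasurable L f -> cmeasurable L (g f).
Proof.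
move=> [fr fi]; case: mP => mm _; split.
  rewrite (_ : _ \o _ = (fun x => m x * (Re \o f) x)); first exact: measurable_funM.
  by apply/funext => x; rewrite /g /= ReZ /= mul0r subr0.
rewrite (_ : _ \o _ = (fun x => m x * (Im \o f) x)); first exact: measurable_funM.
by apply/funext => x; rewrite /g /= ImZ /= mul0r addr0.
Qed.

Lemma multiplier_sqint f : f \in sq -> g f \in sq.
Proof.
move=> fs; have [gr gi] := g_measurable (sqint_cmeasurable fs).
have /sqintP[_ _ fi] := fs; apply/sqintP; split => //.
apply: (le_integrable mI _ _ (integrableZl mI (M ^+ 2) fi)).
  exact: (cmeasurable_normcsq (conj gr gi)).
move=> x _; rewrite -EFinM !abse_EFin lee_fin g_normc.
by rewrite !(ger0_norm (mulr_ge0 (sqr_ge0 _) (sqr_ge0 _))) ler_wpM2r ?sqr_ge0 ?multiplier_sqr.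
Qed.

Lemma mulL2_ae (f : L2) : (mulL2 m f : R -> C) = g f %[ae mu in I].
Proof. exact: toL2_ae (multiplier_sqint (L2_sqint f)). Qed.

Lemma mulL2ZD k (f h : L2) : mulL2 m (k *: f + h) = k *: mulL2 m f + mulL2 m h.
Proof.
set u : L2 := mulL2 m (k *: f + h); set v : L2 := k *: mulL2 m f + mulL2 m h.
have eu : (u : R -> C) = (fun x => (m x)%:C * (k * f x + h x)) %[ae mu in I].
  by apply: filterS2 (L2_funZD_ae k f h) (mulL2_ae (k *: f + h)) => x h1 h2 Ix;
    rewrite h2// /g h1.
have ev : (v : R -> C) = (fun x => (m x)%:C * (k * f x + h x)) %[ae mu in I].
  apply: filterS3 (L2_funZD_ae k (mulL2 m f) (mulL2 m h)) (mulL2_ae f) (mulL2_ae h).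
  by move=> x h1 h2 h3 Ix; rewrite h1// h2// h3// /g mulrDr mulrCA.
suff : u - v = 0 by move/eqP; rewrite subr_eq0 => /eqP.
apply: L2_eq0; apply: filterS3 (L2_subE u v) eu ev => x h1 h2 h3 Ix.
by rewrite h1// h2// h3// subrr.
Qed.

Lemma normL2_mulL2 (f : L2) : N (mulL2 m f) <= M * N f.
Proof.
have M0 := multiplier_ge0.
have gs := multiplier_sqint (L2_sqint f).
have /sqintP[_ _ ig] := gs; have /sqintP[_ _ iff] := L2_sqint f.
have e1 : N (mulL2 m f) ^+ 2 = \int[mu]_(x in I) normc (g f x) ^+ 2.
  by rewrite /Rintegral (ae_normL2 (sqint_cmeasurable gs) (mulL2_ae f)).
have e2 : N f ^+ 2 = \int[mu]_(x in I) normc (f x) ^+ 2.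
  by rewrite /Rintegral (ae_normL2 (w := f) (L2_cmeasurable f) (ae_eq_refl _ _ _)).
suff h : N (mulL2 m f) ^+ 2 <= M ^+ 2 * N f ^+ 2.
  rewrite -(ler_pXn2r (n := 2)) ?nnegrE ?sqrtr_ge0// ?(mulr_ge0 M0) ?sqrtr_ge0//.
  by rewrite exprMn.
have iM : mu.-integrable I (EFin \o (fun x => M ^+ 2 * normc (f x) ^+ 2)).
  by have := integrableZl mI (M ^+ 2) iff; apply: eq_integrable.
rewrite e1 e2 -(RintegralZl _ mI iff); apply: (le_Rintegral mI ig iM) => x _.
by rewrite g_normc ler_wpM2r ?sqr_ge0 ?multiplier_sqr.
Qed.

Lemma mulL2_sym (f h : L2) : ip (mulL2 m f) h = ip f (mulL2 m h).
Proof.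
have sh := conj_sqint (L2_sqint h); have sh' := conj_sqint (L2_sqint (mulL2 m h)).
apply: eq_cint_ae.
- exact: measurable_ReM (L2_sqint (mulL2 m f)) sh.
- exact: measurable_ImM (L2_sqint (mulL2 m f)) sh.
- exact: measurable_ReM (L2_sqint f) sh'.
- exact: measurable_ImM (L2_sqint f) sh'.
- apply: filterS2 (mulL2_ae f) (mulL2_ae h) => x h1 h2 Ix; rewrite h1// h2// /g.
  by case: (L2_fun f x) (L2_fun h x) => p q [r s]; apply: complex_eq => /=; ring.
Qed.

Lemma mulL2_ge0 (f : L2) : (forall x, 0 <= m x) -> 0 <= Re (ip (mulL2 m f) f).
Proof.
move=> m0; have sf := conj_sqint (L2_sqint f).
have sg := multiplier_sqint (L2_sqint f).
have -> : ip (mulL2 m f) f = cint L (fun x => g f x * (L2_fun f x)^*).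
  apply: eq_cint_ae.
  - exact: measurable_ReM (L2_sqint (mulL2 m f)) sf.
  - exact: measurable_ImM (L2_sqint (mulL2 m f)) sf.
  - exact: measurable_ReM sg sf.
  - exact: measurable_ImM sg sf.
  - by apply: filterS (mulL2_ae f) => x /[apply] ->.
apply: Rintegral_ge0 => x _; rewrite /g -mulrA ReZ Re_mulJ /= mul0r subr0.
by rewrite mulr_ge0 ?sqr_ge0.
Qed.

End Multiplier.

(** * The energy space *)

Lemma weighted_sum_eq0 (R : realFieldType) (a p q r s : R) : 0 < a ->
  0 <= p -> 0 <= q -> 0 <= r -> 0 <= s -> p + a * q + r + s = 0 ->
  [/\ p = 0, q = 0, r = 0 & s = 0].
Proof.
move=> a0 p0 q0 r0 s0 h; have aq := mulr_ge0 (ltW a0) q0.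
have aq0 : a * q = 0 by lra.
split; [lra| |lra|lra].
by move/eqP: aq0; rewrite mulf_eq0 gt_eqF//= => /eqP.
Qed.

Lemma le_sqr_sum (R : realFieldType) (n x y z w : R) : 0 <= n ->
  n ^+ 2 = x ^+ 2 + y ^+ 2 + z ^+ 2 + w ^+ 2 -> [/\ x <= n, y <= n, z <= n & w <= n].
Proof.
move=> n0 E; have H t : t ^+ 2 <= n ^+ 2 -> t <= n.
  move=> h; have [t0|t0] := leP 0 t; last by apply: le_trans (ltW t0) n0.
  by rewrite -(ler_pXn2r (n := 2)).
have := sqr_ge0 x; have := sqr_ge0 y; have := sqr_ge0 z; have := sqr_ge0 w.
by move=> *; split; apply: H; rewrite E; lra.
Qed.

Lemma sqr_sum_le (R : realFieldType) (n x y z w : R) :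
  0 <= n -> 0 <= x -> 0 <= y -> 0 <= z -> 0 <= w ->
  n ^+ 2 = x ^+ 2 + y ^+ 2 + z ^+ 2 + w ^+ 2 -> n <= x + y + z + w.
Proof.
move=> n0 x0 y0 z0 w0 E.
rewrite -(ler_pXn2r (n := 2)) ?nnegrE ?addr_ge0// E.
have := mulr_ge0 x0 y0; have := mulr_ge0 x0 z0; have := mulr_ge0 x0 w0.
have := mulr_ge0 y0 z0; have := mulr_ge0 y0 w0; have := mulr_ge0 z0 w0.
nra.
Qed.

Section EnergySpaceHilbert.
Variables (R : realType) (L : R).
Hypothesis L0 : 0 < L.
Local Notation C := R[i].
Local Notation Re := (@complex.Re R).
Local Notation L2 := (L2 L).
Local Notation N := (@normL2 R L).
Local Notation ip := (@ipL2 R L).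

Let ipP := @ipL2_inner R L.
Let NP := @normL2_axioms R L.

Lemma H10_inH10 (u : H10 L) : inH10 (u : L2).
Proof. by have /asboolP := H10P u. Qed.

Lemma H10_inH1 (u : H10 L) : inH1 (u : L2).
Proof. exact/inH10_inH1/H10_inH10. Qed.

Lemma wderivH10_ZD k (u v : H10 L) :
  wderiv (k *: u + v : H10 L) = k *: wderiv u + wderiv v.
Proof. exact: (wderivZD k (H10_inH1 u) (H10_inH1 v)). Qed.

(** Definite by the Poincare inequality; its [ipnorm] is by conversion [N (wderiv u)], the norm in
    [H10_complete]. *)
Definition ipH10 (u v : H10 L) : C := ip (wderiv u) (wderiv v).

Lemma wderivH10_eq0 (u : H10 L) : wderiv u = 0 -> u = 0.
Proof.
move=> u0; apply: val_inj; apply: (n_eq0 NP); apply/eqP.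
have := poincare L0 (H10_inH10 u); rewrite u0 (n0 NP) mulr0 => h.
by rewrite eq_le h (n_ge0 NP).
Qed.

Lemma ipH10_inner : inner_product ipH10.
Proof.
case: (ipP) => l c p z; split.
- by move=> k u v w; rewrite /ipH10 wderivH10_ZD l.
- by move=> u v; rewrite /ipH10 c.
- by move=> u; exact: p.
- by move=> u /z/wderivH10_eq0.
Qed.

Lemma wderivH10_B (u v : H10 L) : wderiv (u - v : H10 L) = wderiv u - wderiv v.
Proof. by rewrite addrC -scaleN1r wderivH10_ZD scaleN1r addrC. Qed.

(** By Poincare, functions converge in L^2 along with their derivatives; test functions close to the
    terms of the sequence are close to the limit pair, which places the limit in H_0^1. *)
Lemma H10_complete : ncomplete (fun u : H10 L => N (wderiv u)).
Proof.
move=> u cu.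
have cw : ncauchy N (fun n => wderiv (u n)).
  by move=> e /cu[n1 h]; exists n1 => m n hm hn; rewrite -wderivH10_B; exact: h.
have cv : ncauchy N (fun n => u n : L2).
  move=> e e0; have p : 0 < 2 * L by rewrite mulr_gt0.
  have [|n1 h] := cu (e / (2 * L)); first by rewrite divr_gt0.
  exists n1 => m n hm hn; apply: le_lt_trans (poincare L0 (H10_inH10 (u m - u n))) _.
  by rewrite mulrC -ltr_pdivlMr//; exact: h.
have [g wg] := L2_complete cw; have [f vf] := L2_complete cv.
have [hf fg] : inH10 f /\ wderiv f = g.
  apply: (inH10_of_approx L0) => e e0; have e2 : 0 < e / 2 by rewrite divr_gt0.
  have [n1 h1] := wg _ e2; have [n2 h2] := vf _ e2; set n := maxn n1 n2.
  have {}h1 := h1 n (leq_maxl _ _); have {}h2 := h2 n (leq_maxr _ _).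
  have [_ /(_ _ e2)[phi tp [a b]]] := inH10_approx (H10_inH10 (u n)).
  exists phi => //; split.
    apply: le_lt_trans (ntri NP (u n : L2) _ _) _.
    by rewrite (splitr e); exact: ltrD.
  apply: le_lt_trans (ntri NP (wderiv (u n)) _ _) _.
  by rewrite (splitr e); exact: ltrD.
have fH : f \in @H10pred R L by apply/asboolP.
exists (MkH10 fH) => e /wg[n1 h]; exists n1 => n /h.
by rewrite wderivH10_B /= fg.
Qed.

Variable a : R.
Hypothesis a0 : 0 < a.

Lemma ipH_ReE (U W : Hspace L) : Re (ipH a U W) = Re (ip (Hv U) (Hv W)) +
    a * Re (ip (wderiv (Hu U)) (wderiv (Hu W))) + Re (ip (Hz U) (Hz W)) +
    Re (ip (wderiv (Hy U)) (wderiv (Hy W))).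
Proof. by rewrite /ipH !ReD ReZ /= mul0r subr0. Qed.

Lemma ipH_inner : inner_product (@ipH R L a).
Proof.
case: (ipP) => l c p z.
split.
- move=> k [[u v] [y w]] [[u1 v1] [y1 w1]] [[u2 v2] [y2 w2]].
  rewrite /ipH /Hu /Hv /Hy /Hz /= !wderivH10_ZD !l.
  move: (ip _ _) (ip _ _) (ip _ _) (ip _ _) (ip _ _) (ip _ _) (ip _ _) (ip _ _) (a%:C).
  by move=> *; ring.
- move=> U W; rewrite /ipH (c (Hv U)) (c (wderiv (Hu U))) (c (Hz U)) (c (wderiv (Hy U))).
  move: (ip _ _) (ip _ _) (ip _ _) (ip _ _) => [? ?] [? ?] [? ?] [? ?].
  by apply: complex_eq => /=; ring.
- by move=> U; rewrite ipH_ReE !addr_ge0 ?p// mulr_ge0 ?p// ltW.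
- move=> U; rewrite ipH_ReE => h.
  have [h1 h2 h3 h4] := weighted_sum_eq0 a0 (p _) (p _) (p _) (p _) h.
  move: (z _ h1) (wderivH10_eq0 (z _ h2)) (z _ h3) (wderivH10_eq0 (z _ h4)).
  by case: U {h h1 h2 h3 h4} => [[u v] [y w]]; rewrite /Hv /Hu /Hz /Hy /= => -> -> -> ->.
Qed.

Lemma normH_sqr (U : Hspace L) : normH a U ^+ 2 =
  N (Hv U) ^+ 2 + (Num.sqrt a * N (wderiv (Hu U))) ^+ 2 + N (Hz U) ^+ 2 +
  N (wderiv (Hy U)) ^+ 2.
Proof.
have En (f : L2) : N f ^+ 2 = Re (ip f f) := ipnormE ipP f.
have e0 : normH a U ^+ 2 = Re (ipH a U U) := ipnormE ipH_inner U.
have e1 : (Num.sqrt a * N (wderiv (Hu U))) ^+ 2 =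
    a * Re (ip (wderiv (Hu U)) (wderiv (Hu U))).
  by rewrite -En exprMn sqr_sqrtr// ltW.
by rewrite e0 e1 (En (Hv U)) (En (Hz U)) (En (wderiv (Hy U))); exact: ipH_ReE.
Qed.

Lemma normH_ge (U : Hspace L) : [/\ N (Hv U) <= normH a U,
  Num.sqrt a * N (wderiv (Hu U)) <= normH a U, N (Hz U) <= normH a U
  & N (wderiv (Hy U)) <= normH a U].
Proof. exact: (le_sqr_sum (sqrtr_ge0 _) (normH_sqr U)). Qed.

Lemma normH_le (U : Hspace L) : normH a U <=
  N (Hv U) + Num.sqrt a * N (wderiv (Hu U)) + N (Hz U) + N (wderiv (Hy U)).
Proof.
have q0 : 0 <= Num.sqrt a * N (wderiv (Hu U)) := mulr_ge0 (sqrtr_ge0 _) (n_ge0 NP _).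
exact: (sqr_sum_le (sqrtr_ge0 _) (n_ge0 NP _) q0 (n_ge0 NP _) (n_ge0 NP _) (normH_sqr U)).
Qed.

Lemma Hspace_complete : ncomplete (@normH R L a).
Proof.
move=> U cU; have q0 : 0 < Num.sqrt a by rewrite sqrtr_gt0.
(* A component whose norm is dominated by the energy norm inherits the Cauchy property. *)
have comp (W : lmodType C) (f : Hspace L -> W) (M : W -> R) : ncomplete M ->
    (forall X Y, f (X - Y) = f X - f Y) -> (exists2 k, 0 < k &
      forall X, k * M (f X) <= normH a X) -> exists w, nlim M (fun n => f (U n)) w.
  move=> cM fB [k k0 hk]; apply: cM => e e0.
  have [|n1 h] := cU (k * e); first by rewrite mulr_gt0.
  exists n1 => i j hi hj; rewrite -(ltr_pM2l k0); apply: le_lt_trans (h i j hi hj).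
  by rewrite -fB; exact: hk.
have [||v hv] := comp _ (@Hv R L) N (@L2_complete R L).
- by [].
- by exists 1 => // X; rewrite mul1r; have [] := normH_ge X.
have [||u hu] := comp _ (@Hu R L) _ H10_complete.
- by [].
- by exists (Num.sqrt a) => // X; have [] := normH_ge X.
have [||z hz] := comp _ (@Hz R L) N (@L2_complete R L).
- by [].
- by exists 1 => // X; rewrite mul1r; have [] := normH_ge X.
have [||y hy] := comp _ (@Hy R L) _ H10_complete.
- by [].
- by exists 1 => // X; rewrite mul1r; have [] := normH_ge X.
exists ((u, v), (y, z)) => e e0.
have e4 : 0 < e / 4 by rewrite divr_gt0.
have e4' : 0 < e / 4 / Num.sqrt a by rewrite divr_gt0.
have [n1 h1] := hv _ e4; have [n2 h2] := hu _ e4'.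
have [n3 h3] := hz _ e4; have [n4 h4] := hy _ e4.
exists (maxn (maxn n1 n2) (maxn n3 n4)) => n; rewrite !geq_max.
move=> /andP[/andP[/h1 {}h1 /h2 {}h2] /andP[/h3 {}h3 /h4 {}h4]].
apply: le_lt_trans (normH_le _) _.
rewrite ltr_pdivlMr// mulrC in h2.
have := ltrD (ltrD (ltrD h1 h2) h3) h4.
have -> : e / 4 + e / 4 + e / 4 + e / 4 = e by field.
by [].
Qed.

End EnergySpaceHilbert.

(** * Energy identity and Dirichlet problem for one flux *)

Section Flux.
Variables (R : realType) (L : R).
Hypothesis L0 : 0 < L.
Local Notation C := R[i].
Local Notation Re := (@complex.Re R).
Local Notation L2 := (L2 L).
Local Notation N := (@normL2 R L).
Local Notation ip := (@ipL2 R L).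

Let ipP := @ipL2_inner R L.
Let NP := @normL2_axioms R L.

(** By [green] the elastic part of the flux contributes [- s Re (u', v')], cancelled by the second
    term, which comes from the H_0^1 component of the energy; only [- Re (m v', v')] survives. *)
Lemma flux_energy (s M : R) (m : R -> R) (u v : L2) : multiplier L M m ->
  (forall x, 0 <= m x) -> inH10 v ->
  inH1 (s%:C *: wderiv u + mulL2 m (wderiv v)) ->
  Re (ip (wderiv (s%:C *: wderiv u + mulL2 m (wderiv v))) v) +
    s * Re (ip (wderiv v) (wderiv u)) <= 0.
Proof.
have real_le (x y z : R) : x = s * y + z -> 0 <= z -> - x + s * y <= 0.
  by move=> -> ?; lra.
move=> mM m0 hv /wderivP wF; have E := green wF hv; rewrite {}E.
apply: real_le (mulL2_ge0 mM (wderiv v) m0).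
exact: (ripZDl ipP).
Qed.

Lemma flux_solve (s : R) (p h : L2) : 0 < s ->
  exists u : H10 L, is_wderiv (s%:C *: wderiv u + p) h.
Proof.
move=> s0; have ipP10 := ipH10_inner L0.
(* From the weak form [s Re (u', w') = - Re (p, w') - Re (h, w)] for all [w] in H_0^1; Poincare
   bounds the last term, hence the constant [M]. *)
pose l (u : H10 L) := - s^-1 * (Re (ip p (wderiv u)) + Re (ip h u)).
pose M := s^-1 * (N p + N h * (2 * L)).
have M0 : 0 <= M.
  rewrite mulr_ge0 ?invr_ge0 ?(ltW s0)// addr_ge0 ?(n_ge0 NP)//.
  by rewrite mulr_ge0 ?(n_ge0 NP)// mulr_ge0// ltW.
have lD (x y : H10 L) : l (x + y) = l x + l y.
  have E : wderiv (x + y : H10 L) = wderiv x + wderiv y.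
    by rewrite -[x in LHS]scale1r wderivH10_ZD scale1r.
  have real_eq (p0 p1 q0 q1 r0 r1 : R) : p0 = q0 + r0 -> p1 = q1 + r1 ->
      - s^-1 * (p0 + p1) = - s^-1 * (q0 + q1) + - s^-1 * (r0 + r1).
    by move=> -> ->; ring.
  rewrite /l E; apply: real_eq; first exact: (ripDr ipP).
  exact: (ripDr ipP (x : L2) (y : L2) h).
have lZ (k : R) (x : H10 L) : l (k%:C *: x) = k * l x.
  have E : wderiv (k%:C *: x : H10 L) = k%:C *: wderiv x.
    rewrite -[k%:C *: x]addr0 wderivH10_ZD.
    by have := wderivH10_B x x; rewrite !subrr => ->; rewrite addr0.
  have real_eq (p0 p1 q0 q1 : R) : p0 = k * q0 -> p1 = k * q1 ->
      - s^-1 * (p0 + p1) = k * (- s^-1 * (q0 + q1)).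
    by move=> -> ->; ring.
  rewrite /l E; apply: real_eq; first exact: (ripZr ipP).
  exact: (ripZr ipP k (x : L2) h).
have real_le (np nx nh mx r t : R) : `|r| <= np * nx -> `|t| <= nh * mx ->
    nh * mx <= nh * (2 * L * nx) ->
    `|- s^-1 * (r + t)| <= s^-1 * (np + nh * (2 * L)) * nx.
  move=> hr ht hm; rewrite normrM normrN [`|s^-1|]gtr0_norm ?invr_gt0// -mulrA.
  rewrite ler_wpM2l ?invr_ge0 ?(ltW s0)//; apply: le_trans (ler_normD _ _) _.
  by rewrite mulrDl -mulrA; exact: lerD hr (le_trans ht hm).
have lM (x : H10 L) : `|l x| <= M * ipnorm (@ipH10 R L) x.
  apply: real_le (cauchy_schwarz ipP _ _) (cauchy_schwarz ipP _ _) _.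
  exact: (ler_wpM2l (n_ge0 NP h) (poincare L0 (H10_inH10 x))).
have [u [_ uP _]] := riesz_on ipP10 (H10_complete L0) (K := setT) (l := l) (M := M) I
  (fun _ _ _ _ => I) (fun _ _ _ => I) (fun _ _ _ _ => I) lD lZ M0 lM.
exists u; apply/is_wderivP => phi tp.
have [hphi dphi] := test_inH10 L0 tp.
have pH : toL2 L phi \in @H10pred R L by apply/asboolP.
have := uP (MkH10 pH) I; rewrite /l /ipH10 /= dphi => E.
have real_eq (x y z w : R) : x = s * y + z -> y = - s^-1 * (z + w) -> x = - w.
  by move=> -> ->; rewrite mulNr mulrN mulrA divff ?gt_eqF//; ring.
apply: (real_eq _ (Re (ip (wderiv u) (toL2 L (cderiv phi)))) _ _ _ E).
rewrite (ripC ipP (toL2 L (cderiv phi))); exact: (ripZDl ipP).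
Qed.

(** Test the equation with [u] itself, apply Cauchy-Schwarz and Poincare, and divide by
    [N (wderiv u)]. *)
Lemma flux_bound (s : R) (u p h : L2) : 0 < s -> inH10 u ->
  is_wderiv (s%:C *: wderiv u + p) h -> s * N (wderiv u) <= N p + 2 * L * N h.
Proof.
move=> s0 hu wF.
have real_le (x y z w r t E : R) : 0 <= x -> 0 <= z -> 0 <= w ->
    E = s * x ^+ 2 + t -> r = - E -> `|r| <= w * y -> `|t| <= z * x ->
    y <= 2 * L * x -> s * x <= z + 2 * L * w.
  move=> x0 z0 w0 -> -> hr ht hy; have [x_eq0|xN0] := eqVneq x 0.
    by rewrite x_eq0 mulr0 addr_ge0// mulr_ge0// mulr_ge0// ltW.
  have xp : 0 < x by rewrite lt_neqAle eq_sym xN0.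
  rewrite -(ler_pM2r xp); have := ler_wpM2l w0 hy.
  have := ler_norm (s * x ^+ 2 + t); have := ler_norm (- t).
  rewrite !normrN in hr *; move: `|t| `|_ + _| ht hr => t' e' ht hr; nra.
have e : Re (ip h u) = - Re (ip (s%:C *: wderiv u + p) (wderiv u)) := green wF hu.
apply: (real_le _ _ _ _ _ _ _ (n_ge0 NP _) (n_ge0 NP _) (n_ge0 NP _) _ e
  (cauchy_schwarz ipP _ _) (cauchy_schwarz ipP p (wderiv u)) (poincare L0 hu)).
rewrite (ripZDl ipP); congr (s * _ + _); exact: (esym (ipnormE ipP _)).
Qed.

End Flux.

(** * The energy operator *)

Lemma add_linear_eq (R : realType) (V : lmodType R[i]) (k : R[i]) (p p1 p2 q q1 q2 : V) :
  p = k *: p1 + p2 -> q = k *: q1 + q2 -> p + q = k *: (p1 + q1) + (p2 + q2).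
Proof. by move=> -> ->; rewrite addrACA scalerDr. Qed.

Lemma sub_linear_eq (R : realType) (V : lmodType R[i]) (k : R[i]) (p p1 p2 q q1 q2 : V) :
  p = k *: p1 + p2 -> q = k *: q1 + q2 -> p - q = k *: (p1 - q1) + (p2 - q2).
Proof. by move=> -> ->; rewrite opprD addrACA scalerBr. Qed.

Lemma Hspace_eq (R : realType) (L : R) (U W : Hspace L) :
  Hu U = Hu W -> Hv U = Hv W -> Hy U = Hy W -> Hz U = Hz W -> U = W.
Proof.
by case: U W => [[u v] [y z]] [[u' v'] [y' z']]; rewrite /Hu /Hv /Hy /Hz /= => -> -> -> ->.
Qed.

Section EnergyOperator.
Variables (R : realType) (L : R).
Hypothesis L0 : 0 < L.
Local Notation C := R[i].
Local Notation Re := (@complex.Re R).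
Local Notation L2 := (L2 L).
Local Notation H := (Hspace L).
Local Notation N := (@normL2 R L).
Local Notation ip := (@ipL2 R L).

Let ipP := @ipL2_inner R L.
Let NP := @normL2_axioms R L.

Variables (a : R) (b c d : R -> R) (Mb Mc Md : R).
Hypotheses (a0 : 0 < a) (bP : multiplier L Mb b) (cP : multiplier L Mc c).
Hypotheses (dP : multiplier L Md d).
Hypotheses (b0 : forall x, 0 <= b x) (d0 : forall x, 0 <= d x).

Local Notation D := (@domA R L a b d).
Local Notation A := (@opA R L a b c d).

Lemma H10_val_insubd (v : L2) : inH10 v -> H10_val (insubd (0 : H10 L) v) = v.
Proof. by move=> hv; apply: insubdK; apply/asboolP. Qed.

Lemma inH10ZD k (v w : L2) : inH10 v -> inH10 w -> inH10 (k *: v + w).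
Proof.
have P (f : L2) : reflect (inH10 f) (f \in @H10pred R L) := asboolP _.
by move=> /P hv /P hw; apply/P; exact: (rpredD (rpredZ k hv) hw).
Qed.

Lemma insubd_H10_ZD k (v w : L2) : inH10 v -> inH10 w ->
  insubd (0 : H10 L) (k *: v + w) =
  k *: insubd (0 : H10 L) v + insubd (0 : H10 L) w.
Proof.
move=> hv hw; apply: val_inj; apply: etrans (H10_val_insubd (inH10ZD k hv hw)) _.
exact: esym (congr2 (fun x y => k *: x + y) (H10_val_insubd hv) (H10_val_insubd hw)).
Qed.

Lemma flux1ZD k (U W : H) : inH10 (Hv U) -> inH10 (Hv W) ->
  flux1 a b (k *: U + W) = k *: flux1 a b U + flux1 a b W.
Proof.
move=> hU hW; rewrite /flux1.
have E1 : wderiv (Hu (k *: U + W)) = k *: wderiv (Hu U) + wderiv (Hu W).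
  exact: wderivH10_ZD.
have E2 : wderiv (Hv (k *: U + W)) = k *: wderiv (Hv U) + wderiv (Hv W).
  exact: (wderivZD k (inH10_inH1 hU) (inH10_inH1 hW)).
rewrite E1 E2; apply: add_linear_eq (mulL2ZD bP k _ _).
by rewrite scalerDr !scalerA mulrC.
Qed.

Lemma flux2ZD k (U W : H) : inH10 (Hz U) -> inH10 (Hz W) ->
  flux2 d (k *: U + W) = k *: flux2 d U + flux2 d W.
Proof.
move=> hU hW; rewrite /flux2.
have E1 : wderiv (Hy (k *: U + W)) = k *: wderiv (Hy U) + wderiv (Hy W).
  exact: wderivH10_ZD.
have E2 : wderiv (Hz (k *: U + W)) = k *: wderiv (Hz U) + wderiv (Hz W).
  exact: (wderivZD k (inH10_inH1 hU) (inH10_inH1 hW)).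
exact: add_linear_eq E1 (etrans (congr1 (mulL2 d) E2) (mulL2ZD dP k _ _)).
Qed.

Lemma domA_0 : D 0.
Proof.
have z : inH10 (0 : L2) := H10_inH10 (0 : H10 L).
(* As [-1 *: 0 + 0 = 0], linearity forces the flux of 0 to vanish. *)
have E (f : H -> L2) : f (-1 *: 0 + 0) = -1 *: f 0 + f 0 -> inH1 (f 0).
  rewrite scaler0 addr0 scaleN1r addNr => ->; exact: inH10_inH1.
by split=> //; apply: E; [exact: flux1ZD|exact: flux2ZD].
Qed.

Lemma opA_linear : linear_on D A.
Proof.
move=> k U W [hv hz hp hq] [hv' hz' hp' hq'].
have Ep := flux1ZD k hv hv'; have Eq := flux2ZD k hz hz'.
split.
  split.
  - exact: (inH10ZD k hv hv').
  - exact: (inH10ZD k hz hz').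
  - by rewrite Ep; exact: (inH1ZD k hp hp').
  - by rewrite Eq; exact: (inH1ZD k hq hq').
have e1 := insubd_H10_ZD k hv hv'; have e3 := insubd_H10_ZD k hz hz'.
have e2 := sub_linear_eq (etrans (congr1 (@wderiv R L) Ep) (wderivZD k hp hp'))
  (mulL2ZD cP k (Hz U) (Hz W)).
have e4 := add_linear_eq (etrans (congr1 (@wderiv R L) Eq) (wderivZD k hq hq'))
  (mulL2ZD cP k (Hv U) (Hv W)).
by apply: Hspace_eq; [exact: e1|exact: e2|exact: e3|exact: e4].
Qed.

(** Puts [flux2] into the shape of [flux1], so that the lemmas on one flux apply with [s = 1]. *)
Lemma flux2E (U : H) : flux2 d U = 1%:C *: wderiv (Hy U) + mulL2 d (wderiv (Hz U)).
Proof. by congr (_ + _); exact/esym/scale1r. Qed.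

Lemma opA_dissipative (U : H) : D U -> Re (ipH a (A U) U) <= 0.
Proof.
have real_le (x1 x2 x3 x4 f1 f2 p r t : R) : x1 = f1 - t -> x2 = p -> x3 = f2 + t ->
    x4 = r -> f1 + a * p <= 0 -> f2 + 1 * r <= 0 -> x1 + a * x2 + x3 + x4 <= 0.
  by move=> -> -> -> -> h1 h2; lra.
move=> [hv hz hp hq]; rewrite ipH_ReE.
have e1 := flux_energy bP b0 hv hp.
have e2 : Re (ip (wderiv (flux2 d U)) (Hz U)) +
    1 * Re (ip (wderiv (Hz U)) (wderiv (Hy U))) <= 0.
  by rewrite flux2E in hq *; exact: flux_energy dP d0 hz hq.
apply: (real_le _ _ _ _ _ _ _ _ (Re (ip (mulL2 c (Hz U)) (Hv U))) _ _ _ _ e1 e2).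
- exact: (ripBl ipP).
- exact: (congr1 (fun w => Re (ip (wderiv w) (wderiv (Hu U)))) (H10_val_insubd hv)).
- have -> : Re (ip (mulL2 c (Hz U)) (Hv U)) = Re (ip (mulL2 c (Hv U)) (Hz U)).
    by rewrite (mulL2_sym cP) (ripC ipP).
  exact: (ripDl ipP).
- exact: (congr1 (fun w => Re (ip (wderiv w) (wderiv (Hy U)))) (H10_val_insubd hz)).
Qed.

(** [v = f1] and [z = f3] are forced and already lie in H_0^1. The damping and coupling terms then
    become data of two separate problems for [u] and [y]. *)
Lemma opA_surj (F : H) : exists2 U, D U & A U = F.
Proof.
case: F => [[f1 f2] [f3 f4]].
have [u hu] := flux_solve L0 (mulL2 b (wderiv f1)) (f2 + mulL2 c (f3 : L2)) a0.
have [y hy] := flux_solve L0 (mulL2 d (wderiv f3)) (f4 - mulL2 c (f1 : L2)) ltr01.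
pose U : H := ((u, f1 : L2), (y, f3 : L2)).
have hy' : is_wderiv (flux2 d U) (f4 - mulL2 c f1) by rewrite flux2E.
exists U.
  split; [exact: H10_inH10|exact: H10_inH10|by exists (f2 + mulL2 c f3)|].
  by exists (f4 - mulL2 c f1).
have Kd (f : H10 L) : insubd (0 : H10 L) (f : L2) = f := valKd _ f.
apply: Hspace_eq; [exact: Kd| |exact: Kd|].
  exact: etrans (congr1 (fun x => x - mulL2 c f3) (wderivE hu)) (addrK _ _).
exact: etrans (congr1 (fun x => x + mulL2 c f1) (wderivE hy')) (subrK _ _).
Qed.

(** Here [q] is the square root of [a], [l = 2 * L], and [nb], [nc], [nd] bound the coefficients;
    [n] and [m] are the energy norms of [A U] and [U]; [V], [Z] are norms of [v], [z], primes denote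
    derivatives, and [h1], [h2] are norms of the flux derivatives. Successive substitution produces
    the constant. *)
Lemma energy_bound_real (q l nb nc nd n V V' Z Z' U' Y' h1 h2 m : R) :
  0 < q -> 0 <= l -> 0 <= nb -> 0 <= nc -> 0 <= nd ->
  V <= l * V' -> Z <= l * Z' -> q * V' <= n -> Z' <= n ->
  h1 <= n + nc * Z -> h2 <= n + nc * V ->
  q ^+ 2 * U' <= nb * V' + l * h1 -> 1 * Y' <= nd * Z' + l * h2 ->
  m <= V + q * U' + Z + Y' ->
  m <= (l * q^-1 + q^-1 * (nb * q^-1 + l * (1 + nc * l)) + l +
        (nd + l * (1 + nc * (l * q^-1)))) * n.
Proof.
move=> q0 l0 nb0 nc0 nd0 hV hZ hV' hZ' e1 e2 eU eY hm.
have {}hV' : V' <= q^-1 * n by rewrite ler_pdivlMl.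
have {}hV := le_trans hV (ler_wpM2l l0 hV'); have {}hZ := le_trans hZ (ler_wpM2l l0 hZ').
have {}e1 := le_trans e1 (lerD (lexx n) (ler_wpM2l nc0 hZ)).
have {}e2 := le_trans e2 (lerD (lexx n) (ler_wpM2l nc0 hV)).
have {}eU := le_trans eU (lerD (ler_wpM2l nb0 hV') (ler_wpM2l l0 e1)).
have {}eY := le_trans eY (lerD (ler_wpM2l nd0 hZ') (ler_wpM2l l0 e2)).
rewrite mul1r in eY; rewrite expr2 -mulrA -ler_pdivlMl// in eU.
apply: le_trans hm (le_trans (lerD (lerD (lerD hV eU) hZ) eY) _).
by rewrite le_eqVlt; apply/orP; left; apply/eqP; ring.
Qed.

(** [A U] contains [v] and [z] as H_0^1 components, so it bounds [v_x] and [z_x], then [v] and [z]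
    by Poincare, then the flux derivatives, and finally [u_x] and [y_x] by [flux_bound]. *)
Lemma opA_bound : exists2 K, 0 < K & forall U, D U -> normH a U <= K * normH a (A U).
Proof.
pose q := Num.sqrt a; have q0 : 0 < q by rewrite sqrtr_gt0.
have l0 : 0 < 2 * L by rewrite mulr_gt0.
have [nb0 nc0 nd0] := And3 (multiplier_ge0 bP) (multiplier_ge0 cP) (multiplier_ge0 dP).
exists (2 * L * q^-1 + q^-1 * (Mb * q^-1 + 2 * L * (1 + Mc * (2 * L))) + 2 * L +
        (Md + 2 * L * (1 + Mc * (2 * L * q^-1)))).
  have r0 : 0 < q^-1 by rewrite invr_gt0.
  have p1 := mulr_gt0 l0 r0.
  have p2 := mulr_ge0 (ltW l0) (addr_ge0 ler01 (mulr_ge0 nc0 (ltW l0))).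
  have p3 := mulr_ge0 (ltW l0) (addr_ge0 ler01 (mulr_ge0 nc0 (ltW p1))).
  have p4 := mulr_ge0 (ltW r0) (addr_ge0 (mulr_ge0 nb0 (ltW r0)) p2).
  exact: ltr_pwDl (addr_gt0 (ltr_pwDl p1 p4) l0) (addr_ge0 nd0 p3).
move=> U [hv hz hp hq].
have [g1 g2 g3 g4] := normH_ge L0 a0 (A U).
have {}g2 : q * N (wderiv (Hv U)) <= normH a (A U).
  by apply: le_trans g2; rewrite [Hu _]/(insubd _ _) (H10_val_insubd hv).
have {}g4 : N (wderiv (Hz U)) <= normH a (A U).
  by apply: le_trans g4; rewrite [Hy _]/(insubd _ _) (H10_val_insubd hz).
have tri (x y z : L2) (n k : R) : x = z - y \/ x = z + y -> N x <= n -> N y <= k ->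
    N z <= n + k.
  move=> xE xn yk; apply: le_trans (lerD xn yk).
  case: xE => ->.
    by have := nD NP (z - y) y; rewrite subrK.
  by have := nD NP (z + y) (- y); rewrite addrK (nN NP).
apply: (energy_bound_real q0 (ltW l0) nb0 nc0 nd0 (poincare L0 hv) (poincare L0 hz)
  g2 g4 _ _ _ _ (normH_le L0 a0 U)).
- exact: (tri _ _ _ _ _ (or_introl erefl) g1 (normL2_mulL2 cP (Hz U))).
- exact: (tri _ _ _ _ _ (or_intror erefl) g3 (normL2_mulL2 cP (Hv U))).
- rewrite /q sqr_sqrtr; last exact: ltW.
  apply: le_trans (flux_bound L0 a0 (H10_inH10 (Hu U)) (wderivP hp)) _.
  exact: lerD (normL2_mulL2 bP _) (lexx _).
- rewrite flux2E in hq *.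
  apply: le_trans (flux_bound L0 ltr01 (H10_inH10 (Hy U)) (wderivP hq)) _.
  exact: lerD (normL2_mulL2 dP _) (lexx _).
Qed.

End EnergyOperator.

Lemma multiplier_ind (R : realType) (L m0 m1 m2 : R) :
  multiplier L `|m0| (ind m0 m1 m2).
Proof.
split.
  apply: measurable_funM; first exact: measurable_cst.
  by apply: measurable_indic; exact: measurable_itv.
move=> x; rewrite /ind normrM ler_piMr// indicE; case: (_ \in _) => /=.
  by rewrite normr1.
by rewrite normr0.
Qed.

Lemma ind_ge0 (R : realType) (m0 m1 m2 : R) : 0 < m0 -> forall x, 0 <= ind m0 m1 m2 x.
Proof. by move=> m0P x; rewrite /ind indicE mulr_ge0 ?ler0n ?(ltW m0P). Qed.

(** Extracts what the energy argument asks of the coefficients: measurability and boundedness of all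
    three, and nonnegative damping. The coupling [c] may have either sign. *)
Lemma case_multipliers (R : realType) (L : R) (b c d : R -> R) :
  caseC1 L b c d \/ caseC2 L b c d \/ caseC3 L b c d ->
  (exists Mb Mc Md, [/\ multiplier L Mb b, multiplier L Mc c & multiplier L Md d]) /\
  (forall x, 0 <= b x) /\ (forall x, 0 <= d x).
Proof.
have M := @multiplier_ind R L.
have M0 : multiplier L 0 (cst 0) by split; [exact: measurable_cst|move=> x; rewrite normr0].
move=> [|[|]].
- move=> [m0 [m1 [m2 [n0 [n1 [n2 [p0 [p1 [p2 [[m0P _ p0P] _ _ [-> -> ->]]]]]]]]]]].
  split; last by split; exact: ind_ge0.
  by exists `|m0|, `|n0|, `|p0|; split; exact: M.
- move=> [m0 [m1 [m2 [n0 [n1 [n2 [p0 [p1 [p2 [[m0P _ p0P] _ _ [-> -> ->]]]]]]]]]]].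
  split; last by split; exact: ind_ge0.
  by exists `|m0|, `|n0|, `|p0|; split; exact: M.
- move=> [m0 [m1 [m2 [n0 [n1 [n2 [[m0P _] _ [-> -> ->]]]]]]]].
  split; last by split => //; exact: ind_ge0.
  by exists `|m0|, `|n0|, 0; split; [exact: M|exact: M|exact: M0].
Qed.

Theorem theorem2p2 (R : realType) (L a : R) (b c d : R -> R) :
  0 < L -> 0 < a ->
  caseC1 L b c d \/ caseC2 L b c d \/ caseC3 L b c d ->
  let N := @normH R L a in
  let D := @domA R L a b d in
  let A := @opA R L a b c d in
  (exists T : R -> Hspace L -> Hspace L, generated_by N D A T) /\
  forall T : R -> Hspace L -> Hspace L, generated_by N D A T ->
    (forall U0 : Hspace L,
       weak_solution N D A U0 (fun t => T t U0) /\
       forall U, weak_solution N D A U0 U -> forall t, 0 <= t -> U t = T t U0) /\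
    (forall U0 : Hspace L, D U0 ->
       strong_solution N D A U0 (fun t => T t U0) /\
       forall U, strong_solution N D A U0 U ->
         forall t, 0 <= t -> U t = T t U0).
Proof.
move=> L0 a0 /case_multipliers[[Mb [Mc [Md [bP cP dP]]]] [b0 d0]] N D A.
have [K K0 bd] := opA_bound L0 a0 bP cP dP.
have D0 : D 0 := domA_0 _ bP dP.
have Alin : linear_on D A by exact: opA_linear bP cP dP.
have Adis (U : Hspace L) : D U -> complex.Re (ipH a (A U) U) <= 0.
  exact: opA_dissipative bP cP dP b0 d0 _.
have Asurj : forall F, exists2 U, D U & A U = F by exact: opA_surj.
exact (dissipative_wellposed (ipH_inner L0 a0) (Hspace_complete L0 a0)
  D0 Alin Adis Asurj K0 bd).
Qed.
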